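(* Let $\tau\in[0,1]$. (i) (Elliptic Ginibre matrix) Let $X^{\mathrm e}=X^{\mathrm e}_N$ be the elliptic Ginibre matrix of size $N$ with parameter $\tau$. Then, almost surely, $$\lim_{N\to\infty} d_H\big(W(X^{\mathrm e}),E_{a,b}\big)=0,\qquad a=\sqrt{2(1+\tau)},\quad b=\sqrt{2(1-\tau)}.$$ (ii) (Chiral elliptic Ginibre matrix) Let $X^{\mathrm{ce}}=X^{\mathrm{ce}}_N$ be the chiral elliptic Ginibre matrix of size $2N+\nu$ with parameter $\tau$, where the non-negative integers $\nu=\nu_N$ satisfy $\lim_{N\to\infty}\nu/N=\alpha\in[0,\infty)$. Then, almost surely, $$\lim_{N\to\infty} d_H\big(W(X^{\mathrm{ce}}),E_{a,b}\big)=0,\qquad a=\frac{\sqrt{1+\tau}\,(\sqrt{1+\alpha}+1)}{\sqrt2},\quad b=\frac{\sqrt{1-\tau}\,(\sqrt{1+\alpha}+1)}{\sqrt2}.$$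
   Context: Numerical range: for $A\in\mathbb{C}^{m\times m}$, $W(A)=\{(Ay,y): y\in\mathbb{C}^m,\ \|y\|_2=1\}\subset\mathbb{C}$. Hausdorff distance: for subsets $X,Y$ of $\mathbb{C}$, $d_H(X,Y)=\max\{\sup_{x\in X}d(x,Y),\ \sup_{y\in Y}d(X,y)\}$. We identify $\mathbb{C}$ with $\mathbb{R}^2$. Ellipse: for $a,b>0$, $E_{a,b}=\{(x,y)\in\mathbb{R}^2:(x/a)^2+(y/b)^2\le 1\}$. In the degenerate case $a>0$, $b=0$, set $E_{a,0}=[-a,a]\times\{0\}$. Complex Gaussian variables are circularly symmetric: ''complex Gaussian of mean zero and variance $\sigma^2$'' means that the real and imaginary parts are independent real centred Gaussians of variance $\sigma^2/2$ each. Complex Ginibre matrix $G$ of size $N$: an $N\times N$ matrix with i.i.d. complex Gaussian entries of mean zero and variance $1/N$. Elliptic Ginibre matrix with parameter $\tau\in[0,1]$: $$X^{\mathrm e}=\frac{\sqrt{1+\tau}}{2}(G+G^* )+\frac{\sqrt{1-\tau}}{2}(G-G^* ).$$ Chiral elliptic Ginibre matrix: let $P,Q$ be independent $N\times(N+\nu)$ random matrices with independent complex Gaussian entries of mean zero and variance $1/(2N)$, and set $$X_1=\sqrt{1+\tau}\,P+\sqrt{1-\tau}\,Q,\qquad X_2=\sqrt{1+\tau}\,P-\sqrt{1-\tau}\,Q,\qquad X^{\mathrm{ce}}=\begin{bmatrix} 0 & X_1 \\ {} X_2^* & 0 \end{bmatrix},$$ so that $X^{\mathrm{ce}}$ is a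 $(2N+\nu)\times(2N+\nu)$ matrix. The matrices for different $N$ are all defined on a common probability space. *)

(* Defs.v *)
From HB Require Import structures.
From mathcomp Require Import all_boot all_order all_algebra.
From mathcomp Require Import all_classical all_reals all_analysis.
From mathcomp Require Export complex.

Set Implicit Arguments.
Unset Strict Implicit.
Unset Printing Implicit Defensive.

Import Order.TTheory GRing.Theory Num.Theory.
Import numFieldNormedType.Exports.

Local Open Scope classical_set_scope.
Local Open Scope ring_scope.
Local Open Scope complex_scope.
Local Open Scope sesquilinear_scope.

Section Geometry.
Context {R : realType}.

(* The Euclidean distance on the plane; the norm of the product type R * R
   in MathComp-Analysis is the max norm, so it is not used here. *)
Definition cdist (z w : R[i]) : R := Normc.normc (z - w).

Definition dist_set (z : R[i]) (Y : set R[i]) : \bar R :=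
  ereal_inf [set (cdist z w)%:E | w in Y].

(* Extended-real valued, so that it is total; it is finite on nonempty bounded
   sets. *)
Definition hausdorff_dist (X Y : set R[i]) : \bar R :=
  maxe (ereal_sup [set dist_set x Y | x in X])
       (ereal_sup [set dist_set y X | y in Y]).

Definition l2norm (m : nat) (y : 'cV[R[i]]_m) : R :=
  Num.sqrt (\sum_(i < m) Normc.normc (y i 0) ^+ 2).

Definition inner (m : nat) (x y : 'cV[R[i]]_m) : R[i] :=
  \sum_(i < m) x i 0 * (y i 0)^*.

Definition numerical_range (m : nat) (A : 'M[R[i]]_m) : set R[i] :=
  [set inner (A *m y) y | y in [set y | l2norm y = 1]].

(* The degenerate case is separate because x / 0 = 0 in MathComp. *)
Definition ellipse (a b : R) : set R[i] :=
  if b == 0 then [set z | - a <= complex.Re z <= a /\ complex.Im z = 0]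
  else [set z | (complex.Re z / a) ^+ 2 + (complex.Im z / b) ^+ 2 <= 1].

End Geometry.

Section Probability.
Context {R : realType} {d : measure_display} {T : measurableType d}.
Variable Pr : probability T R.

Definition indep2 (F G : set_system T) : Prop :=
  forall A B, F A -> G B -> Pr (A `&` B) = (Pr A * Pr B)%E.

Definition mutual_indep (I : finType) (F : I -> set_system T) : Prop :=
  forall (J : {set I}) (A : I -> set T), (forall i, i \in J -> F i (A i)) ->
    Pr (\bigcap_(i in [set` J]) A i) = (\prod_(i in J) Pr (A i))%E.

(* The sigma-algebra generated by Z, with C identified with R * R. *)
Definition sigma_complex (Z : T -> R[i]) : set_system T :=
  g_sigma_algebra_preimage (fun w => (complex.Re (Z w), complex.Im (Z w))).

Definition sigma_mx (m n : nat) (M : T -> 'M[R[i]]_(m, n)) : set_system T :=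
  <<s \bigcup_(ij in [set: 'I_m * 'I_n])
        sigma_complex (fun w => M w ij.1 ij.2) >>.

(* The equality of laws is restricted to measurable sets: both sides take
   junk values elsewhere. *)
Definition real_gaussian (v : R) (X : {RV Pr >-> R}) : Prop :=
  forall B : set R, measurable B ->
    distribution Pr X B = normal_prob 0 (Num.sqrt v) B.

Definition complex_gaussian (v : R) (Z : T -> R[i]) : Prop :=
  exists X Y : {RV Pr >-> R},
    [/\ Z = (fun w => X w +i* Y w),
        real_gaussian (v / 2) X, real_gaussian (v / 2) Y
      & indep2 (g_sigma_algebra_preimage X) (g_sigma_algebra_preimage Y)].

Definition gaussian_mx (v : R) (m n : nat) (M : T -> 'M[R[i]]_(m, n)) : Prop :=
  (forall i j, complex_gaussian v (fun w => M w i j)) /\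
  mutual_indep (fun ij : 'I_m * 'I_n =>
                  sigma_complex (fun w => M w ij.1 ij.2)).

Definition ginibre (N : nat) (G : T -> 'M[R[i]]_N) : Prop :=
  gaussian_mx (N%:R^-1) G.

End Probability.

Section Models.
Context {R : realType}.

Definition elliptic_mx (tau : R) (N : nat) (G : 'M[R[i]]_N) : 'M[R[i]]_N :=
  (Num.sqrt (1 + tau) / 2)%:C *: (G + G ^t*) +
  (Num.sqrt (1 - tau) / 2)%:C *: (G - G ^t*).

(* The size 2N + nu is written N + (N + nu). *)
Definition chiral_elliptic_mx (tau : R) (N nu : nat)
    (P Q : 'M[R[i]]_(N, N + nu)) : 'M[R[i]]_(N + (N + nu)) :=
  let X1 := (Num.sqrt (1 + tau))%:C *: P + (Num.sqrt (1 - tau))%:C *: Q in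
  let X2 := (Num.sqrt (1 + tau))%:C *: P - (Num.sqrt (1 - tau))%:C *: Q in
  block_mx 0 X1 (X2 ^t*) 0.

End Models.

(* Main.v *)
(* By the separation theorem and the convexity of the numerical range
   (Toeplitz-Hausdorff), Hausdorff convergence reduces to almost sure convergence
   of the support functions in integer directions, that is, of the largest
   eigenvalue of the Hermitian part of a complex multiple of X. For X^e this
   Hermitian part is a GUE matrix, and for X^ce it is the block matrix
   [0, Y; Y^*, 0] with Y a rectangular Ginibre matrix; only their variances
   depend on the direction and on tau. Gaussian integration by parts gives
   recursive loop equations for the mixed moments of the traces of such matrices,
   whose large N limit is the moment recursion of the semicircle and
   Marchenko-Pastur laws, with corrections of order N^-2. In fixed degree this
   bounds the variances of normalised traces by O(N^-2), hence they converge
   almost surely, and trace inequalities bound the largest eigenvalue from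
   below. In degree 2^k of order N^(1/2) an explicit supersolution of the
   recursion bounds the moments, and Markov's inequality bounds the largest
   eigenvalue from above. *)
Require Import Defs.
From mathcomp Require Import all_boot all_order all_algebra.
From mathcomp Require Import all_classical all_reals all_analysis.
From HB Require Import structures.
From mathcomp Require Import measurable_realfun.
From mathcomp Require mpoly.
Import -(notations) mpoly.
From mathcomp Require Import ring lra zify.
Import Order.TTheory GRing.Theory Num.Theory.
Import numFieldNormedType.Exports.
Local Open Scope classical_set_scope.
Local Open Scope ring_scope.

Set Implicit Arguments.
Unset Strict Implicit.
Unset Printing Implicit Defensive.

(** * The moment recursion *)

(** Everything is read off from traces, without eigenvalues. Repeated use of Cauchy-Schwarz bounds a
    Rayleigh quotient by the trace of a power, and each use doubles the degree: hence the powers of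
    two. A level above the limiting edge is excluded when a fixed ratio below 1, raised to the
    degree n, beats powers of N; the loop equations tolerate this while n^3 / N^2 is small, and n of
    order N^(1/2) meets both demands. All coefficients of the recursions are nonnegative, so
    subsolutions and supersolutions are compared by plain induction. Almost sure convergence comes
    from second moments of order N^-2, which are summable; no relation between the matrices of
    different sizes enters. Countably many directions keep the exceptional set null, hence the
    integer vectors. Integration by parts is done on formal polynomials, where it is an algebraic
    identity of a linear functional; measure theory enters only to identify this functional with the
    expectation. *)

Section MomentRecursion.
Context {R : realFieldType}.
Implicit Types (e a n : nat) (s : seq nat) (beta q : R) (M : seq nat -> R) (m : nat -> R).

Definition del (i : nat) (s : seq nat) : seq nat := take i s ++ drop i.+1 s.

Lemma perm_del i s : (i < size s)%N -> perm_eq s (nth 0%N s i :: del i s).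
Proof.
move=> lt_is; rewrite -{1}(cat_take_drop i s) (drop_nth 0%N lt_is).
by rewrite perm_catC /= perm_cons perm_catC.
Qed.

Lemma sumn_del i s : (i < size s)%N -> sumn s = (nth 0 s i + sumn (del i s))%N.
Proof. by move=> /perm_del/perm_sumn ->. Qed.

Lemma size_del i s : (i < size s)%N -> size s = (size (del i s)).+1.
Proof. by move=> /perm_del/perm_size ->. Qed.

Lemma prod_del (f : nat -> R) i s : (i < size s)%N ->
  \prod_(a <- s) f a = f (nth 0%N s i) * \prod_(a <- del i s) f a.
Proof. by move=> lt_is; rewrite (perm_big _ (perm_del lt_is)) big_cons. Qed.

Lemma sumn_nth s : sumn s = (\sum_(i < size s) nth 0 s i)%N.
Proof. by rewrite sumnE (big_nth 0%N) big_mkord. Qed.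

(* The loop equations for the mixed moments of the normalised traces of a
   Gaussian matrix: [e = 1], [beta = 0] for the powers of a Hermitian matrix
   and [e = 0], [beta = nu / N] for the powers of [Y Y^*]; [q] is [N ^- 2]. *)
Definition trace_rec e beta q M : Prop :=
  [/\ M [::] = 1, forall s, M (0%N :: s) = M s &
      forall a s, M (a.+1 :: s) = beta * M (a :: s)
        + \sum_(j < a.+1 - e) M [:: (j : nat), (a - e - j)%N & s]
        + q * \sum_(i < size s)
            (nth 0%N s i)%:R * M ((a + nth 0 s i - e)%N :: del i s)].

(** For [e = 1], [beta = 0] the solution is the moment sequence of the semicircle law on [-2, 2];
    for [e = 0] it is that of the Marchenko-Pastur law of ratio [1 + beta], and the Catalan numbers
    when moreover [beta = 0]. *)
Definition mom_rec e beta m : Prop :=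
  m 0%N = 1 /\ forall a, m a.+1 = beta * m a
     + \sum_(j < a.+1 - e) m j * m (a - e - j)%N.

Lemma mom_rec_trace_rec e beta m : mom_rec e beta m ->
  trace_rec e beta 0 (fun s => \prod_(a <- s) m a).
Proof.
move=> [m0 mS]; split=> [|s|a s]; first by rewrite big_nil.
  by rewrite big_cons m0 mul1r.
rewrite !big_cons mS mul0r addr0 mulrDl mulrA; congr (_ + _).
by rewrite mulr_suml; apply: eq_bigr => j _; rewrite !big_cons mulrA.
Qed.

Lemma mom_rec_ge0 e beta m : 0 <= beta -> mom_rec e beta m -> forall a, 0 <= m a.
Proof.
move=> b0 [m0 mS]; elim/ltn_ind => -[|a] IH; first by rewrite m0.
rewrite mS addr_ge0 ?mulr_ge0 ?IH//; apply: sumr_ge0 => j _.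
by have hj := ltn_ord j; apply: mulr_ge0; apply: IH; lia.
Qed.

(** A split lowers the sum by at least one but lengthens the list by one, and removing a zero only
    shortens it; the factor 2 makes both decreases strict. *)
Definition weight s : nat := (2 * sumn s + size s)%N.

Lemma weight_ind (P : seq nat -> Prop) :
  (forall s, (forall t, (weight t < weight s)%N -> P t) -> P s) -> forall s, P s.
Proof.
move=> H s; move: {2}(weight s) (leqnn (weight s)) => n; elim: n s => [|n IH] s hs.
  by apply: H => t; lia.
by apply: H => t ht; apply: IH; lia.
Qed.

Lemma weight_split e a j s : (j < a.+1 - e)%N ->
  (weight [:: j, (a - e - j)%N & s] < weight (a.+1 :: s))%N.
Proof. rewrite /weight /=; lia. Qed.

Lemma weight_merge e a i s : (i < size s)%N ->
  (weight ((a + nth 0 s i - e)%N :: del i s) < weight (a.+1 :: s))%N.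
Proof.
move=> lt_is; rewrite /weight /= (sumn_del lt_is) (size_del lt_is); lia.
Qed.

Lemma trace_rec_ge0 e beta q M : 0 <= beta -> 0 <= q -> trace_rec e beta q M ->
  forall s, 0 <= M s.
Proof.
move=> b0 q0 [M0 Mz MS]; elim/weight_ind => -[|[|a] s] IH; first by rewrite M0.
  by rewrite Mz IH// /weight /=; lia.
rewrite MS addr_ge0 ?addr_ge0 ?mulr_ge0 ?IH//.
- by rewrite /weight /=; lia.
- by apply: sumr_ge0 => j _; apply: IH; apply: weight_split.
- by apply: sumr_ge0 => i _; rewrite mulr_ge0// IH// weight_merge.
Qed.

(** The terms in [q] are nonnegative; dropping them leaves the recursion that the product of moments
    solves, and the other coefficients are nonnegative too. *)
Lemma trace_rec_ge_prod e beta q M m : 0 <= beta -> 0 <= q ->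
  trace_rec e beta q M -> mom_rec e beta m ->
  forall s, \prod_(a <- s) m a <= M s.
Proof.
move=> b0 q0 MR mR; have [P0 Pz PS] := mom_rec_trace_rec mR.
have M_ge0 := trace_rec_ge0 b0 q0 MR; case: MR => M0 Mz MS.
elim/weight_ind => -[|[|a] s] IH; first by rewrite M0 P0.
  by rewrite Mz Pz IH// /weight /=; lia.
rewrite MS PS lerD ?lerD//.
- by rewrite ler_wpM2l// IH// /weight /=; lia.
- by apply: ler_sum => j _; apply: IH; apply: weight_split.
- by rewrite mul0r mulr_ge0//; apply: sumr_ge0 => i _; rewrite mulr_ge0.
Qed.

(** The merging sum has total multiplicity [sumn s]. Zero entries have coefficient 0, so [F] is
    controlled at positive entries only; there, for [e <= 1], the truncated degree of a merged trace
    is the true one. *)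
Lemma sum_nth_le n s (F : nat -> R) (B : R) : 0 <= B -> (sumn s <= n)%N ->
  (forall i, (i < size s)%N -> (0 < nth 0 s i)%N -> F i <= B) ->
  \sum_(i < size s) (nth 0%N s i)%:R * F i <= n%:R * B.
Proof.
move=> B0 hs HF; apply: (@le_trans _ _ ((sumn s)%:R * B)).
  rewrite sumn_nth natr_sum mulr_suml ler_sum// => i _.
  by have [->|si0] := posnP (nth 0%N s i); rewrite ?mul0r // ler_wpM2l ?HF.
by rewrite ler_wpM2r// ler_nat.
Qed.

Lemma sum_ord_le (k n : nat) (F : nat -> R) (B : R) : 0 <= B -> (k <= n)%N ->
  (forall j, (j < k)%N -> F j <= B) -> \sum_(j < k) F j <= n%:R * B.
Proof.
move=> B0 kn HF; apply: (@le_trans _ _ (\sum_(j < k) B)).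
  by apply: ler_sum => j _; apply: HF.
by rewrite sumr_const card_ord -[B *+ k]mulr_natl ler_wpM2r// ler_nat.
Qed.

Lemma trace_rec_bounded e (B : R) n : 0 <= B -> exists2 Q, 0 <= Q &
  forall beta q M, 0 <= beta <= B -> 0 <= q <= 1 -> trace_rec e beta q M ->
  forall s, (weight s <= n)%N -> M s <= Q.
Proof.
move=> B0; elim: n => [|n [Q Q0 IH]].
  by exists 1 => // beta q M _ _ [M0 _ _] [|a s]; rewrite ?M0// /weight /=; lia.
have T0 : 0 <= B * Q + n.+1%:R * Q + 1 * (n.+1%:R * Q).
  by rewrite !addr_ge0 ?mulr_ge0.
exists (1 + Q + (B * Q + n.+1%:R * Q + 1 * (n.+1%:R * Q))); first by lra.
move=> beta q M hb hq MR s hs; have IH' := IH _ _ _ hb hq MR.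
have /andP[b0 bB] := hb; have /andP[q0 q1] := hq.
have M_ge0 := trace_rec_ge0 b0 q0 MR; case: MR => M0 Mz MS.
case: s hs => [|[|a] s] hs; first by rewrite M0; lra.
  suff : M s <= Q by rewrite Mz; lra.
  by apply: IH'; move: hs; rewrite /weight /=; lia.
have h1 t : (weight t < weight (a.+1 :: s))%N -> M t <= Q.
  by move=> ht; apply: IH'; lia.
have -> : M (a.+1 :: s) = 0 + M (a.+1 :: s) by rewrite add0r.
rewrite lerD//; first lra.
rewrite MS !lerD//.
- by rewrite ler_pM// h1// /weight /=; lia.
- apply: (@sum_ord_le _ _ (fun j => M [:: j, (a - e - j)%N & s])) => //.
    by move: hs; rewrite /weight /=; lia.
  by move=> j hj; apply: h1; apply: weight_split.
- rewrite ler_pM//; first by apply: sumr_ge0 => i _; rewrite mulr_ge0.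
  apply: (@sum_nth_le _ _ (fun i => M ((a + nth 0 s i - e)%N :: del i s))) => //.
    by move: hs; rewrite /weight /=; lia.
  by move=> i hi _; apply: h1; apply: weight_merge.
Qed.

(** The terms in [q] are bounded crudely by [trace_rec_bounded]; all other errors are inherited with
    bounded coefficients. [K] is chosen before [beta], [q] and [M], so it is uniform in the size of
    the matrix. *)
Lemma trace_rec_le_prod e (B : R) n : 0 <= B -> exists2 K, 0 <= K &
  forall beta q M m, 0 <= beta <= B -> 0 <= q <= 1 -> trace_rec e beta q M ->
  mom_rec e beta m ->
  forall s, (weight s <= n)%N -> M s <= \prod_(a <- s) m a + K * q.
Proof.
move=> B0; elim: n => [|n [K K0 IH]].
  exists 0 => // beta q M m _ _ [M0 _ _] _ [|a s]; rewrite ?M0 ?big_nil ?mul0r ?addr0//.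
  by rewrite /weight /=; lia.
have [Q Q0 HQ] := trace_rec_bounded e n.+1 B0.
exists (K + (B * K + n.+1%:R * K + n.+1%:R * Q)).
  by rewrite !addr_ge0 ?mulr_ge0.
move=> beta q M m hb hq MR mR s hs; have IH' := IH _ _ _ _ hb hq MR mR.
have {}HQ := HQ _ _ _ hb hq MR.
have /andP[b0 bB] := hb; have /andP[q0 q1] := hq.
have M_ge0 := trace_rec_ge0 b0 q0 MR.
have [P0 Pz PS] := mom_rec_trace_rec mR; case: MR => M0 Mz MS.
have T0 : 0 <= (B * K + n.+1%:R * K + n.+1%:R * Q) * q.
  by rewrite mulr_ge0// !addr_ge0 ?mulr_ge0.
have T1 : 0 <= K * q by rewrite mulr_ge0.
case: s hs => [|[|a] s] hs; first by rewrite M0 P0 mulrDl; lra.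
  suff : M s <= \prod_(a <- s) m a + K * q by rewrite Mz Pz mulrDl; lra.
  by apply: IH'; clear -hs; move: hs; rewrite /weight /=; lia.
have h1 t : (weight t < weight (a.+1 :: s))%N -> M t <= \prod_(a <- t) m a + K * q.
  by move=> ht; apply: IH'; rewrite -ltnS; exact: leq_trans ht hs.
have ha : (a < n.+1)%N by clear -hs; move: hs; rewrite /weight /=; lia.
have hsum : (sumn s <= n.+1)%N by clear -hs; move: hs; rewrite /weight /=; lia.
have t1 : beta * M (a :: s) <= beta * \prod_(a <- a :: s) m a + B * (K * q).
  apply: (@le_trans _ _ (beta * (\prod_(a <- a :: s) m a + K * q))).
    by rewrite ler_wpM2l// h1// /weight /=; clear; lia.
  by rewrite mulrDr lerD2l ler_wpM2r.
have t2 : \sum_(j < a.+1 - e) M [:: (j : nat), (a - e - j)%N & s] <=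
   \sum_(j < a.+1 - e) \prod_(a <- [:: (j : nat), (a - e - j)%N & s]) m a
    + n.+1%:R * (K * q).
  apply: (@le_trans _ _ (\sum_(j < a.+1 - e)
     (\prod_(a <- [:: (j : nat), (a - e - j)%N & s]) m a + K * q))).
    by apply: ler_sum => j _; apply: h1; apply: weight_split.
  rewrite big_split/= lerD2l; apply: (@sum_ord_le _ _ (fun=> K * q)) => //; clear -ha; lia.
have t3 : q * \sum_(i < size s) (nth 0%N s i)%:R * M ((a + nth 0 s i - e)%N :: del i s)
    <= q * (n.+1%:R * Q).
  rewrite ler_wpM2l//.
  apply: (@sum_nth_le _ _ (fun i => M ((a + nth 0 s i - e)%N :: del i s))) => //.
  move=> i hi _; apply: HQ; have := @weight_merge e a i s hi; clear -hs => h.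
  by rewrite -ltnS; exact: leq_trans h (leqW hs).
move: (PS a s) (MS a s) t1 t2 t3; rewrite mul0r addr0 => -> ->.
set X := beta * \prod_(_ <- _) _; set Y := \sum_(_ < _) \prod_(_ <- _) _.
rewrite !mulrDl; nra.
Qed.

(** The table of earlier values turns the course-of-values recursion into a structural one. *)
Fixpoint mom_tab e beta n : seq R :=
  if n is n'.+1 then
    let t := mom_tab e beta n' in
    rcons t (beta * nth 0 t n' + \sum_(j < n'.+1 - e) nth 0 t j * nth 0 t (n' - e - j)%N)
  else [:: 1].

Definition mom e beta n : R := nth 0 (mom_tab e beta n) n.

Lemma size_mom_tab e beta n : size (mom_tab e beta n) = n.+1.
Proof. by elim: n => //= n IH; rewrite size_rcons IH. Qed.

Lemma nth_mom_tab e beta n k : (k <= n)%N -> nth 0 (mom_tab e beta n) k = mom e beta k.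
Proof.
elim: n => [|n IH]; first by case: k.
rewrite leq_eqVlt => /orP[/eqP ->//|]; rewrite ltnS => kn.
by rewrite /= nth_rcons size_mom_tab ltnS kn IH.
Qed.

Lemma mom_recP e beta : mom_rec e beta (mom e beta).
Proof.
split=> // a; rewrite {1}/mom /= nth_rcons size_mom_tab ltnn eqxx.
rewrite nth_mom_tab//; congr (_ + _); apply: eq_bigr => j _.
by rewrite !nth_mom_tab//; have := ltn_ord j; lia.
Qed.

End MomentRecursion.

(** * Exponential growth of the moments and the bound in high degree *)

Section Growth.
Context {R : realFieldType}.
Implicit Types (e a n : nat) (s : seq nat) (beta q z mu rho : R) (M : seq nat -> R) (m : nat -> R).

(* [z] is the radius of convergence of the generating function of [m], and
   [mu] its value there: the equation for the generating function has a double
   root at [z]. *)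
Definition critical e beta z mu : Prop :=
  [/\ 0 < z <= 1, 1 <= mu, 1 + beta * z * mu + z ^+ e.+1 * mu ^+ 2 = mu &
      beta * z + 2 * z ^+ e.+1 * mu = 1].

(** A partial sum [S] is followed by one that is at most [1 + beta z S + z ^+ e.+1 S ^+ 2]. This map
    is increasing on nonnegative numbers and fixes [mu], so the partial sums never pass [mu]. *)
Lemma mom_sum_critical e beta z mu m : 0 <= beta -> mom_rec e beta m ->
  critical e beta z mu -> forall n, \sum_(k < n) m k * z ^+ k <= mu.
Proof.
move=> b0 mR [/andP[z0 _] mu1 fix_mu _]; have m_ge0 := mom_rec_ge0 b0 mR.
case: mR => m0 mS; elim=> [|n IH]; first by rewrite big_ord0; lra.
set S := \sum_(k < n) _ in IH.
have S0 : 0 <= S by apply: sumr_ge0 => k _; rewrite mulr_ge0 ?exprn_ge0 // ltW.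
rewrite big_ord_recl /= m0 expr0 mul1r -fix_mu -addrA lerD2l.
under eq_bigr => k _ do rewrite /bump /= add1n mS mulrDl.
rewrite big_split /=; apply: lerD.
  have -> : \sum_(k < n) beta * m k * z ^+ k.+1 = beta * z * S.
    by rewrite mulr_sumr; apply: eq_bigr => k _; rewrite exprS; ring.
  by rewrite ler_wpM2l// mulr_ge0// ltW.
have zk k : 0 <= z ^+ k by rewrite exprn_ge0// ltW.
apply: (@le_trans _ _ (z ^+ e.+1 * S ^+ 2)); last first.
  by rewrite ler_wpM2l// lerXn2r// nnegrE; lra.
have E : z ^+ e.+1 * S ^+ 2 = \sum_(j < n) \sum_(l < n) m j * m l * z ^+ (j + l + e.+1).
  rewrite expr2 mulr_suml mulr_sumr; apply: eq_bigr => j _.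
  rewrite mulrA mulr_sumr; apply: eq_bigr => l _.
  by rewrite !exprD; ring.
(* The convolution runs over pairs of indices with sum below [n - e], a part of the full square of
   pairs that makes up [S ^+ 2]. *)
have -> : \sum_(k < n) (\sum_(j < k.+1 - e) m j * m (k - e - j)%N) * z ^+ k.+1
  = \sum_(k < n) \sum_(j < n | (j + e <= k)%N) m j * m (k - e - j)%N * z ^+ k.+1.
  apply: eq_bigr => k _; rewrite mulr_suml.
  rewrite (big_ord_widen n (fun j => m j * m (k - e - j)%N * z ^+ k.+1)); last first.
    by have := ltn_ord k; lia.
  by apply: eq_bigl => j; lia.
rewrite E (exchange_big_dep xpredT) //=; apply: ler_sum => j _.
have -> : \sum_(k < n | (j + e <= k)%N) m j * m (k - e - j)%N * z ^+ k.+1 =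
  \sum_(0 <= k < n | (j + e <= k)%N) m j * m (k - e - j)%N * z ^+ k.+1.
  by rewrite big_mkord.
have -> : \sum_(l < n) m j * m l * z ^+ (j + l + e.+1) =
  \sum_(0 <= l < n) m j * m l * z ^+ (j + l + e.+1) by rewrite big_mkord.
case: (leqP (j + e) n) => hje; last first.
  rewrite big_nat_cond big1; last by move=> k; lia.
  by apply: sumr_ge0 => l _; rewrite !mulr_ge0.
rewrite (big_cat_nat _ hje)//= big_nat_cond big1 ?add0r; last by move=> k; lia.
rewrite -{1}(add0n (j + e)%N) big_addn (big_cat_nat (n := n - (j + e)) (p := n)) //=; last lia.
rewrite -[leLHS]addr0 lerD //; last first.
  by apply: sumr_ge0 => l _; rewrite !mulr_ge0.
rewrite big_mkcond /=; apply: ler_sum => l _.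
have -> : (l + (j + e) - e - j)%N = l by lia.
have -> : (l + (j + e)).+1 = (j + l + e.+1)%N by lia.
by case: ifP => // _; rewrite !mulr_ge0.
Qed.

Lemma mom_le_critical e beta z mu m : 0 <= beta -> mom_rec e beta m ->
  critical e beta z mu -> forall k, m k <= mu * z ^- k.
Proof.
move=> b0 mR cr k; have := mom_sum_critical b0 mR cr k.+1.
have /andP[z0 z1] : 0 < z <= 1 by case: cr.
have m_ge0 := mom_rec_ge0 b0 mR.
rewrite big_ord_recr /= ler_pdivlMr ?exprn_gt0 // => h.
apply: le_trans h; rewrite lerDr; apply: sumr_ge0 => i _.
by rewrite mulr_ge0 // exprn_ge0 // ltW.
Qed.

(* The supersolution [m_a + eta z^-a] of the moment recursion: criticality
   makes the linearised recursion at [m] reproduce [z^-a] exactly, so the error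
   is quadratic in [eta] and is absorbed, like the terms of order [q], by the
   factors [1 + delta]. *)
Lemma trace_rec_le_super e beta z mu q delta n M m : (0 < n)%N ->
  0 <= beta -> 0 <= q -> 0 < delta <= 1 ->
  trace_rec e beta q M -> mom_rec e beta m -> critical e beta z mu -> (e <= 1)%N ->
  q * (16 * mu * n%:R ^+ 3) <= delta ^+ 3 ->
  let eta := delta / (2 * n%:R) in
  forall s, (sumn s <= n)%N ->
    M s <= \prod_(a <- s) ((m a + eta * z ^- a) * (1 + delta) ^+ a).
Proof.
move=> n0 b0 q0 /andP[d0 d1] MR mR cr e1 hq eta.
have m_ge0 := mom_rec_ge0 b0 mR; have m_le := mom_le_critical b0 mR cr.
have M_ge0 := trace_rec_ge0 b0 q0 MR.
have m_sum := mom_sum_critical b0 mR cr.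
case: (cr) => /andP[z0 z1] mu1 _ lin.
have nR : 1 <= n%:R :> R by rewrite ler1n.
have eta0 : 0 < eta by rewrite divr_gt0 //; lra.
have eta1 : eta <= 1 by rewrite ler_pdivrMr; lra.
set c := fun a => m a + eta * z ^- a.
have zV k : 0 < z ^- k by rewrite invr_gt0 exprn_gt0.
have c_gt0 a : 0 < c a by rewrite ltr_wpDl // mulr_gt0.
have c_ge a : eta * z ^- a <= c a by rewrite lerDr.
have c_le a : c a <= 2 * mu * z ^- a.
  rewrite /c (le_trans (lerD (m_le a) (ler_wpM2r (ltW (zV a)) eta1))) //.
  by rewrite -mulrDl ler_wpM2r ?(ltW (zV a)) //; lra.
have d1p k : 0 < (1 + delta) ^+ k by rewrite exprn_gt0; lra.
pose F s := \prod_(a <- s) (c a * (1 + delta) ^+ a).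
have F_ge0 s : 0 <= F s.
  by rewrite /F; apply: prodr_ge0 => a _; rewrite ltW // mulr_gt0.
have Fc a s : F (a :: s) = c a * (1 + delta) ^+ a * F s by rewrite /F big_cons.
(* Merging costs at most this factor, [c (a + b - e) <= D a * c b] for all positive [b]: the upper
   bound [2 mu z ^- k] of [c] is divided by its lower bound [eta z ^- k]. *)
pose D a := 2 * mu * z ^+ e.+1 * z ^- a.+1 / eta.
have zp k : 0 < z ^+ k by rewrite exprn_gt0.
have D0 a : 0 <= D a.
  by rewrite /D ltW // divr_gt0 // !mulr_gt0 //; lra.
have zsplit a b : (b <= a)%N -> z ^- (a - b) = z ^+ b * z ^- a.
  by move=> ba; rewrite -(subnK ba) addnK exprD invfM mulrCA divff ?mulr1 // gt_eqF.
(* The part quadratic in [eta] and the part of order [q] each take at most [delta / 2] of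
   [eta * z ^- a.+1]. The first fixes [eta] by [n * eta = delta / 2], the second then gives the
   constant 16 of the hypothesis. *)
have key a : (a < n)%N -> beta * c a + \sum_(j < a.+1 - e) c j * c (a - e - j)%N
      + q * (n%:R * D a) <= (1 + delta) * c a.+1.
  move=> an; have [_ mS] := mR.
  have zE j : (j < a.+1 - e)%N -> z ^- (a - e - j) = z ^+ e.+1 * z ^+ j * z ^- a.+1.
    move=> hj; rewrite -exprD -zsplit; last by clear -hj; lia.
    by congr (z ^- _); clear -hj; lia.
  have E1 : \sum_(j < a.+1 - e) c j * c (a - e - j)%N =
     \sum_(j < a.+1 - e) m j * m (a - e - j)%N
     + (\sum_(j < a.+1 - e) m j * (eta * z ^- (a - e - j))
     + \sum_(j < a.+1 - e) m (a - e - j)%N * (eta * z ^- j))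
     + \sum_(j < a.+1 - e) (eta * z ^- j) * (eta * z ^- (a - e - j)).
    by rewrite -!big_split /=; apply: eq_bigr => j _; rewrite /c; ring.
  have E2 : \sum_(j < a.+1 - e) m (a - e - j)%N * (eta * z ^- j) =
     \sum_(j < a.+1 - e) m j * (eta * z ^- (a - e - j)).
    rewrite [LHS](reindex_inj rev_ord_inj) /=; apply: eq_bigr => j _.
    by have hj := ltn_ord j; congr (m _ * (_ * z ^- _)) => /=; clear -hj; lia.
  have E3 : \sum_(j < a.+1 - e) m j * (eta * z ^- (a - e - j))
      <= eta * (z ^+ e.+1 * z ^- a.+1 * mu).
    have -> : \sum_(j < a.+1 - e) m j * (eta * z ^- (a - e - j)) =
       eta * (z ^+ e.+1 * z ^- a.+1 * \sum_(j < a.+1 - e) m j * z ^+ j).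
      rewrite !mulr_sumr; apply: eq_bigr => j _; have hj := ltn_ord j.
      by rewrite zE //; ring.
    apply: ler_wpM2l; first exact: ltW.
    apply: ler_wpM2l; last exact: m_sum.
    exact: mulr_ge0 (ltW (zp _)) (ltW (zV _)).
  have E4 : \sum_(j < a.+1 - e) (eta * z ^- j) * (eta * z ^- (a - e - j))
      <= n%:R * (eta ^+ 2 * (z ^+ e.+1 * z ^- a.+1)).
    apply: (@sum_ord_le _ _ _ (fun j => (eta * z ^- j) * (eta * z ^- (a - e - j)))).
    - exact: mulr_ge0 (exprn_ge0 _ (ltW eta0)) (mulr_ge0 (ltW (zp _)) (ltW (zV _))).
    - by clear -an; lia.
    - move=> j hj; rewrite zE // (_ : eta * _ * _ = (z ^- j * z ^+ j) * (eta ^+ 2 * (z ^+ e.+1 * z ^- a.+1))).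
        by rewrite mulVf ?mul1r // gt_eqF.
      by ring.
  set W := z ^- a.+1 in E3 E4 *; set Z := z ^+ e.+1 in E3 E4 lin *.
  have W0 : 0 < W by exact: zV.
  have Z0 : 0 < Z by exact: zp.
  have Z1 : Z <= 1 by rewrite exprn_ile1 // ltW.
  have E5 : beta * c a = beta * m a + eta * (beta * z * W).
    by rewrite /c /W exprS invfM; field; rewrite !(gt_eqF (zp _), gt_eqF z0).
  have E6 : q * (n%:R * D a) <= delta / 2 * (eta * W).
    rewrite /D -/W -/Z.
    have -> : q * (n%:R * (2 * mu * Z * W / eta)) = (q * (2 * mu * n%:R) * Z) / eta ^+ 2 * (eta * W).
      by field; rewrite gt_eqF.
    rewrite (ler_pM2r (mulr_gt0 eta0 W0)).
    rewrite ler_pdivrMr ?exprn_gt0 //.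
    apply: (@le_trans _ _ (q * (2 * mu * n%:R) * 1)).
      by rewrite ler_wpM2l // !mulr_ge0 //; lra.
    rewrite mulr1 /eta expr_div_n (_ : delta / 2 * (delta ^+ 2 / _) = delta ^+ 3 / (8 * n%:R ^+ 2)); last first.
      by field; lra.
    have n2 : 0 < 8 * n%:R ^+ 2 :> R by rewrite mulr_gt0 // exprn_gt0 //; clear -nR; lra.
    rewrite (ler_pdivlMr _ _ n2).
    by rewrite (_ : q * _ * _ = q * (16 * mu * n%:R ^+ 3)) //; ring.
  have E7 : n%:R * (eta ^+ 2 * (Z * W)) <= delta / 2 * (eta * W).
    have -> : n%:R * (eta ^+ 2 * (Z * W)) = (n%:R * eta * Z) * (eta * W) by ring.
    rewrite (ler_pM2r (mulr_gt0 eta0 W0)).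
    have -> : n%:R * eta = delta / 2 by rewrite /eta; field; lra.
    by rewrite ler_piMr //; lra.
  have E8 : eta * (beta * z * W) + 2 * (eta * (Z * W * mu)) = eta * W.
    by rewrite -[RHS]mulr1 -[X in _ = _ * X]lin; ring.
  have E9 : c a.+1 = beta * m a + \sum_(j < a.+1 - e) m j * m (a - e - j)%N + eta * W.
    by rewrite /c mS.
  have E10 : eta * W <= c a.+1 by exact: c_ge.
  rewrite E5 E1 E2; rewrite E9 in E10 *.
  have := m_ge0 a; move: (\sum_(j < a.+1 - e) m j * m (a - e - j)%N) E10 => S1 E10.
  nra.
case: MR => M0 Mz MS; elim/weight_ind => -[|[|a] s] IH hs.
- by rewrite M0 big_nil.
- rewrite Mz; apply: (@le_trans _ _ (F s)); first by apply: IH => //; by rewrite /weight /=; clear; lia.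
  rewrite -/(F (0%N :: s)) Fc expr0 mulr1 ler_peMl //.
  by rewrite /c; have [-> _] := mR; rewrite lerDl mulr_ge0 ?ltW.
have an : (a < n)%N by move: hs => /=; clear; lia.
have ssum : (sumn s <= n)%N by move: hs => /=; clear; lia.
have IH' t : (weight t < weight (a.+1 :: s))%N -> (sumn t <= n)%N -> M t <= F t := IH t.
have dmon k l : (k <= l)%N -> (1 + delta) ^+ k <= (1 + delta) ^+ l.
  by move=> kl; rewrite ler_weXn2l //; lra.
rewrite -/(F (a.+1 :: s)) Fc MS.
set X := (1 + delta) ^+ a * F s.
have X0 : 0 <= X by rewrite mulr_ge0 // ltW.
(* One factor [1 + delta] is set aside for [key]; after a split or a merge the total degree is at
   most the one counted by the remaining factors. *)
have -> : c a.+1 * (1 + delta) ^+ a.+1 * F s = (1 + delta) * c a.+1 * X.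
  by rewrite /X exprS; ring.
apply: le_trans (ler_wpM2r X0 (key a an)); rewrite !mulrDl !lerD //.
- rewrite -mulrA ler_wpM2l // /X mulrA -Fc; apply: IH'; first by rewrite /weight /=; clear; lia.
  by move: hs => /=; clear; lia.
- rewrite mulr_suml; apply: ler_sum => j _; have hj := ltn_ord j.
  apply: le_trans (IH' _ (weight_split _ hj) _) _; first by move: hs hj => /=; clear; lia.
  rewrite !Fc /X.
  rewrite (_ : c j * _ * _ = c j * c (a - e - j)%N * F s * (1 + delta) ^+ (j + (a - e - j))); last first.
    by rewrite exprD; ring.
  rewrite (mulrC (_ ^+ a)) mulrA ler_wpM2l ?dmon //; last by clear -hj; lia.
  by rewrite !mulr_ge0 // ltW.
- have -> : q * (n%:R * D a) * X = q * (n%:R * (D a * X)) by ring.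
  apply: ler_wpM2l => //.
  apply: (@sum_nth_le _ _ _ (fun i => M ((a + nth 0 s i - e)%N :: del i s))) => //.
    exact: mulr_ge0.
  move=> i hi si0; have hdel := sumn_del hi; set b := nth 0%N s i in si0 hdel *.
  have hI : M ((a + b - e)%N :: del i s) <= F ((a + b - e)%N :: del i s).
    apply: IH' (weight_merge _ _ hi) _; move: an hs ssum hdel => /=; clear -e; lia.
  have hc : c (a + b - e)%N <= D a * c b.
    apply: (le_trans (c_le _)); apply: (@le_trans _ _ (D a * (eta * z ^- b))); last first.
      by rewrite ler_wpM2l.
    have -> : z ^- (a + b - e) = z ^+ e.+1 * z ^- a.+1 * z ^- b.
      rewrite -mulrA -invfM -exprD -zsplit; last by clear -si0 e1; lia.
      by congr (z ^- _); clear -si0 e1; lia.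
    by rewrite /D le_eqVlt; apply/orP; left; apply/eqP; field; rewrite !(gt_eqF (zp _), gt_eqF eta0).
  apply: (le_trans hI); rewrite Fc /X.
  have -> : F s = c b * (1 + delta) ^+ b * F (del i s) by rewrite /F (prod_del _ hi).
  have -> : D a * ((1 + delta) ^+ a * (c b * (1 + delta) ^+ b * F (del i s)))
    = D a * c b * (1 + delta) ^+ (a + b) * F (del i s) by rewrite exprD; ring.
  apply: ler_wpM2r => //; apply: ler_pM => //; first exact: ltW.
    exact: ltW.
  by apply: dmon; clear; lia.
Qed.

End Growth.

(** * Growth rate from below, Catalan numbers, continuity in the ratio *)

Section CatalanGrowth.
Context {R : realType}.
Implicit Types (beta rho A : R) (m : nat -> R).

(* If all ratios were at most [rho < A], the generating function of [m] would
   converge at some point beyond [1 / A], where its quadratic equation has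
   negative discriminant. *)
Lemma mom_growth beta A rho m : 0 <= beta -> mom_rec 0 beta m -> beta < A ->
  (A - beta) ^+ 2 = 4 * A -> rho < A ->
  exists2 k, (0 < k)%N & rho * m k < m k.+1.
Proof.
move=> b0 mR bA A4 rA; have m_ge0 := mom_rec_ge0 b0 mR; have [m0 mS] := mR.
apply: contrapT => Hn.
have A1 : 1 < A by nra.
(* Still below [A], and large enough to turn the ratio bound into a geometric bound from degree 0 on
   and to keep [A * r - beta * beta] positive. *)
pose rho1 := Num.max rho (Num.max beta 1).
have r1A : rho1 < A by rewrite /rho1 !gt_max rA bA A1.
have [r1r [r1b r11]] : [/\ rho <= rho1, beta <= rho1 & 1 <= rho1].
  by rewrite /rho1 !le_max !lexx !orbT.
have ratio k : (0 < k)%N -> m k.+1 <= rho1 * m k.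
  move=> k0; apply: (@le_trans _ _ (rho * m k)); last by rewrite ler_wpM2r.
  by rewrite leNgt; apply/negP => h; apply: Hn; exists k.
have m_le k : m k <= (beta + 1) * rho1 ^+ k.
  elim: k => [|[|k] IH]; first by rewrite m0 expr0; lra.
    by rewrite mS subn0 big_ord1 m0 !mulr1; rewrite expr1 ler_peMr //; lra.
  rewrite (le_trans (ratio _ _)) // exprS mulrCA ler_wpM2l //; lra.
pose r := (rho1 + A) / 2; pose z := r^-1.
have [rr1 rA'] : rho1 < r /\ r < A by rewrite /r; split; lra.
have r0 : 0 < r by lra.
have z0 : 0 < z by rewrite invr_gt0.
pose S K := \sum_(k < K) m k * z ^+ k.
have S_ge0 K : 0 <= S K by apply: sumr_ge0 => k _; rewrite mulr_ge0 // exprn_ge0 // ltW.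
pose x := rho1 * z.
have x1 : x < 1 by rewrite /x /z ltr_pdivrMr // mul1r.
have x0 : 0 < x by rewrite mulr_gt0 //; lra.
have S_le K : S K <= (beta + 1) / (1 - x).
  apply: (@le_trans _ _ (\sum_(k < K) (beta + 1) * x ^+ k)).
    apply: ler_sum => k _; rewrite /x exprMn mulrA ler_wpM2r // exprn_ge0 //; lra.
  rewrite -mulr_sumr ler_wpM2l //; first lra.
  rewrite -[leRHS]div1r ler_pdivlMr; last lra.
  rewrite mulrC -(opprB x) mulNr -subrX1 opprB gerBl exprn_ge0 //; lra.
(* Products of two of the first [K] terms have degree below [K + K], so after the shift by [z] they
   stay within the longer partial sum. *)
have S_step K : 1 + beta * z * S K + z * S K ^+ 2 <= S (K + K).+1.
  rewrite /S big_ord_recl /= m0 expr0 mul1r -addrA lerD2l -/(S K).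
  under eq_bigr => k _ do rewrite /bump /= add1n mS mulrDl subn0.
  rewrite big_split /=; apply: lerD.
    rewrite mulr_sumr big_split_ord /= -[leLHS]addr0 lerD //.
      by rewrite le_eqVlt; apply/orP; left; apply/eqP/eq_bigr => k _; rewrite exprS; ring.
    by apply: sumr_ge0 => k _; rewrite !mulr_ge0 // exprn_ge0 // ltW.
  have -> : \sum_(k < K + K) (\sum_(j < k.+1) m j * m (k - 0 - j)%N) * z ^+ k.+1
    = \sum_(k < K + K) \sum_(j < K + K | (j <= k)%N) m j * m (k - j)%N * z ^+ k.+1.
    apply: eq_bigr => k _; rewrite mulr_suml subn0.
    by rewrite (big_ord_widen (K + K) (fun j => m j * m (k - j)%N * z ^+ k.+1)) // ltn_ord.
  rewrite (exchange_big_dep xpredT) //= big_split_ord /= -[leLHS]addr0 lerD //; last first.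
    apply: sumr_ge0 => j _; apply: sumr_ge0 => k _.
    by rewrite !mulr_ge0 // exprn_ge0 // ltW.
  rewrite expr2 mulr_suml mulr_sumr; apply: ler_sum => j _.
  rewrite -(big_mkord (fun k => (j <= k)%N) (fun k => m j * m (k - j)%N * z ^+ k.+1)).
  have jK := ltn_ord j.
  rewrite (@big_cat_nat _ _ _ j) //=; last by clear -jK; lia.
  rewrite big_nat_cond big1 ?add0r; last by move=> k; clear; lia.
  rewrite -[X in \sum_(X <= _ < _ | _) _]add0n big_addn (@big_cat_nat _ _ _ K) //=; last by clear -jK; lia.
  rewrite -[leLHS]addr0 lerD //; last first.
    by apply: sumr_ge0 => l _; rewrite !mulr_ge0 // exprn_ge0 // ltW.
  rewrite big_mkcond /= big_mkord !mulr_sumr le_eqVlt; apply/orP; left; apply/eqP.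
  apply: eq_bigr => l _; rewrite leq_addl addnK exprS exprD; ring.
(* The minimum of [1 + beta z S + z S ^+ 2 - S], found by completing the square. It is positive
   because the discriminant, proportional to [(r - beta) ^+ 2 - 4 r], vanishes at [A] and is
   negative at [r]. Hence the partial sums grow by [eps] again and again, against the geometric
   bound. *)
pose eps := (r - (r - beta) ^+ 2 / 4) * z.
have eps0 : 0 < eps.
  rewrite mulr_gt0 // subr_gt0 ltr_pdivrMr //.
  have : A * (r - beta) ^+ 2 < A * (r * 4).
    rewrite (_ : A * (r * 4) = r * (4 * A)); last by ring.
    rewrite -A4 -subr_gt0.
    have -> : r * (A - beta) ^+ 2 - A * (r - beta) ^+ 2 = (A - r) * (A * r - beta * beta) by ring.
    by rewrite mulr_gt0; nra.
  by rewrite ltr_pM2l //; lra.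
have S_inc K : S K + eps <= S (K + K).+1.
  apply: le_trans (S_step K); rewrite -subr_ge0.
  have -> : 1 + beta * z * S K + z * S K ^+ 2 - (S K + eps) = z * (S K - (r - beta) / 2) ^+ 2.
    by rewrite /eps /z; field; rewrite gt_eqF.
  by rewrite mulr_ge0 ?sqr_ge0 // ltW.
have S_unb n : exists K, n%:R * eps <= S K.
  elim: n => [|n [K IH]]; first by exists 0%N; rewrite mul0r.
  exists (K + K).+1; apply: le_trans (S_inc K).
  by rewrite -addn1 natrD mulrDl mul1r lerD2r.
pose B := (beta + 1) / (1 - x) / eps.
have [K] := S_unb (Num.truncn B).+1.
apply/negP; rewrite -ltNge; apply: (le_lt_trans (S_le K)).
rewrite -ltr_pdivrMr //; apply: truncnS_gt.
Qed.

Lemma sum_even (F : nat -> R) k : (forall i, odd i -> F i = 0) ->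
  \sum_(j < k.*2.+1) F j = \sum_(i < k.+1) F i.*2.
Proof.
move=> Fodd; elim: k => [|k IH]; first by rewrite !big_ord1.
by rewrite doubleS big_ord_recr big_ord_recr IH /= [RHS]big_ord_recr /= Fodd ?addr0 //= odd_double.
Qed.

(** Odd moments vanish by parity, which leaves only even indices in the convolution. In this way the
    growth result for [e = 0] also serves the semicircle law. *)
Lemma mom_catalan m c : mom_rec 1 0 m -> mom_rec 0 0 c ->
  forall k, m k.*2 = c k /\ m k.*2.+1 = 0.
Proof.
move=> [m0 mS] [c0 cS].
have modd a : odd a -> m a = 0.
  elim/ltn_ind: a => -[//|a] IH /= oa; rewrite mS mul0r add0r big1 // => j _.
  have hj := ltn_ord j; case oj : (odd j); first by rewrite IH ?mul0r //; lia.
  by rewrite [X in _ * X]IH ?mulr0 //; lia.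
move=> k; split; last by rewrite modd //= odd_double.
elim/ltn_ind: k => -[|k] IH; first by rewrite m0 c0.
rewrite doubleS mS cS !mul0r !add0r !subn0 subSS subn0.
rewrite (@sum_even (fun j => m j * m (k.*2.+1 - 1 - j)%N)).
  apply: eq_bigr => j _; have hj := ltn_ord j; rewrite IH //.
  by rewrite (_ : (k.*2.+1 - 1 - j.*2)%N = (k - j).*2) ?IH //; lia.
by move=> i oi; rewrite modd ?mul0r.
Qed.

(** Each moment is a fixed polynomial in [beta]. *)
Lemma cvg_mom e (beta : nat -> R) (alpha : R) (m : nat -> nat -> R) (mu : nat -> R) :
  (forall n, mom_rec e (beta n) (m n)) -> mom_rec e alpha mu ->
  beta n @[n --> \oo] --> alpha ->
  forall a, m n a @[n --> \oo] --> mu a.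
Proof.
move=> mR [mu0 muS] cb; elim/ltn_ind => -[|a] IH.
  by under eq_fun => n do rewrite (mR n).1; rewrite mu0; apply: cvg_cst.
under eq_fun => n do rewrite (mR n).2.
rewrite muS; apply: cvgD; first by apply: cvgM => //; apply: IH.
apply: cvg_big => [|j _]; first exact: add_continuous.
apply: cvgM; apply: IH; have := ltn_ord j; lia.
Qed.

End CatalanGrowth.

(** * Loop equations for Gaussian matrices *)

Section Derivations.
Context {P : comNzRingType}.

Definition derivation (d : P -> P) : Prop :=
  (forall x y, d (x + y) = d x + d y) /\ (forall x y, d (x * y) = d x * y + x * d y).

Section Theory.
Variable d : P -> P.
Hypothesis dP : derivation d.

Lemma derivation0 : d 0 = 0.
Proof. by apply: (addrI (d 0)); rewrite -dP.1 !addr0. Qed.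

Lemma derivation1 : d 1 = 0.
Proof. by apply: (addrI (d 1)); rewrite addr0 -{3}(mulr1 1) dP.2 mulr1 mul1r. Qed.

Lemma derivation_sum I (r : seq I) (p : pred I) (F : I -> P) :
  d (\sum_(i <- r | p i) F i) = \sum_(i <- r | p i) d (F i).
Proof. exact: (big_morph d dP.1 derivation0). Qed.

Lemma derivation_mulmx m n k (A : 'M[P]_(m, n)) (B : 'M[P]_(n, k)) :
  map_mx d (A *m B) = map_mx d A *m B + A *m map_mx d B.
Proof.
apply/matrixP => i j; rewrite !mxE derivation_sum -big_split /=.
by apply: eq_bigr => l _; rewrite dP.2 !mxE.
Qed.

Lemma derivation_mxpow n (A : 'M[P]_n) k :
  map_mx d (A ^+ k) = \sum_(j < k) A ^+ j *m map_mx d A *m A ^+ (k.-1 - j).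
Proof.
elim: k => [|k IH].
  rewrite big_ord0 expr0; apply/matrixP => i j; rewrite !mxE.
  by case: eqP; rewrite ?derivation1 ?derivation0.
rewrite exprS -mulmxE derivation_mulmx IH big_ord_recl /= expr0 subn0 mul1mx; congr (_ + _).
rewrite mulmx_sumr; apply: eq_bigr => j _; have hj := ltn_ord j.
rewrite /bump /= add1n exprS -mulmxE !mulmxA; congr (_ *m _ ^+ _); lia.
Qed.

Lemma derivation_mxtrace n (A : 'M[P]_n) : d (\tr A) = \tr (map_mx d A).
Proof. by rewrite derivation_sum; apply: eq_bigr => i _; rewrite mxE. Qed.

Lemma derivation_prod (f : nat -> P) (s : seq nat) :
  d (\prod_(a <- s) f a) =
  \sum_(i < size s) d (f (nth 0%N s i)) * \prod_(a <- del i s) f a.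
Proof.
elim: s => [|b s IH]; first by rewrite big_nil big_ord0 derivation1.
rewrite big_cons dP.2 IH big_ord_recl /= /del /= drop0; congr (_ + _).
rewrite mulr_sumr; apply: eq_bigr => i _.
by rewrite /= big_cons mulrCA.
Qed.

End Theory.

Lemma mulmx_deltal n m k (i : 'I_m) (j : 'I_n) (A : 'M[P]_(n, k)) u v :
  (delta_mx i j *m A) u v = (A j v) *+ (u == i).
Proof.
rewrite !mxE (bigD1 j) //= big1 ?addr0 => [|l lj]; last first.
  by rewrite mxE (negbTE lj) andbF mul0r.
by rewrite mxE eqxx andbT; case: eqP; rewrite ?mul1r ?mul0r.
Qed.

Lemma mxtrace_delta n m (i : 'I_m) (j : 'I_n) (A : 'M[P]_(n, m)) :
  \tr (delta_mx i j *m A) = A j i.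
Proof.
rewrite /mxtrace (bigD1 i) //= big1 => [|l li]; last by rewrite mulmx_deltal (negbTE li).
by rewrite mulmx_deltal eqxx addr0.
Qed.

Lemma exchange_big3 (I J K : finType) (F : I -> J -> K -> P) :
  \sum_i \sum_j \sum_k F i j k = \sum_k \sum_i \sum_j F i j k.
Proof. by rewrite [RHS]exchange_big /=; apply: eq_bigr => i _; rewrite exchange_big. Qed.

Definition tr_prod n (A : 'M[P]_n) (s : seq nat) : P := \prod_(a <- s) \tr (A ^+ a).

End Derivations.

Section LoopEquations.
Context {P : comNzRingType} {C : zmodType} (L : {additive P -> C}) (kap : P).

(** Integration by parts against the first entry of the cyclic product tr H^(a+1). By the Leibniz
    rule the derivation either hits the remaining H^a and cuts the cycle into two traces, or hits
    another trace and joins it to the first. *)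
Lemma loop_hermitian N (H : 'M[P]_N) (D : 'I_N -> 'I_N -> P -> P) a s :
  (forall i j, derivation (D i j)) ->
  (forall i j k l, D i j (H k l) = kap *+ ((k == j) && (l == i))) ->
  (forall i j F, L (H i j * F) = L (D i j F)) ->
  L (tr_prod H (a.+1 :: s)) =
  L (kap * \sum_(j < a) tr_prod H [:: (j : nat), (a.-1 - j)%N & s])
  + L (kap * \sum_(i < size s)
         (nth 0%N s i)%:R * tr_prod H ((a + nth 0%N s i).-1 :: del i s)).
Proof.
move=> DP DH LH.
have DHm i j : map_mx (D i j) H = kap *: delta_mx j i.
  by apply/matrixP => k l; rewrite !mxE DH mulr_natr.
have Dtr i j b : D i j (\tr (H ^+ b)) = kap * (b%:R * (H ^+ b.-1) i j).
  rewrite (derivation_mxtrace (DP i j)) (derivation_mxpow (DP i j)) DHm linear_sum /=.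
  rewrite mulr_natl -[X in _ *+ X](card_ord b) -sumr_const mulr_sumr.
  apply: eq_bigr => k _; have hk := ltn_ord k.
  rewrite -scalemxAr -scalemxAl linearZ /=; congr (_ * _).
  rewrite mxtrace_mulC mulmxA mxtrace_mulC mxtrace_delta mulmxE -exprD.
  by have -> : (b.-1 - k + k)%N = b.-1 by clear -hk; lia.
have -> : tr_prod H (a.+1 :: s) = \sum_i \sum_j H i j * ((H ^+ a) j i * tr_prod H s).
  rewrite /tr_prod big_cons exprS -mulmxE /mxtrace mulr_suml.
  apply: eq_bigr => i _; rewrite mxE mulr_suml; apply: eq_bigr => j _.
  by rewrite mulrA.
rewrite raddf_sum /=; under eq_bigr => i _ do rewrite raddf_sum /=.
under eq_bigr => i _ do under eq_bigr => j _ do rewrite LH (DP i j).2 raddfD.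
under eq_bigr => i _ do rewrite big_split /=.
rewrite big_split /=; congr (_ + _).
  under eq_bigr => i _ do rewrite -raddf_sum /=.
  rewrite -raddf_sum /=; congr (L _).
  have Dpow i j : D i j ((H ^+ a) j i) = kap * \sum_(k < a) (H ^+ k) j j * (H ^+ (a.-1 - k)) i i.
    have -> : D i j ((H ^+ a) j i) = (map_mx (D i j) (H ^+ a)) j i by rewrite mxE.
    rewrite (derivation_mxpow (DP i j)) DHm summxE mulr_sumr.
    apply: eq_bigr => k _; rewrite -scalemxAr -scalemxAl mxE; congr (_ * _).
    rewrite -mulmxA mxE (bigD1 j) //= big1 => [|l lj].
      by rewrite mulmx_deltal eqxx addr0.
    by rewrite mulmx_deltal (negbTE lj) mulr0.
  under eq_bigr => i _ do under eq_bigr => j _ do rewrite Dpow -mulrA mulr_suml.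
  under eq_bigr => i _ do rewrite -mulr_sumr.
  rewrite -mulr_sumr; congr (_ * _).
  rewrite exchange_big3; apply: eq_bigr => k _.
  rewrite /tr_prod !big_cons mulrA [X in X * _]mulrC [X in X * _]big_distrlr /= mulr_suml.
  apply: eq_bigr => i _; rewrite mulr_suml; apply: eq_bigr => j _.
  by rewrite [X in X * _]mulrC.
under eq_bigr => i _ do rewrite -raddf_sum /=.
rewrite -raddf_sum /=; congr (L _).
under eq_bigr => i _ do under eq_bigr => j _ do
  rewrite (derivation_prod (DP i j)) mulr_sumr.
rewrite exchange_big3 /= mulr_sumr; apply: eq_bigr => k _.
set b := nth 0%N s k.
under eq_bigr => i _ do under eq_bigr => j _ do rewrite Dtr.
rewrite /tr_prod big_cons; set T := \prod_(_ <- _) _.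
(* For [b = 0] the coefficient [b] annihilates both sides, so the truncated exponents [b.-1] and
   [(a + b).-1] matter only for positive [b]. *)
have [->|b0] := posnP b.
  rewrite !mul0r mulr0 big1 // => i _; rewrite big1 // => j _.
  by rewrite !(mul0r, mulr0).
rewrite (_ : (a + b).-1 = b.-1 + a)%N; last by clear -b0; lia.
rewrite exprD -mulmxE /mxtrace mulr_suml !mulr_sumr.
apply: eq_bigr => i _; rewrite mxE mulr_suml !mulr_sumr; apply: eq_bigr => j _.
by ring.
Qed.

(** [Y'] plays the adjoint of [Y], and [D] the derivative in the conjugate variables, which does not
    see [Y]. Hitting the leading [Y'] leaves a free index of range [q]; hitting a later one cuts off
    a cycle containing at least one factor [K], hence the exponent [j.+1]. *)
Lemma loop_wishart p q (Y : 'M[P]_(p, q)) (Y' : 'M[P]_(q, p))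
    (D : 'I_p -> 'I_q -> P -> P) a s :
  (forall i j, derivation (D i j)) ->
  (forall i j k l, D i j (Y k l) = 0) ->
  (forall i j k l, D i j (Y' k l) = kap *+ ((k == j) && (l == i))) ->
  (forall i j F, L (Y i j * F) = L (D i j F)) ->
  L (tr_prod (Y *m Y') (a.+1 :: s)) =
  L (kap * (q%:R * tr_prod (Y *m Y') (a :: s)
     + \sum_(j < a) tr_prod (Y *m Y') [:: (j.+1 : nat), (a.-1 - j)%N & s]))
  + L (kap * \sum_(i < size s)
         (nth 0%N s i)%:R * tr_prod (Y *m Y') ((a + nth 0%N s i)%N :: del i s)).
Proof.
move=> DP DY DY' LY; set K := Y *m Y'.
have DYm i j : map_mx (D i j) Y = 0 by apply/matrixP => k l; rewrite !mxE DY.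
have DY'm i j : map_mx (D i j) Y' = kap *: delta_mx j i.
  by apply/matrixP => k l; rewrite !mxE DY' mulr_natr.
have DKm i j : map_mx (D i j) K = kap *: (Y *m delta_mx j i).
  by rewrite (derivation_mulmx (DP i j)) DYm mul0mx add0r DY'm scalemxAr.
have Dtr i j b : D i j (\tr (K ^+ b)) = kap * (b%:R * (K ^+ b.-1 *m Y) i j).
  rewrite (derivation_mxtrace (DP i j)) (derivation_mxpow (DP i j)) DKm linear_sum /=.
  rewrite mulr_natl -[X in _ *+ X](card_ord b) -sumr_const mulr_sumr.
  apply: eq_bigr => k _; have hk := ltn_ord k.
  rewrite -scalemxAr -scalemxAl linearZ /=; congr (_ * _).
  rewrite mxtrace_mulC !mulmxA mxtrace_mulC mxtrace_delta mulmxE -exprD.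
  by have -> : (b.-1 - k + k)%N = b.-1 by clear -hk; lia.
have -> : tr_prod K (a.+1 :: s) = \sum_i \sum_j Y i j * ((Y' *m K ^+ a) j i * tr_prod K s).
  rewrite /tr_prod big_cons exprS -mulmxE /K -mulmxA -/K /mxtrace mulr_suml.
  apply: eq_bigr => i _; rewrite mxE mulr_suml; apply: eq_bigr => j _.
  by rewrite mulrA.
rewrite raddf_sum /=; under eq_bigr => i _ do rewrite raddf_sum /=.
under eq_bigr => i _ do under eq_bigr => j _ do rewrite LY (DP i j).2 raddfD.
under eq_bigr => i _ do rewrite big_split /=.
rewrite big_split /=; congr (_ + _).
  under eq_bigr => i _ do rewrite -raddf_sum /=.
  rewrite -raddf_sum /=; congr (L _).
  have Dpow i j : D i j ((Y' *m K ^+ a) j i) =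
      kap * ((K ^+ a) i i + \sum_(k < a) (Y' *m K ^+ k *m Y) j j * (K ^+ (a.-1 - k)) i i).
    have -> : D i j ((Y' *m K ^+ a) j i) = (map_mx (D i j) (Y' *m K ^+ a)) j i by rewrite [RHS]mxE.
    rewrite (derivation_mulmx (DP i j)) DY'm (derivation_mxpow (DP i j)) DKm mxE.
    rewrite -scalemxAl mxE mulmx_deltal eqxx mulrDr; congr (_ + _).
    rewrite mulmx_sumr summxE mulr_sumr.
    apply: eq_bigr => k _; rewrite -scalemxAr -scalemxAl -scalemxAr mxE; congr (_ * _).
    rewrite !mulmxA -mulmxA mxE (bigD1 j) //= big1 => [|l lj].
      by rewrite mulmx_deltal eqxx addr0.
    by rewrite mulmx_deltal (negbTE lj) mulr0.
  under eq_bigr => i _ do under eq_bigr => j _ do rewrite Dpow -mulrA.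
  under eq_bigr => i _ do rewrite -mulr_sumr.
  rewrite -mulr_sumr; congr (_ * _).
  rewrite /=; under eq_bigr => i _ do under eq_bigr => j _ do rewrite mulrDl mulr_suml.
  under eq_bigr => i _ do rewrite big_split /= sumr_const card_ord.
  rewrite big_split /= exchange_big3; congr (_ + _).
    by rewrite /tr_prod big_cons mulr_natl /mxtrace mulr_suml sumrMnl.
  apply: eq_bigr => k _.
  have -> : tr_prod K [:: k.+1, (a.-1 - k)%N & s] =
     \tr (Y' *m K ^+ k *m Y) * (\tr (K ^+ (a.-1 - k)) * tr_prod K s).
    by rewrite /tr_prod !big_cons exprSr -mulmxE /K mulmxA mxtrace_mulC mulmxA.
  rewrite mulrA [X in X * _]mulrC [X in X * _]big_distrlr /= mulr_suml.
  apply: eq_bigr => i _; rewrite mulr_suml; apply: eq_bigr => j _.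
  by rewrite [X in X * _]mulrC.
under eq_bigr => i _ do rewrite -raddf_sum /=.
rewrite -raddf_sum /=; congr (L _).
under eq_bigr => i _ do under eq_bigr => j _ do
  rewrite (derivation_prod (DP i j)) mulr_sumr.
rewrite exchange_big3 /= mulr_sumr; apply: eq_bigr => k _.
set b := nth 0%N s k.
under eq_bigr => i _ do under eq_bigr => j _ do rewrite Dtr.
rewrite /tr_prod big_cons; set T := \prod_(_ <- _) _.
have [->|b0] := posnP b.
  rewrite !mul0r mulr0 big1 // => i _; rewrite big1 // => j _.
  by rewrite !(mul0r, mulr0).
rewrite (_ : (a + b) = b.-1 + 1 + a)%N; last by clear -b0; lia.
rewrite !exprD expr1 -!mulmxE /mxtrace mulr_suml !mulr_sumr.
have -> : K ^+ b.-1 *m K *m K ^+ a = (K ^+ b.-1 *m Y) *m (Y' *m K ^+ a).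
  by rewrite {2}/K !mulmxA.
apply: eq_bigr => i _; rewrite mxE mulr_suml !mulr_sumr; apply: eq_bigr => j _.
by ring.
Qed.

End LoopEquations.

Section ScalarLoopEquations.
Context {P : comNzRingType} {R : comNzRingType} (L : {additive P -> R}) (kap : P) (c : R).
Hypothesis Lkap : forall p, L (kap * p) = c * L p.

Let Lnat k p : L (k%:R * p) = k%:R * L p.
Proof. by rewrite !mulr_natl raddfMn. Qed.

Lemma loop_hermitian_scalar N (H : 'M[P]_N) (D : 'I_N -> 'I_N -> P -> P) a s :
  (forall i j, derivation (D i j)) ->
  (forall i j k l, D i j (H k l) = kap *+ ((k == j) && (l == i))) ->
  (forall i j F, L (H i j * F) = L (D i j F)) ->
  L (tr_prod H (a.+1 :: s)) =
  c * (\sum_(j < a) L (tr_prod H [:: (j : nat), (a.-1 - j)%N & s]))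
  + c * (\sum_(i < size s)
           (nth 0%N s i)%:R * L (tr_prod H ((a + nth 0%N s i).-1 :: del i s))).
Proof.
move=> DP DH LH; rewrite (loop_hermitian a s DP DH LH) !Lkap !raddf_sum /=.
by congr (_ + _ * _); apply: eq_bigr => i _; rewrite Lnat.
Qed.

Lemma loop_wishart_scalar p q (Y : 'M[P]_(p, q)) (Y' : 'M[P]_(q, p))
    (D : 'I_p -> 'I_q -> P -> P) a s :
  (forall i j, derivation (D i j)) ->
  (forall i j k l, D i j (Y k l) = 0) ->
  (forall i j k l, D i j (Y' k l) = kap *+ ((k == j) && (l == i))) ->
  (forall i j F, L (Y i j * F) = L (D i j F)) ->
  L (tr_prod (Y *m Y') (a.+1 :: s)) =
  c * (q%:R * L (tr_prod (Y *m Y') (a :: s))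
     + \sum_(j < a) L (tr_prod (Y *m Y') [:: (j.+1 : nat), (a.-1 - j)%N & s]))
  + c * (\sum_(i < size s)
           (nth 0%N s i)%:R * L (tr_prod (Y *m Y') ((a + nth 0%N s i)%N :: del i s))).
Proof.
move=> DP DY DY' LY; rewrite (loop_wishart a s DP DY DY' LY) !Lkap raddfD !raddf_sum /= Lnat.
by congr (_ + _ * _); apply: eq_bigr => i _; rewrite Lnat.
Qed.

End ScalarLoopEquations.

Local Open Scope complex_scope.

Section ComplexParts.
Context {R : realType}.
Implicit Types z w : R[i].

Lemma conjCE z : Num.conj z = conjc z.
Proof. by []. Qed.

Lemma ReD z w : complex.Re (z + w) = complex.Re z + complex.Re w.
Proof. by case: z; case: w. Qed.

Lemma Re_sum I (r : seq I) (p : pred I) (F : I -> R[i]) :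
  complex.Re (\sum_(i <- r | p i) F i) = \sum_(i <- r | p i) complex.Re (F i).
Proof. by apply: (big_morph (@complex.Re R) ReD). Qed.

Lemma ReZ (a : R) z : complex.Re (a%:C * z) = a * complex.Re z.
Proof. by case: z => x y /=; rewrite mul0r subr0. Qed.

End ComplexParts.

(** * Gaussian expectation on formal polynomials and integration by parts *)

Section GaussianFunctional.
Context {R : realType} (n : nat) (v : R).
Local Notation C := R[i].
Local Notation poly := (mpoly n C).

Fixpoint gauss_mom (k : nat) : R :=
  if k is k'.+1 then if k' is l.+1 then k'%:R * v * gauss_mom l else 0 else 1.

Definition gauss_weight (m : multinom n) : R := \prod_(i < n) gauss_mom (m i).

(* The expectation of a polynomial in independent centred Gaussian variables, as
   a functional on formal polynomials. *)
Definition gaussE (p : poly) : C := \sum_(m <- msupp p) mcoeff m p * (gauss_weight m)%:C.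

Lemma gaussE_wide (r : seq (multinom n)) (p : poly) : uniq r -> {subset msupp p <= r} ->
  gaussE p = \sum_(m <- r) mcoeff m p * (gauss_weight m)%:C.
Proof.
move=> ur sub; rewrite /gaussE.
rewrite -[RHS](@big_rmcond_in _ _ _ _ _ (fun m => m \in msupp p)) => [|m _ /memN_msupp_eq0 ->]; last first.
  by rewrite mul0r.
rewrite -big_filter; apply: perm_big; apply: uniq_perm; rewrite ?filter_uniq ?msupp_uniq //.
by move=> m; rewrite mem_filter; case: (boolP (m \in msupp p)) => //= /sub ->.
Qed.

Lemma gaussE_is_linear : linear (gaussE : poly -> C^o).
Proof.
move=> a p q; pose r := undup (msupp p ++ msupp q ++ msupp (a *: p + q)).
have [ur sub] : uniq r /\ forall m, [|| m \in msupp p, m \in msupp q | m \in msupp (a *: p + q)] -> m \in r.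
  by rewrite undup_uniq; split=> // m; rewrite mem_undup !mem_cat.
rewrite !(@gaussE_wide r) // => [|m hm|m hm|m hm]; try by apply: sub; rewrite hm ?orbT.
rewrite scaler_sumr -big_split /=; apply: eq_bigr => m _.
by rewrite mcoeffD mcoeffZ mulrDl -mulrA.
Qed.

HB.instance Definition _ := GRing.isLinear.Build C poly C^o _ gaussE gaussE_is_linear.

Lemma gaussEX m : gaussE (mpolyX C m) = (gauss_weight m)%:C.
Proof. by rewrite /gaussE msuppX big_seq1 mcoeffX eqxx mul1r. Qed.

Lemma gaussE1 : gaussE 1 = 1.
Proof.
by rewrite -mpolyX0 gaussEX /gauss_weight big1 // => i _; rewrite mnm0E.
Qed.

Lemma gaussEZ a p : gaussE (a *: p) = a * gaussE p.
Proof. by rewrite linearZ. Qed.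

Lemma gaussED p q : gaussE (p + q) = gaussE p + gaussE q.
Proof. exact: raddfD. Qed.

Lemma gaussEB p q : gaussE (p - q) = gaussE p - gaussE q.
Proof. exact: raddfB. Qed.

(** Where [m i = 0] the subtraction truncates, but the factor [m i] is 0 and the left side contains
    the first moment, which is 0. *)
Lemma gauss_weight_stein i (m : multinom n) :
  gauss_weight (mnm_add (mnm1 i) m) = v * (m i)%:R * gauss_weight (mnm_sub m (mnm1 i)).
Proof.
rewrite /gauss_weight (bigD1 i) //= [in RHS](bigD1 i) //= !mulrA.
rewrite mnmDE mnmBE mnm1E eqxx add1n subn1.
congr (_ * _); last first.
  by apply: eq_bigr => j ji; rewrite mnmDE mnmBE mnm1E eq_sym (negbTE ji) add0n subn0.
by case: (m i) => [|k] /=; rewrite ?mulr0 ?mul0r //; ring.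
Qed.

(** Stein's identity; on monomials it is the recursion defining [gauss_mom]. *)
Lemma gaussE_stein i (p : poly) :
  gaussE (mpolyX C (mnm1 i) * p) = v%:C * gaussE (mderiv i p).
Proof.
rewrite {1 2}[p]mpolyE mulr_sumr [mderiv _ _]raddf_sum /= !raddf_sum /= mulr_sumr.
apply: eq_bigr => m _; rewrite -scalerAr mderivZ !gaussEZ mulrCA; congr (_ * _).
rewrite -mpolyXD mderivX gaussEZ !gaussEX gauss_weight_stein.
by rewrite !rmorphM /= rmorph_nat mulrA.
Qed.

End GaussianFunctional.

Section ComplexGaussian.
Context {R : realType} (K : finType) (v : R).
Local Notation C := R[i].
Local Notation n := #|{: K * bool}|.
Local Notation poly := (mpoly n C).
Local Notation L := (@gaussE R n v).

Definition gvar (k : K) (b : bool) : poly := mpolyX C (mnm1 (enum_rank (k, b))).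
Definition gpoly (k : K) : poly := gvar k false + 'i *: gvar k true.
(** Conjugation is not an operation on formal polynomials, so the conjugate variable is a polynomial
    of its own. *)
Definition gpolyc (k : K) : poly := gvar k false - 'i *: gvar k true.

Definition dvar (k : K) (b : bool) : poly -> poly := mderiv (enum_rank (k, b)).
(** Up to the factor [2 v], the Wirtinger derivative in the conjugate variable; [dgpoly] is the one
    in the variable itself. *)
Definition dgpolyc (k : K) (p : poly) : poly :=
  v%:C *: (dvar k false p + 'i *: dvar k true p).
Definition dgpoly (k : K) (p : poly) : poly :=
  v%:C *: (dvar k false p - 'i *: dvar k true p).

Lemma dvarM k b : derivation (dvar k b).
Proof. by split=> x y; rewrite /dvar ?linearD ?mderivM. Qed.

Lemma derivation_scale (a : C) (d : poly -> poly) :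
  derivation d -> derivation (fun x => a *: d x).
Proof.
move=> [dD dM]; split=> x y; first by rewrite dD scalerDr.
by rewrite dM scalerDr scalerAl scalerAr.
Qed.

Lemma derivation_add (d d' : poly -> poly) :
  derivation d -> derivation d' -> derivation (fun x => d x + d' x).
Proof.
move=> [dD dM] [dD' dM']; split=> x y; first by rewrite dD dD' addrACA.
by rewrite dM dM' mulrDl mulrDr addrACA.
Qed.

Lemma dgpolycM k : derivation (dgpolyc k).
Proof.
apply: derivation_scale; apply: derivation_add; first exact: dvarM.
by apply: derivation_scale; apply: dvarM.
Qed.

Lemma dgpolyM k : derivation (dgpoly k).
Proof.
have -> : dgpoly k = fun p => v%:C *: (dvar k false p + (- 'i) *: dvar k true p).
  by apply/funext => p; rewrite /dgpoly scaleNr.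
apply: derivation_scale; apply: derivation_add; first exact: dvarM.
by apply: derivation_scale; apply: dvarM.
Qed.

Lemma dvar_gvar k b l c : dvar k b (gvar l c) = ((k == l) && (b == c))%:R.
Proof.
rewrite /dvar /gvar mderivX mnm1E (inj_eq enum_rank_inj) xpair_eqE [l == k]eq_sym [c == b]eq_sym.
case: (k =P l) => [->|_] /=; last by rewrite scale0r.
case: (b =P c) => [->|_] /=; last by rewrite scale0r.
by rewrite scale1r -[RHS]mpolyX0; congr mpolyX; apply/mnmP => i; rewrite mnmBE mnm0E subnn.
Qed.

Lemma dvarD k b x y : dvar k b (x + y) = dvar k b x + dvar k b y.
Proof. by rewrite /dvar linearD. Qed.

Lemma dvarZ k b a x : dvar k b (a *: x) = a *: dvar k b x.
Proof. by rewrite /dvar linearZ. Qed.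

Lemma dvarN k b x : dvar k b (- x) = - dvar k b x.
Proof. by rewrite /dvar linearN. Qed.

Lemma dgpolycD k x y : dgpolyc k (x + y) = dgpolyc k x + dgpolyc k y.
Proof. exact: (dgpolycM k).1. Qed.

Lemma dgpolyD k x y : dgpoly k (x + y) = dgpoly k x + dgpoly k y.
Proof. exact: (dgpolyM k).1. Qed.

Lemma dgpolycZ k c x : dgpolyc k (c *: x) = c *: dgpolyc k x.
Proof. by rewrite /dgpolyc !dvarZ !scalerDr !scalerA; congr (_ *: _ + _ *: _); ring. Qed.

Lemma dgpolyZ k c x : dgpoly k (c *: x) = c *: dgpoly k x.
Proof. by rewrite /dgpoly !dvarZ !scalerBr !scalerA; congr (_ *: _ - _ *: _); ring. Qed.

Lemma dgpolyc_comb k a b x y : dgpolyc k (a *: x + b *: y) = a *: dgpolyc k x + b *: dgpolyc k y.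
Proof. by rewrite dgpolycD !dgpolycZ. Qed.

Lemma dgpoly_comb k a b x y : dgpoly k (a *: x + b *: y) = a *: dgpoly k x + b *: dgpoly k y.
Proof. by rewrite dgpolyD !dgpolyZ. Qed.

Lemma ii : 'i * 'i = -1 :> C.
Proof. by rewrite -sqr_i expr2. Qed.

Definition gdvars := (dvarD, dvarN, dvarZ, dvar_gvar).

Lemma dgpolyc_gpoly k l : dgpolyc k (gpoly l) = 0.
Proof.
rewrite /dgpolyc /gpoly !gdvars /=; case: (k == l) => /=;
  rewrite !(scaler0, addr0, add0r) // scalerA ii scaleN1r.
by rewrite subrr scaler0.
Qed.

Lemma dgpoly_gpolyc k l : dgpoly k (gpolyc l) = 0.
Proof.
rewrite /dgpoly /gpolyc !gdvars /=; case: (k == l) => /=;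
  rewrite ?(scaler0, addr0, subr0, add0r, oppr0) // scalerN scalerA ii scaleN1r.
by rewrite opprK subrr scaler0.
Qed.

Lemma dgpolyc_gpolyc k l : dgpolyc k (gpolyc l) = (2 * v)%:C *: (k == l)%:R.
Proof.
rewrite /dgpolyc /gpolyc !gdvars /=; case: (k == l) => /=;
  rewrite ?(scaler0, addr0, subr0, add0r, oppr0) // scalerN scalerA ii scaleN1r opprK.
by rewrite -mulr2n -scaler_nat scalerA mulrC rmorphM /= rmorph_nat.
Qed.

Lemma dgpoly_gpoly k l : dgpoly k (gpoly l) = (2 * v)%:C *: (k == l)%:R.
Proof.
rewrite /dgpoly /gpoly !gdvars /=; case: (k == l) => /=;
  rewrite ?(scaler0, addr0, subr0, add0r, oppr0) // scalerA ii scaleN1r opprK.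
by rewrite -mulr2n -scaler_nat scalerA mulrC rmorphM /= rmorph_nat.
Qed.

Lemma gaussE_gpoly k p : L (gpoly k * p) = L (dgpolyc k p).
Proof.
rewrite /gpoly /dgpolyc mulrDl -scalerAl gaussEZ !gaussED !gaussEZ !gaussE_stein.
by rewrite mulrDr mulrCA.
Qed.

Lemma gaussE_gpolyc k p : L (gpolyc k * p) = L (dgpoly k p).
Proof.
rewrite /gpolyc /dgpoly mulrBl -scalerAl gaussEZ !gaussEB !gaussEZ !gaussE_stein.
by rewrite mulrBr mulrCA.
Qed.

Lemma gaussE_comb (a b : C) (g h p q F : poly) :
  L (g * F) = L p -> L (h * F) = L q -> L ((a *: g + b *: h) * F) = L (a *: p + b *: q).
Proof. by move=> E1 E2; rewrite mulrDl -!scalerAl !gaussED !gaussEZ E1 E2. Qed.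

End ComplexGaussian.

Section Normalise.
Context {R : realType} (N : nat) (t : seq nat -> R).
Hypotheses (N_gt0 : (0 < N)%N) (t_nil : t [::] = 1)
  (t_zero : forall s, t (0%N :: s) = N%:R * t s).

Let N1 : N%:R != 0 :> R. Proof. by rewrite pnatr_eq0 -lt0n. Qed.

(** A split produces one more trace, whose normalisation cancels the factor N^-1; a merge loses one,
    so its factor becomes N^-2. *)
Lemma trace_rec_hermitian :
  (forall a s, t (a.+1 :: s) =
     N%:R^-1 * (\sum_(j < a) t [:: (j : nat), (a.-1 - j)%N & s])
     + N%:R^-1 * (\sum_(i < size s) (nth 0%N s i)%:R * t ((a + nth 0%N s i).-1 :: del i s))) ->
  trace_rec 1 0 (N%:R ^- 2) (fun s => t s / N%:R ^+ size s).
Proof.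
move=> tS; split=> [|s|a s]; first by rewrite t_nil expr0 divr1.
  by rewrite t_zero /= exprS; field; rewrite expf_neq0 //= N1.
rewrite tS /= mul0r add0r subn1 /= mulrDl; congr (_ + _).
  rewrite mulr_sumr mulr_suml; apply: eq_bigr => j _.
  by rewrite subn1 !exprS ?expr0; field; rewrite expf_neq0 //= N1.
rewrite mulr_sumr mulr_suml mulr_sumr; apply: eq_bigr => i _; rewrite subn1.
have -> : N%:R ^+ (size s).+1 = N%:R * (N%:R * N%:R ^+ size (del i s)) :> R.
  by rewrite -!exprS -(size_del (ltn_ord i)).
by rewrite /= !exprS ?expr0; field; rewrite expf_neq0 //= N1.
Qed.

(** Of the term [M * t (a :: s)] a share [N * t (a :: s) = t [:: 0, a & s]] supplies the missing
    summand of index 0 of the convolution; the rest, [M - N], becomes [beta] after division by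
    [N]. *)
Lemma trace_rec_wishart (M : nat) :
  (forall a s, t (a.+1 :: s) =
     N%:R^-1 * (M%:R * t (a :: s) + \sum_(j < a) t [:: j.+1 : nat, (a.-1 - j)%N & s])
     + N%:R^-1 * (\sum_(i < size s) (nth 0%N s i)%:R * t ((a + nth 0%N s i)%N :: del i s))) ->
  trace_rec 0 (M%:R / N%:R - 1) (N%:R ^- 2) (fun s => t s / N%:R ^+ size s).
Proof.
move=> tS; split=> [|s|a s]; first by rewrite t_nil expr0 divr1.
  by rewrite t_zero /= exprS; field; rewrite expf_neq0 //= N1.
rewrite tS /= subn0 big_ord_recl /= subn0 mulrDl; congr (_ + _); last first.
  rewrite mulr_sumr mulr_suml mulr_sumr; apply: eq_bigr => i _; rewrite subn0.
  have -> : N%:R ^+ (size s).+1 = N%:R * (N%:R * N%:R ^+ size (del i s)) :> R.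
    by rewrite -!exprS -(size_del (ltn_ord i)).
  by rewrite /= !exprS ?expr0; field; rewrite expf_neq0 //= N1.
rewrite subn0 t_zero.
have -> : \sum_(i < a) t [:: bump 0 i, (a - bump 0 i)%N & s] / N%:R ^+ (size s).+2
  = (\sum_(j < a) t [:: j.+1 : nat, (a.-1 - j)%N & s]) / N%:R ^+ (size s).+2.
  rewrite mulr_suml; apply: eq_bigr => i _; rewrite /bump /= add1n.
  by rewrite (_ : a - i.+1 = a.-1 - i)%N //; lia.
by rewrite !exprS ?expr0; field; rewrite expf_neq0 //= N1.
Qed.
End Normalise.

(** * The random matrices with formal entries *)

Section FormalModels.
Context {R : realType}.
Local Notation C := R[i].

Definition gue_mx (N : nat) (z : C) : 'M[mpoly #|{: 'I_N * 'I_N * bool}| C]_N :=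
  \matrix_(i, j) (z *: gpoly (i, j) + z^* *: gpolyc (j, i)).

(** The boolean index tells the variables of the two independent matrices apart: [false] for [P],
    [true] for [Q]. *)
Definition wishart_l (N M : nat) (z1 z2 : C) :
    'M[mpoly #|{: bool * ('I_N * 'I_M) * bool}| C]_(N, M) :=
  \matrix_(i, j) (z1 *: gpoly (false, (i, j)) + z2 *: gpoly (true, (i, j))).

Definition wishart_r (N M : nat) (z1 z2 : C) :
    'M[mpoly #|{: bool * ('I_N * 'I_M) * bool}| C]_(M, N) :=
  \matrix_(j, i) (z1^* *: gpolyc (false, (i, j)) + z2^* *: gpolyc (true, (i, j))).

Section RealFunctional.
Context (n : nat) (v : R).

Definition gaussR (p : mpoly n C) : R := complex.Re (gaussE v p).

Lemma gaussR_is_additive : zmod_morphism gaussR.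
Proof. by move=> p q; rewrite /gaussR gaussEB; case: (gaussE v p); case: (gaussE v q). Qed.

HB.instance Definition _ := GRing.isZmodMorphism.Build (mpoly n C) R gaussR gaussR_is_additive.

Lemma gaussR_kap (c : R) (p : mpoly n C) : gaussR ((c%:C *: 1) * p) = c * gaussR p.
Proof. by rewrite -scalerAl mul1r /gaussR gaussEZ ReZ. Qed.

Lemma gaussR_nil N (A : 'M[mpoly n C]_N) : gaussR (tr_prod A [::]) = 1.
Proof. by rewrite /gaussR /tr_prod big_nil gaussE1. Qed.

Lemma gaussR_zero N (A : 'M[mpoly n C]_N) s :
  gaussR (tr_prod A (0%N :: s)) = N%:R * gaussR (tr_prod A s).
Proof. by rewrite /tr_prod big_cons expr0 mxtrace1 !mulr_natl raddfMn. Qed.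

End RealFunctional.

Definition norm_traces (n N : nat) (v : R) (A : 'M[mpoly n C]_N) (s : seq nat) : R :=
  gaussR v (tr_prod A s) / N%:R ^+ size s.

Lemma mulcJ (z : C) : z * z^* = (complex.Re z ^+ 2 + complex.Im z ^+ 2)%:C.
Proof. by rewrite add_Re2_Im2 sqr_normc. Qed.

(** Terms carrying [z ^+ 2] or its conjugate vanish by circular symmetry ([dgpolyc_gpoly],
    [dgpoly_gpolyc]). Only the squared modulus of [z] survives, times [2 v] from the variable and
    [2 v] from its conjugate. *)
Lemma gue_trace_rec (N : nat) (z : C) (v : R) : (0 < N)%N ->
  (complex.Re z ^+ 2 + complex.Im z ^+ 2) * (4 * v) = N%:R^-1 ->
  trace_rec 1 0 (N%:R ^- 2) (norm_traces v (gue_mx N z)).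
Proof.
move=> N0 hz.
pose D (i j : 'I_N) p := z *: dgpolyc v (i, j) p + z^* *: dgpoly v (j, i) p.
have DP i j : derivation (D i j).
  apply: derivation_add; apply: derivation_scale; first exact: dgpolycM.
  exact: dgpolyM.
have LD i j F : gaussE v (gue_mx N z i j * F) = gaussE v (D i j F).
  have -> : gue_mx N z i j = z *: gpoly (i, j) + z^* *: gpolyc (j, i) by rewrite mxE.
  by apply: gaussE_comb; [exact: gaussE_gpoly | exact: gaussE_gpolyc].
have DH i j k l : D i j (gue_mx N z k l) = (N%:R^-1)%:C *: 1 *+ ((k == j) && (l == i)).
  have -> : gue_mx N z k l = z *: gpoly (k, l) + z^* *: gpolyc (l, k) by rewrite mxE.
  rewrite /D dgpolyc_comb dgpoly_comb.
  rewrite dgpolyc_gpoly dgpoly_gpolyc dgpolyc_gpolyc dgpoly_gpoly.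
  rewrite !xpair_eqE [i == l]eq_sym [j == k]eq_sym [(l == i) && _]andbC.
  case: ((k == j) && (l == i)); last by rewrite !mulr0n !scaler0 !addr0 !scaler0 addr0.
  rewrite !scaler0 add0r addr0.
  rewrite !scalerA -scalerDl mulr1n; congr (_ *: _).
  by rewrite -hz !rmorphM /= -mulcJ !rmorph_nat; ring.
apply: trace_rec_hermitian => // [|s|a s]; [exact: gaussR_nil | exact: gaussR_zero |].
apply: (loop_hermitian_scalar (gaussR_kap v _) a s DP DH) => i j F.
by rewrite /= /gaussR LD.
Qed.

Lemma wishart_trace_rec (N M : nat) (z1 z2 : C) (v : R) : (0 < N)%N ->
  (complex.Re z1 ^+ 2 + complex.Im z1 ^+ 2 + (complex.Re z2 ^+ 2 + complex.Im z2 ^+ 2))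
    * (2 * v) = N%:R^-1 ->
  trace_rec 0 (M%:R / N%:R - 1) (N%:R ^- 2)
    (norm_traces v (wishart_l N M z1 z2 *m wishart_r N M z1 z2)).
Proof.
move=> N0 hz.
pose D (i : 'I_N) (j : 'I_M) p := z1 *: dgpolyc v (false, (i, j)) p + z2 *: dgpolyc v (true, (i, j)) p.
have DP i j : derivation (D i j).
  by apply: derivation_add; apply: derivation_scale; apply: dgpolycM.
have LD i j F : gaussE v (wishart_l N M z1 z2 i j * F) = gaussE v (D i j F).
  have -> : wishart_l N M z1 z2 i j = z1 *: gpoly (false, (i, j)) + z2 *: gpoly (true, (i, j)).
    by rewrite mxE.
  by apply: gaussE_comb; exact: gaussE_gpoly.
have DY i j k l : D i j (wishart_l N M z1 z2 k l) = 0.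
  have -> : wishart_l N M z1 z2 k l = z1 *: gpoly (false, (k, l)) + z2 *: gpoly (true, (k, l)).
    by rewrite mxE.
  by rewrite /D !dgpolyc_comb !dgpolyc_gpoly !(scaler0, addr0).
have DY' i j k l : D i j (wishart_r N M z1 z2 k l) = (N%:R^-1)%:C *: 1 *+ ((k == j) && (l == i)).
  have -> : wishart_r N M z1 z2 k l = z1^* *: gpolyc (false, (l, k)) + z2^* *: gpolyc (true, (l, k)).
    by rewrite mxE.
  rewrite /D !dgpolyc_comb !dgpolyc_gpolyc !xpair_eqE /=.
  rewrite [i == l]eq_sym [j == k]eq_sym [(l == i) && _]andbC.
  case: ((k == j) && (l == i)); last by rewrite !mulr0n !scaler0 !addr0 !scaler0 addr0.
  rewrite !scaler0 addr0 add0r !scalerA -scalerDl mulr1n; congr (_ *: _).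
  by rewrite -hz !mulrA !mulcJ -!rmorphM -rmorphD /=; congr (_%:C); ring.
apply: trace_rec_wishart => // [|s|a s]; [exact: gaussR_nil | exact: gaussR_zero |].
apply: (loop_wishart_scalar (gaussR_kap v _) a s DP DY DY') => i j F.
by rewrite /= /gaussR LD.
Qed.

End FormalModels.

(** * Gaussian moments and independence *)

Section WeightedExtension.
Import HBNNSimple.
Local Open Scope ereal_scope.
Context {R : realType} d1 d2 d (T1 : measurableType d1) (T2 : measurableType d2)
  (U : measurableType d).
Variables (m1 : {measure set T1 -> \bar R}) (m2 : {measure set T2 -> \bar R}).
Variables (X1 : T1 -> U) (X2 : T2 -> U) (w1 : T1 -> R) (w2 : T2 -> R).
Hypotheses (mX1 : measurable_fun setT X1) (mX2 : measurable_fun setT X2)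
  (mw1 : measurable_fun setT w1) (mw2 : measurable_fun setT w2)
  (w1_ge0 : forall x, (0 <= w1 x)%R) (w2_ge0 : forall x, (0 <= w2 x)%R).

Lemma integral_weighted_nnsfun d' (T' : measurableType d') (m : {measure set T' -> \bar R})
    (X : T' -> U) (w : T' -> R) (g : {nnsfun U >-> R}) :
  measurable_fun setT X -> measurable_fun setT w -> (forall x, (0 <= w x)%R) ->
  \int[m]_x (w x * g (X x))%:E =
  \sum_(r \in range g) r%:E * \int[m]_x (w x * \1_(g @^-1` [set r]) (X x))%:E.
Proof.
move=> mX mw w0.
have gr0 r x : (0 <= r * (w x * \1_(g @^-1` [set r]) (X x)))%R.
  have [r0|r0] := leP 0%R r; first by rewrite !mulr_ge0.
  rewrite indicE memNset ?mulr0 //= => gr.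
  by have : (0 <= g (X x))%R by []; rewrite gr leNgt r0.
have mI r : measurable_fun setT (fun x => w x * \1_(g @^-1` [set r]) (X x))%R.
  apply: measurable_funM => //.
  by apply: (measurableT_comp _ mX); apply: measurable_indic.
under eq_integral => x _.
  rewrite fimfunE EFinM -fsumEFin // ge0_mule_fsumr; last first.
    move=> r; rewrite lee_fin; have [r0|r0] := leP 0%R r; first by rewrite mulr_ge0.
    rewrite indicE memNset ?mulr0 //= => gr.
    by have : (0 <= g (X x))%R by []; rewrite gr leNgt r0.
  over.
rewrite /= ge0_integral_fsum //; last 2 first.
- move=> r; apply/measurable_EFinP.
  rewrite (_ : (fun x => _) = (fun x => r * (w x * \1_(g @^-1` [set r]) (X x)))%R).
    exact: measurable_funM.
  by apply/funext => x; rewrite mulrCA.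
- by move=> r x _; rewrite -EFinM lee_fin mulrCA.
apply: eq_fsbigr => r /set_mem [u _ <-].
rewrite -ge0_integralZl //.
- by apply: eq_integral => x _; rewrite -!EFinM mulrCA.
- exact/measurable_EFinP.
- by move=> x _; rewrite lee_fin mulr_ge0.
- by rewrite lee_fin.
Qed.

(** Indicators determine simple functions, and monotone convergence does the rest. The weights give
    the lemma two uses: a law with a density ([w2] the density), and one variable isolated from an
    independent product ([w1] the product of the others). *)
Lemma integral_weighted_ext (f : U -> R) :
  (forall A, measurable A ->
    \int[m1]_x (w1 x * \1_A (X1 x))%:E = \int[m2]_x (w2 x * \1_A (X2 x))%:E) ->
  measurable_fun setT f -> (forall u, (0 <= f u)%R) ->
  \int[m1]_x (w1 x * f (X1 x))%:E = \int[m2]_x (w2 x * f (X2 x))%:E.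
Proof.
move=> H mf f0.
have mf' : measurable_fun setT (EFin \o f) by exact/measurable_EFinP.
pose h := nnsfun_approx measurableT mf'.
have step d' (T' : measurableType d') (m : {measure set T' -> \bar R}) (X : T' -> U) (w : T' -> R) :
  measurable_fun setT X -> measurable_fun setT w -> (forall x, (0 <= w x)%R) ->
  \int[m]_x (w x * f (X x))%:E = lim (\int[m]_x (w x * h n (X x))%:E @[n --> \oo]).
  move=> mX mw w0; rewrite -monotone_convergence //=.
  - apply: eq_integral => x _; apply/esym/cvg_lim => //=.
    apply: (@cvg_trans _ ((fun n => (w x)%:E * (h n (X x))%:E) @ \oo)); first by [].
    rewrite EFinM; apply: cvgeZl => //.
    by apply: (@cvg_nnsfun_approx _ _ _ _ measurableT _ mf') => // u _; rewrite lee_fin.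
  - move=> n; apply/measurable_EFinP; apply: measurable_funM => //.
    exact: measurableT_comp.
  - by move=> n x _; rewrite lee_fin mulr_ge0.
  - move=> x _ a b ab; rewrite lee_fin ler_wpM2l //.
    by have /lefP := @nd_nnsfun_approx _ _ _ _ measurableT _ mf' a b ab; apply.
rewrite !step //; congr (lim (_ @ \oo)); apply/funext => n.
rewrite !integral_weighted_nnsfun //; apply: eq_fsbigr => r _.
by rewrite H //; exact: measurable_sfunP.
Qed.
End WeightedExtension.

(** * Moments of the normal law *)

Section NormalMoments.
Context {R : realType} (v : R).
Hypothesis v_gt0 : 0 < v.
Local Notation lam := (@lebesgue_measure R).
Local Notation phi := (normal_pdf 0 (Num.sqrt v)).

Let s_neq0 : Num.sqrt v != 0.
Proof. by rewrite gt_eqF // sqrtr_gt0. Qed.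

Let phiE x : phi x = normal_peak (Num.sqrt v) * expR (- (2 * v)^-1 * x ^+ 2).
Proof.
rewrite normal_pdfE // /normal_fun subr0 sqr_sqrtr ?ltW //; congr (_ * expR _).
by rewrite -mulr_natl mulNr mulrC mulNr.
Qed.

Let phi_ge0 x : 0 <= phi x. Proof. exact: normal_pdf_ge0. Qed.

Let phi_even x : phi (- x) = phi x.
Proof. by rewrite !phiE sqrrN. Qed.

Let is_derive_phi (x : R) : is_derive x 1 phi (- (x / v) * phi x).
Proof.
have -> : phi = (fun y => normal_peak (Num.sqrt v) * expR (- (2 * v)^-1 * y ^+ 2)).
  by apply/funext => y; exact: phiE.
have H : is_derive x 1 (fun y : R => - (2 * v)^-1 * y ^+ 2) (- (x / v)).
  apply: is_derive_eq; rewrite /GRing.scale /=; by field; rewrite gt_eqF.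
apply: is_derive_eq.
rewrite /GRing.scale /=; ring.
Qed.

Let cont_phi : continuous phi. Proof. exact: continuous_normal_pdf. Qed.

(** Antiderivative of [tail_der k], whose vanishing integral over the half line is the recursion
    between the moments of degree [k] and [k.+2]. *)
Definition tail_prim (k : nat) (x : R) : R := - v * (x ^+ k.+1 * phi x).
Definition tail_der (k : nat) (x : R) : R := x ^+ k.+2 * phi x - k.+1%:R * v * (x ^+ k * phi x).

Lemma is_derive_tail_prim k (x : R) : is_derive x 1 (tail_prim k) (tail_der k x).
Proof.
have H (g : R -> R) (dg : R) : is_derive x 1 g dg ->
    is_derive x 1 (fun y => - v * (y ^+ k.+1 * g y)) (- v * (x ^+ k.+1 * dg + k.+1%:R * x ^+ k * g x)).
  move=> Dg.
  have D1 : is_derive x 1 (fun y : R => y ^+ k.+1) (k.+1%:R * x ^+ k).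
    apply: DeriveDef; first exact: exprn_derivable.
    by rewrite exp_derive /GRing.scale /= mulr1 mulr_natl.
  apply: (is_derive_eq (is_deriveZ (- v) (is_deriveM D1 Dg))).
  rewrite /GRing.scale /=; ring.
have := H _ _ (is_derive_phi x); congr (is_derive x 1 _ _).
rewrite /tail_der !exprS; field; by rewrite gt_eqF.
Qed.

Lemma cont_Xphi k : continuous (fun x : R => x ^+ k * phi x).
Proof. by move=> x; apply: (@cvgM _ _ _ _ (fun x => x ^+ k) phi); [exact: exprn_continuous|exact: cont_phi]. Qed.

Lemma cont_tail_der k : continuous (tail_der k).
Proof.
move=> x; apply: cvgB; first exact: cont_Xphi.
by apply: cvgM; [exact: cvg_cst|exact: cont_Xphi].
Qed.

Lemma expR_ge_pow (y : R) n : 0 <= y -> (y / n.+1%:R) ^+ n.+1 <= expR y.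
Proof.
move=> y0; have -> : expR y = expR (y / n.+1%:R) ^+ n.+1.
  by rewrite -expRM_natr; congr expR; rewrite divfK // pnatr_eq0.
have h : 0 <= y / n.+1%:R by rewrite divr_ge0.
rewrite lerXn2r // ?nnegrE ?expR_ge0 //.
by apply: le_trans (expR_ge1Dx _); rewrite lerDr.
Qed.

Lemma tail_prim_cvg k : tail_prim k x @[x --> +oo] --> (0 : R).
Proof.
rewrite /tail_prim -[X in _ --> X](mulr0 (- v)); apply: cvgM; first exact: cvg_cst.
(* [expR_ge_pow] at [x ^+ 2 / (2 v)] bounds [(x ^+ k.+1) ^+ 2] by a constant times the exponential;
   one factor [x ^+ k.+1], at least [x], is left over and gives the decay [C / x]. *)
pose C := normal_peak (Num.sqrt v) * (2 * v * k.+1%:R) ^+ k.+1.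
have C0 : 0 <= C.
  by rewrite mulr_ge0 ?normal_peak_ge0 // exprn_ge0 // mulr_ge0 // mulr_ge0 // ltW.
apply: (@squeeze_cvgr _ _ _ _ (fun=> 0) (fun x => C * x^-1)).
- near=> x; have x1 : 1 <= x by near: x; apply: nbhs_pinfty_ge; rewrite num_real.
  have x0 : 0 < x by lra.
  apply/andP; split; first exact: mulr_ge0 (exprn_ge0 _ (ltW x0)) (phi_ge0 x).
  rewrite phiE mulNr expRN.
  have := @expR_ge_pow ((2 * v)^-1 * x ^+ 2) k.
  rewrite mulr_ge0 ?sqr_ge0 ?invr_ge0 ?mulr_ge0 // ?(ltW v_gt0) // => /(_ isT) h.
  set e := expR _ in h *.
  have e0 : 0 < e by exact: expR_gt0.
  set p := normal_peak _.
  have p0 : 0 <= p by exact: normal_peak_ge0.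
  have D0 : 0 < 2 * v * k.+1%:R by rewrite !mulr_gt0.
  have h2 : (x ^+ k.+1) ^+ 2 <= (2 * v * k.+1%:R) ^+ k.+1 * e.
    apply: le_trans (ler_wpM2l (exprn_ge0 _ (ltW D0)) h).
    rewrite -exprMn -exprM mulnC exprM lerXn2r ?nnegrE ?sqr_ge0 //.
      by rewrite !mulr_ge0 ?invr_ge0 ?sqr_ge0 // ?mulr_ge0 // ltW.
    rewrite le_eqVlt; apply/orP; left; apply/eqP; field.
    by rewrite (gt_eqF v_gt0) /= addrC natr1 pnatr_eq0.
  rewrite ler_pdivlMr // -/p /C -/p.
  have xk : x <= x ^+ k.+1 by rewrite -{1}(expr1 x) ler_weXn2l.
  rewrite (_ : x ^+ k.+1 * (p / e) * x = (p / e) * (x ^+ k.+1 * x)); last by ring.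
  apply: (@le_trans _ _ (p / e * (x ^+ k.+1) ^+ 2)).
    apply: ler_wpM2l; first exact: divr_ge0 p0 (ltW e0).
    by rewrite expr2; apply: ler_wpM2l => //; exact: exprn_ge0 (ltW x0).
  by rewrite mulrAC ler_pdivrMr //; have := ler_wpM2l p0 h2; rewrite !mulrA.
- exact: cvg_cst.
- rewrite -[X in _ --> X](mulr0 C); apply: cvgM; first exact: cvg_cst.
  apply/cvgr0Pnorm_lt => e e0; near=> x.
  have x0 : e^-1 < x by near: x; apply: nbhs_pinfty_gt; rewrite num_real.
  have x1 : 0 < x by apply: lt_trans x0; rewrite invr_gt0.
  by rewrite gtr0_norm ?invr_gt0 // -[ltRHS]invrK ltf_pV2 // posrE invr_gt0.
Unshelve. all: by end_near. Qed.

Lemma half_line_split (a : R) (g : R -> R) : 0 <= a -> continuous g ->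
  (forall x, 0 <= x -> 0 <= g x) ->
  (\int[lam]_(x in `[0%R, +oo[) (g x)%:E =
   \int[lam]_(x in `[0%R, a]) (g x)%:E + \int[lam]_(x in `[a, +oo[) (g x)%:E)%E.
Proof.
move=> a0 cg g0.
have mg : measurable_fun setT g by exact: continuous_measurable_fun.
have -> : `[0%R, +oo[%classic = `[0%R, a] `|` `]a, +oo[ :> set R.
  by rewrite -itv_bndbnd_setU //= bnd_simp.
rewrite ge0_integral_setU //=.
- rewrite integral_itv_obnd_cbnd //; apply/measurable_EFinP; exact: measurable_funTS.
- by apply/measurable_EFinP; exact: measurable_funTS.
- move=> x [|]; rewrite /= in_itv /= => /andP[h _]; rewrite lee_fin g0 //.
  by rewrite ltW // (le_lt_trans a0).
- apply/disj_setPS => x [/=]; rewrite !in_itv /= => /andP[_ h1] /andP[h2 _].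
  by move: (lt_le_trans h2 h1); rewrite ltxx.
Qed.

(** On the half line the integrand is nonnegative, so the recursion holds in the extended reals
    before finiteness is known; finiteness is then deduced from it. *)
Definition half_mom (k : nat) : \bar R :=
  (\int[lam]_(x in `[0%R, +oo[) (x ^+ k * phi x)%:E)%E.

Lemma half_mom_rec k : half_mom k.+2 = ((k.+1%:R * v)%:E * half_mom k)%E.
Proof.
(* The only sign change of [tail_der k] on the half line. On either side of it the fundamental
   theorem of calculus applies to an integrand of constant sign, and no difference of possibly
   infinite integrals occurs. *)
pose a := Num.sqrt (k.+1%:R * v).
have kv : 0 < k.+1%:R * v by rewrite mulr_gt0.
have a0 : 0 < a by rewrite sqrtr_gt0.
have a2 : a ^+ 2 = k.+1%:R * v by rewrite sqr_sqrtr // ltW.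
pose g2 x := x ^+ k.+2 * phi x; pose g0 x := k.+1%:R * v * (x ^+ k * phi x).
have fE x : tail_der k x = (x ^+ 2 - a ^+ 2) * (x ^+ k * phi x).
  by rewrite /tail_der a2 !exprS; ring.
have xk0 x : 0 <= x -> 0 <= x ^+ k * phi x.
  by move=> x0; exact: mulr_ge0 (exprn_ge0 _ x0) (phi_ge0 x).
have cg2 : continuous g2 by exact: cont_Xphi.
have cg0 : continuous g0.
  by move=> x; apply: cvgM; [exact: cvg_cst|exact: cont_Xphi].
have g2_ge0 x : 0 <= x -> 0 <= g2 x.
  by move=> x0; exact: mulr_ge0 (exprn_ge0 _ x0) (phi_ge0 x).
have g0_ge0 x : 0 <= x -> 0 <= g0 x by move=> x0; rewrite mulr_ge0 ?xk0 // ltW.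
have mE (D : set R) (g : R -> R) : continuous g -> measurable_fun D (EFin \o g).
  move=> cg; apply/measurable_EFinP; apply: measurable_funTS.
  exact: continuous_measurable_fun.
have dF x : derivable (tail_prim k) x 1 by have [] := is_derive_tail_prim k x.
have cF : continuous (tail_prim k).
  by move=> x; apply: differentiable_continuous; apply/derivable1_diffP.
have F'E x : (tail_prim k)^`()%classic x = tail_der k x.
  by rewrite derive1E; have [_ ->] := is_derive_tail_prim k x.
have Hy : (\int[lam]_(x in `[a, +oo[) (tail_der k x)%:E = (- tail_prim k a)%:E)%E.
  rewrite (@ge0_continuous_FTC2y _ _ (tail_prim k) _ 0) //.
  - by rewrite -EFinB sub0r.
  - move=> x ax; rewrite fE mulr_ge0 ?xk0 //; last lra.
    by rewrite subr_ge0 lerXn2r ?nnegrE //; lra.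
  - by apply: continuous_subspaceT; exact: cont_tail_der.
  - exact: tail_prim_cvg.
  - by apply: cvg_at_right_filter; exact: cF.
have Hb : (\int[lam]_(x in `[0%R, a]) (- tail_der k x)%:E = (- tail_prim k a)%:E)%E.
  rewrite (@continuous_FTC2 _ _ (fun x => - tail_prim k x)) //.
  - have -> : tail_prim k 0 = 0 by rewrite /tail_prim expr0n /= mul0r mulr0.
    by rewrite -EFinB oppr0 subr0.
  - apply: continuous_subspaceT => x; apply: cvgN; exact: cont_tail_der.
  - split.
    + by move=> x _; apply: derivableN.
    + by apply: cvg_at_right_filter; apply: cvgN; exact: cF.
    + by apply: cvg_at_left_filter; apply: cvgN; exact: cF.
  - move=> x _; rewrite derive1E deriveN // -derive1E F'E //.
have S2 : (\int[lam]_(x in `[a, +oo[) (g2 x)%:E =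
   (- tail_prim k a)%:E + \int[lam]_(x in `[a, +oo[) (g0 x)%:E)%E.
  rewrite -Hy -ge0_integralD //=.
  - by apply: eq_integral => x _; rewrite -EFinD /tail_der /g2 /g0 subrK.
  - move=> x; rewrite /= in_itv /= andbT => ax; rewrite lee_fin fE mulr_ge0 ?xk0 //; last lra.
    by rewrite subr_ge0 lerXn2r ?nnegrE //; lra.
  - exact: mE (@cont_tail_der k).
  - move=> x; rewrite /= in_itv /= andbT => ax; rewrite lee_fin g0_ge0 //; lra.
  - exact: mE.
have S0 : (\int[lam]_(x in `[0%R, a]) (g0 x)%:E =
   (- tail_prim k a)%:E + \int[lam]_(x in `[0%R, a]) (g2 x)%:E)%E.
  rewrite -Hb -ge0_integralD //=.
  - by apply: eq_integral => x _; rewrite -EFinD /tail_der /g2 /g0; congr (_%:E); ring.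
  - move=> x; rewrite /= in_itv /= => /andP[x0 ax]; rewrite lee_fin fE -mulNr mulr_ge0 ?xk0 //.
    by rewrite opprB subr_ge0 lerXn2r ?nnegrE //; lra.
  - by apply: mE => x; apply: cvgN; exact: cont_tail_der.
  - by move=> x; rewrite /= in_itv /= => /andP[x0 ax]; rewrite lee_fin g2_ge0.
  - exact: mE.
have -> : ((k.+1%:R * v)%:E * half_mom k = \int[lam]_(x in `[0%R, +oo[) (g0 x)%:E)%E.
  rewrite /half_mom -ge0_integralZl //=.
  - exact: mE (@cont_Xphi k).
  - by move=> x; rewrite /= in_itv /= andbT => x0; rewrite lee_fin xk0.
  - by rewrite lee_fin ltW.
rewrite /half_mom (half_line_split (ltW a0) cg2) // (half_line_split (ltW a0) cg0) //.
by rewrite S2 S0 addeCA addeA.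
Qed.

Lemma integral_two_sides (h : R -> R) : continuous h -> (forall x, 0 <= h x) ->
  (\int[lam]_x (h x)%:E = \int[lam]_(x in `[0%R, +oo[) (h x)%:E
    + \int[lam]_(x in `[0%R, +oo[) (h (- x))%:E)%E.
Proof.
move=> ch h0.
have mh : measurable_fun setT h by exact: continuous_measurable_fun.
have -> : [set: R] = `]-oo, (- 0%R)%R] `|` `]0%R, +oo[.
  by rewrite oppr0 -itv_bndbnd_setU //= set_itvNyy.
rewrite ge0_integral_setU //=.
- rewrite integral_itv_obnd_cbnd //; last by apply/measurable_EFinP; exact: measurable_funTS.
  rewrite ge0_integration_by_substitutionNy; first by rewrite addeC.
    exact: continuous_subspaceT.
  by move=> x _.
- by apply/measurable_EFinP; exact: measurable_funTS.
- by move=> x _; rewrite lee_fin.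
- apply/disj_setPS => x [/=]; rewrite !in_itv /= oppr0 andbT => h1 h2.
  by move: (lt_le_trans h2 h1); rewrite ltxx.
Qed.

Let half_ge0 k : (0 <= half_mom k)%E.
Proof.
apply: integral_ge0 => x; rewrite /= in_itv /= andbT => x0; rewrite lee_fin.
exact: mulr_ge0 (exprn_ge0 _ x0) (phi_ge0 x).
Qed.

Let mXphi k (D : set R) : measurable_fun D (fun x : R => (x ^+ k * phi x)%:E).
Proof.
apply/measurable_EFinP; apply: measurable_funTS; apply: continuous_measurable_fun.
exact: cont_Xphi.
Qed.

Lemma half_mom0 : (half_mom 0 + half_mom 0 = 1)%E.
Proof.
rewrite -(integral_normal_pdf 0 (Num.sqrt v)) (integral_two_sides cont_phi phi_ge0).
congr (_ + _)%E; apply: eq_integral => x _; first by rewrite expr0 mul1r.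
by rewrite expr0 mul1r phi_even.
Qed.

Let half_fin k : half_mom k \is a fin_num.
Proof.
have h0 : half_mom 0 \is a fin_num.
  have := half_mom0; case: (half_mom 0) (half_ge0 0) => // r _ //.
suff H : half_mom k \is a fin_num /\ half_mom k.+1 \is a fin_num by case: H.
elim: k => [|k [IH1 IH2]]; last first.
  by split => //; rewrite half_mom_rec fin_numM.
split=> //; rewrite ge0_fin_numE //.
(* The first odd moment is finite because [x <= 1 + x ^+ 2]. *)
apply: (@le_lt_trans _ _ (half_mom 0 + half_mom 2)%E).
  rewrite /half_mom -ge0_integralD //=.
  - apply: ge0_le_integral => //=.
    + move=> x; rewrite /= in_itv /= andbT => x0; rewrite lee_fin.
      exact: mulr_ge0 (exprn_ge0 _ x0) (phi_ge0 x).
    + exact: mXphi.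
    + by apply: emeasurable_funD; exact: mXphi.
    + move=> x; rewrite /= in_itv /= andbT => x0; rewrite -EFinD lee_fin -mulrDl ler_wpM2r //.
      by rewrite expr0 expr1; nra.
  - move=> x; rewrite /= in_itv /= andbT => x0; rewrite lee_fin.
    exact: mulr_ge0 (exprn_ge0 _ x0) (phi_ge0 x).
  - exact: mXphi.
  - move=> x; rewrite /= in_itv /= andbT => x0; rewrite lee_fin.
    exact: mulr_ge0 (exprn_ge0 _ x0) (phi_ge0 x).
  - exact: mXphi.
rewrite -ge0_fin_numE; last exact: adde_ge0.
by rewrite fin_numD h0 (half_mom_rec 0) fin_numM.
Qed.

Lemma half_mom_even k : ~~ odd k -> (half_mom k + half_mom k = (gauss_mom v k)%:E)%E.
Proof.
elim/ltn_ind: k => -[|[|k]] IH // ek; first exact: half_mom0.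
have ek' : ~~ odd k by move: ek; rewrite /= negbK.
by rewrite half_mom_rec -ge0_muleDr // (IH k) // -EFinM.
Qed.

Lemma gauss_mom_odd k : odd k -> gauss_mom v k = 0.
Proof.
elim/ltn_ind: k => -[|[|k]] IH // ek /=; rewrite IH ?mulr0 //.
by move: ek; rewrite /= negbK.
Qed.

Section RandomVariable.
Context d (T : measurableType d) (Pr : probability T R) (X : {RV Pr >-> R}).
Hypothesis gX : real_gaussian v X.

Lemma gaussian_ge0_integral (f : R -> R) : measurable_fun setT f -> (forall x, 0 <= f x) ->
  (\int[Pr]_w (f (X w))%:E = \int[lam]_x (phi x * f x)%:E)%E.
Proof.
move=> mf f0.
have -> : (\int[Pr]_w (f (X w))%:E = \int[Pr]_w (1 * f (X w))%:E)%E.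
  by apply: eq_integral => w _; rewrite mul1r.
have H := @integral_weighted_ext R _ _ _ _ _ _ Pr lam X id (fun=> 1) phi.
rewrite H //.
  exact: measurable_normal_pdf.
move=> A mA; transitivity (Pr (X @^-1` A)).
  have mXA : measurable (X @^-1` A) by exact: measurable_funPTI.
  rewrite (eq_integral (EFin \o \1_(X @^-1` A))); first by rewrite integral_indic // setIT.
  by move=> w _; rewrite mul1r.
have := gX mA; rewrite /distribution /pushforward => ->.
rewrite /normal_prob [LHS]integral_mkcond; apply: eq_integral => x _.
by rewrite patchE indicE; case: ifP; rewrite ?mulr1 ?mulr0.
Qed.

Lemma gaussian_moment k : Pr.-integrable setT (fun w => (X w ^+ k)%:E) /\
  (\int[Pr]_w (X w ^+ k)%:E = (gauss_mom v k)%:E)%E.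
Proof.
have mX : measurable_fun setT X by [].
have cabs (j : R -> R) : continuous j -> continuous (fun x => phi x * j x).
  by move=> cj x; apply: cvgM; [exact: cont_phi | exact: cj].
have pos (j : R -> R) : continuous j -> (forall x, 0 <= j x) ->
   (\int[Pr]_w (j (X w))%:E = \int[lam]_(x in `[0%R, +oo[) (j x * phi x)%:E
    + \int[lam]_(x in `[0%R, +oo[) (j (- x) * phi x)%:E)%E.
  move=> cj j0; rewrite gaussian_ge0_integral //; last exact: continuous_measurable_fun.
  rewrite integral_two_sides //; last by move=> x; rewrite mulr_ge0.
    congr (_ + _)%E; apply: eq_integral => x _; rewrite mulrC //.
    by rewrite phi_even.
  exact: cabs.
have cX : continuous (fun x : R => x ^+ k) by exact: exprn_continuous.
have intX : Pr.-integrable setT (fun w => (X w ^+ k)%:E).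
  apply/integrableP; split; first by apply/measurable_EFinP; exact: measurable_funX.
  rewrite (eq_integral (fun w => (`|X w ^+ k|)%:E)) //.
  rewrite (pos (fun x => `|x ^+ k|)) //; last by move=> x; apply: cvg_norm; exact: cX.
  have E : (\int[lam]_(x in `[0%R, +oo[) (`|x ^+ k| * phi x)%:E = half_mom k)%E.
    apply: eq_integral => x; rewrite inE /= in_itv /= andbT => x0.
    by rewrite ger0_norm // exprn_ge0.
  have E' : (\int[lam]_(x in `[0%R, +oo[) (`|(- x) ^+ k| * phi x)%:E = half_mom k)%E.
    rewrite -E; apply: eq_integral => x _; congr ((_ * _)%:E).
    by rewrite exprNn normrM normrX normrN1 expr1n mul1r.
  by rewrite E E' -ge0_fin_numE; [rewrite fin_numD !half_fin | exact: adde_ge0].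
split=> //; have [ok|ek] := boolP (odd k).
  rewrite gauss_mom_odd // integralE.
  (* The reflection of the line exchanges positive and negative part, so their integrals agree; each
     equals [half_mom k], which is finite. *)
  pose p (x : R) := Num.max (x ^+ k) 0; pose n (x : R) := Num.max (- x ^+ k) 0.
  have cmax (j : R -> R) : continuous j -> continuous (fun x => Num.max (j x) 0).
    move=> cj; have -> : (fun x => Num.max (j x) 0) = (fun x => (j x + `|j x|) / 2).
      by apply/funext => x; rewrite maxr_absE addr0 subr0.
    move=> x; apply: cvgMl; apply: cvgD; first exact: cj.
    by apply: cvg_norm; exact: cj.
  have cp : continuous p by exact: cmax.
  have cn : continuous n by apply: cmax => x; apply: cvgN; exact: cX.
  rewrite (eq_integral (fun w => (p (X w))%:E)); last by move=> w _; rewrite funeposE /p EFin_max.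
  rewrite [X in (_ - X)%E](eq_integral (fun w => (n (X w))%:E)); last first.
    by move=> w _; rewrite funenegE /n EFin_max.
  have p0 x : 0 <= p x by rewrite le_max lexx orbT.
  have n0 x : 0 <= n x by rewrite le_max lexx orbT.
  rewrite !pos //.
  have pn x : p (- x) = n x.
    by rewrite /p /n exprNn -signr_odd ok expr1 mulN1r.
  have np x : n (- x) = p x by rewrite -pn opprK.
  under [X in (_ + X - _)%E]eq_integral => x _ do rewrite pn.
  under [X in (_ + _ - (_ + X))%E]eq_integral => x _ do rewrite np.
  rewrite [X in (_ - X)%E]addeC subee //.
  have E1 : (\int[lam]_(x in `[0%R, +oo[) (p x * phi x)%:E = half_mom k)%E.
    apply: eq_integral => x; rewrite inE /= in_itv /= andbT => x0.
    by rewrite /p max_l // exprn_ge0.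
  have E2 : (\int[lam]_(x in `[0%R, +oo[) (n x * phi x)%:E = 0)%E.
    apply: integral0_eq => x; rewrite /= in_itv /= andbT => x0.
    by rewrite /n max_r ?mul0r // oppr_le0 exprn_ge0.
  by rewrite E1 E2 adde0.
rewrite (pos (fun x => x ^+ k)) // -?half_mom_even //; last by move=> x; rewrite exprn_even_ge0.
congr (_ + _)%E; apply: eq_integral => x _.
by rewrite exprNn -signr_odd (negbTE ek) expr0 mul1r.
Qed.

End RandomVariable.

End NormalMoments.

Lemma measurable_fun_bigprod {R : realType} d (T : measurableType d) (I : Type) (r : seq I)
    (P : pred I) (F : I -> T -> R) :
  (forall i, measurable_fun setT (F i)) ->
  measurable_fun setT (fun w => \prod_(i <- r | P i) F i w).
Proof.
move=> mF; elim: r => [|i r IH].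
  by under eq_fun do rewrite big_nil; exact: measurable_cst.
by case Pi : (P i); under eq_fun do rewrite big_cons Pi; first exact: measurable_funM.
Qed.

(** * Expectations of products of independent variables *)

Section IndependentFamily.
Context {R : realType} d (T : measurableType d) (Pr : probability T R) (n : nat).
Variable x : 'I_n -> T -> R.
Hypothesis mx : forall i, measurable_fun setT (x i).
Hypothesis indx : forall B : 'I_n -> set R, (forall i, measurable (B i)) ->
  Pr (\bigcap_i (x i @^-1` B i)) = (\prod_i Pr (x i @^-1` B i))%E.

Lemma measurable_prod_comp (f : 'I_n -> R -> R) (P : pred 'I_n) :
  (forall i, measurable_fun setT (f i)) ->
  measurable_fun setT (fun w => \prod_(i | P i) f i (x i w)).
Proof.
move=> mf; apply: measurable_fun_bigprod => i.
exact: (measurableT_comp (mf i) (mx i)).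
Qed.

(** The factors are freed one at a time: in [H k] those of index at least [k] are still indicators.
    [H 0] is independence itself, and [H n] puts no restriction. *)
Lemma ge0_integral_prod (f : 'I_n -> R -> R) (e : 'I_n -> R) :
  (forall i, measurable_fun setT (f i)) -> (forall i y, 0 <= f i y) ->
  (forall i, \int[Pr]_w (f i (x i w))%:E = (e i)%:E)%E ->
  (\int[Pr]_w (\prod_i f i (x i w))%:E = (\prod_i e i)%:E)%E.
Proof.
suff H k : forall (f : 'I_n -> R -> R) (e : 'I_n -> R), (forall i, measurable_fun setT (f i)) -> (forall i y, 0 <= f i y) ->
    (forall i, \int[Pr]_w (f i (x i w))%:E = (e i)%:E)%E ->
    (forall i : 'I_n, (k <= i)%N -> exists2 A, measurable A & f i = \1_A) ->
    (\int[Pr]_w (\prod_i f i (x i w))%:E = (\prod_i e i)%:E)%E.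
  by move=> mf f0 fe; apply: (H n) => // i; rewrite leqNgt ltn_ord.
elim: k => [|k IH] {}f {}e mf f0 fe fk.
  pose B i := sval (cid2 (fk i (leq0n i))).
  have mB i : measurable (B i) by rewrite /B; case: cid2.
  have fB i : f i = \1_(B i) by rewrite /B; case: cid2.
  have eB i : Pr (x i @^-1` B i) = (e i)%:E.
    rewrite -fe; have mXA : measurable (x i @^-1` B i).
      by rewrite -[X in measurable X]setTI; exact: mx.
    rewrite (eq_integral (EFin \o \1_(x i @^-1` B i))); first by rewrite integral_indic // setIT.
    by move=> w _; rewrite fB.
  have mI : measurable (\bigcap_i (x i @^-1` B i)).
    apply: fin_bigcap_measurable => // i _.
    by rewrite -[X in measurable X]setTI; exact: mx.
  rewrite (eq_integral (EFin \o \1_(\bigcap_i (x i @^-1` B i)))).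
    rewrite integral_indic // setIT; apply: (etrans (indx mB)).
    by rewrite (eq_bigr (fun i => (e i)%:E)) // -prodEFin.
  move=> w _ /=; congr (_%:E); rewrite indicE.
  have [h|h] := pselect ((\bigcap_i (x i @^-1` B i)) w).
    by rewrite mem_set // big1 // => i _; rewrite fB indicE mem_set //; exact: h.
  rewrite memNset //; move/existsNP : h => [i /not_implyP[_ h]].
  by rewrite (bigD1 i) //= fB indicE memNset // mul0r.
have [kn|nk] := ltnP k n; last first.
  by apply: IH => // i ki; have := leq_trans nk ki; rewrite leqNgt ltn_ord.
pose j := Ordinal kn.
have e0 i : 0 <= e i.
  by rewrite -lee_fin -fe; apply: integral_ge0 => w _; rewrite lee_fin.
pose c := \prod_(i | i != j) e i.
have c0 : 0 <= c by apply: prodr_ge0.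
have HW := @integral_weighted_ext R _ _ _ _ _ _ Pr Pr (x j) (x j)
  (fun w => \prod_(i | i != j) f i (x i w)) (fun=> c) (mx j) (mx j).
have -> : (\prod_i e i)%:E = (\int[Pr]_w (c * f j (x j w))%:E)%E.
  rewrite (bigD1 j) //= -/c mulrC EFinM -fe -ge0_integralZl //.
  - by apply/measurable_EFinP; exact: (measurableT_comp (mf j) (mx j)).
  - by move=> w _; rewrite lee_fin.
have -> : (\int[Pr]_w (\prod_i f i (x i w))%:E =
    \int[Pr]_w (\prod_(i | i != j) f i (x i w) * f j (x j w))%:E)%E.
  by apply: eq_integral => w _; rewrite (bigD1 j) //= mulrC.
apply: HW => //.
- exact: measurable_prod_comp.
- by move=> w; apply: prodr_ge0.
move=> A mA; pose f' i := if i == j then \1_A else f i.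
pose pA := fine (Pr (x j @^-1` A)); pose e' i := if i == j then pA else e i.
have mXA : measurable (x j @^-1` A) by rewrite -[X in measurable X]setTI; exact: mx.
have pAE : (\int[Pr]_w (\1_A (x j w))%:E = pA%:E)%E.
  rewrite (eq_integral (EFin \o \1_(x j @^-1` A))) //.
  by rewrite integral_indic // setIT fineK // fin_num_measure.
have := IH f' e'; rewrite (bigD1 j) //= [e' j]/e' eqxx (eq_bigr e); last first.
  by move=> i ij; rewrite /e' (negbTE ij).
rewrite -/c => IH'.
have -> : (\int[Pr]_w (c * \1_A (x j w))%:E = (pA * c)%:E)%E.
  rewrite mulrC EFinM -pAE -ge0_integralZl //.
  by apply/measurable_EFinP; apply: (measurableT_comp _ (mx j)); exact: measurable_indic.
rewrite -IH'.
- apply: eq_integral => w _; congr (_%:E); rewrite [RHS](bigD1 j) //= [f' j]/f' eqxx mulrC.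
  by congr (_ * _); apply: eq_bigr => i ij; rewrite /f' (negbTE ij).
- by move=> i; rewrite /f'; case: ifP => // _; exact: measurable_indic.
- by move=> i y; rewrite /f'; case: ifP.
- by move=> i; rewrite /f' /e'; case: eqP => [->|].
- move=> i ki; rewrite /f'; case: eqP => [_|ij]; first by exists A.
  apply: fk; rewrite ltn_neqAle ki andbT; apply/eqP => kE; apply: ij.
  exact: val_inj.
Qed.

(** Same scheme with signs: in [H k] the factors of index at least [k] are nonnegative, and factor
    [k] is freed by writing it as positive minus negative part. *)
Lemma integral_prod_indep (f : 'I_n -> R -> R) (e : 'I_n -> R) :
  (forall i, measurable_fun setT (f i)) ->
  (forall i, Pr.-integrable setT (fun w => (f i (x i w))%:E)) ->
  (forall i, \int[Pr]_w (f i (x i w))%:E = (e i)%:E)%E ->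
  Pr.-integrable setT (fun w => (\prod_i f i (x i w))%:E) /\
  (\int[Pr]_w (\prod_i f i (x i w))%:E = (\prod_i e i)%:E)%E.
Proof.
suff H k : forall (f : 'I_n -> R -> R) (e : 'I_n -> R), (forall i, measurable_fun setT (f i)) ->
    (forall i, Pr.-integrable setT (fun w => (f i (x i w))%:E)) ->
    (forall i, \int[Pr]_w (f i (x i w))%:E = (e i)%:E)%E ->
    (forall i : 'I_n, (k <= i)%N -> forall y, 0 <= f i y) ->
  Pr.-integrable setT (fun w => (\prod_i f i (x i w))%:E) /\
    (\int[Pr]_w (\prod_i f i (x i w))%:E = (\prod_i e i)%:E)%E.
  by move=> mf f0 fe; apply: (H n) => // i; rewrite leqNgt ltn_ord.
elim: k => [|k IH] {}f {}e mf intf fe fk.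
  have f0 i y : 0 <= f i y by exact: fk.
  have E := ge0_integral_prod mf f0 fe; split=> //.
  apply/integrableP; split.
    by apply/measurable_EFinP; exact: measurable_prod_comp.
  rewrite (eq_integral (fun w => (\prod_i f i (x i w))%:E)); first by rewrite E ltry.
  by move=> w _; rewrite gee0_abs // lee_fin; apply: prodr_ge0.
have [kn|nk] := ltnP k n; last first.
  by apply: IH => // i ki; have := leq_trans nk ki; rewrite leqNgt ltn_ord.
pose j := Ordinal kn.
pose pos y := Num.max (f j y) 0; pose neg y := Num.max (- f j y) 0.
have mpos : measurable_fun setT pos by exact: measurable_maxr.
have mneg : measurable_fun setT neg.
  by apply: measurable_maxr => //; exact: measurableT_comp.
have fpn y : f j y = pos y - neg y.
  by rewrite /pos /neg; case: (leP (f j y) 0) => h; [by rewrite max_l ?oppr_ge0 // sub0r opprK | by rewrite max_r ?subr0 // oppr_le0 ltW].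
have bnd (g : R -> R) : measurable_fun setT g -> (forall y, `|g y| <= `|f j y|) ->
    Pr.-integrable setT (fun w => (g (x j w))%:E).
  move=> mg gf; apply: (le_integrable measurableT _ _ (intf j)) => //.
    by apply/measurable_EFinP; exact: (measurableT_comp mg (mx j)).
  by move=> w _; rewrite lee_fin.
have ipos : Pr.-integrable setT (fun w => (pos (x j w))%:E).
  apply: bnd => // y; rewrite /pos; case: (leP (f j y) 0) => h; rewrite ?normr0 //.
have ineg : Pr.-integrable setT (fun w => (neg (x j w))%:E).
  apply: bnd => // y; rewrite /neg; case: (leP (- f j y) 0) => h; rewrite ?normr0 ?normrN //.
pose ep := fine (\int[Pr]_w (pos (x j w))%:E)%E.
pose en := fine (\int[Pr]_w (neg (x j w))%:E)%E.
have epE : (\int[Pr]_w (pos (x j w))%:E = ep%:E)%E by rewrite fineK // integrable_fin_num.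
have enE : (\int[Pr]_w (neg (x j w))%:E = en%:E)%E by rewrite fineK // integrable_fin_num.
have ejE : e j = ep - en.
  apply: EFin_inj; rewrite -fe EFinB -epE -enE -integralB_EFin //.
  by apply: eq_integral => w _; rewrite fpn.
pose fw (g : R -> R) i := if i == j then g else f i.
pose ew (r : R) i := if i == j then r else e i.
have IHw (g : R -> R) r : measurable_fun setT g -> (forall y, 0 <= g y) ->
   Pr.-integrable setT (fun w => (g (x j w))%:E) ->
   (\int[Pr]_w (g (x j w))%:E = r%:E)%E ->
   Pr.-integrable setT (fun w => (\prod_i fw g i (x i w))%:E) /\
    (\int[Pr]_w (\prod_i fw g i (x i w))%:E = (\prod_i ew r i)%:E)%E.
  move=> mg g0 ig gr; apply: IH => [i|i|i|i ki]; rewrite /fw ?/ew; case: eqP => [E|ij] //; rewrite ?E //.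
  apply: fk; rewrite ltn_neqAle ki andbT; apply/eqP => kE; apply: ij.
  exact: val_inj.
have p0 y : 0 <= pos y by rewrite /pos le_max lexx orbT.
have n0 y : 0 <= neg y by rewrite /neg le_max lexx orbT.
have [ip Ep] := IHw _ _ mpos p0 ipos epE.
have [in_ En] := IHw _ _ mneg n0 ineg enE.
have prodE g w : \prod_i fw g i (x i w) = g (x j w) * \prod_(i | i != j) f i (x i w).
  rewrite (bigD1 j) //= [fw g j]/fw eqxx; congr (_ * _).
  by apply: eq_bigr => i ij; rewrite /fw (negbTE ij).
have prodeE r : \prod_i ew r i = r * \prod_(i | i != j) e i.
  rewrite (bigD1 j) //= [ew r j]/ew eqxx; congr (_ * _).
  by apply: eq_bigr => i ij; rewrite /ew (negbTE ij).
have fE w : (\prod_i f i (x i w))%:E = ((\prod_i fw pos i (x i w))%:E - (\prod_i fw neg i (x i w))%:E)%E.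
  by rewrite -EFinB !prodE -mulrBl -fpn (bigD1 j).
split.
  by apply: (eq_integrable _ _ _ _ (integrableB _ ip in_)) => // w _; rewrite -fE.
under eq_integral => w _ do rewrite fE.
rewrite integralB // Ep En -EFinB !prodeE -mulrBl -ejE; congr (_%:E).
by rewrite [RHS](bigD1 j).
Qed.

End IndependentFamily.

Section GaussianExpectation.
Context {R : realType} d (T : measurableType d) (Pr : probability T R) (n : nat) (v : R).
Variable x : 'I_n -> {RV Pr >-> R}.
Hypothesis v_gt0 : 0 < v.
Hypothesis gx : forall i, real_gaussian v (x i).
Hypothesis indx : forall B : 'I_n -> set R, (forall i, measurable (B i)) ->
  Pr (\bigcap_i (x i @^-1` B i)) = (\prod_i Pr (x i @^-1` B i))%E.

Definition peval (p : mpoly n R[i]) (w : T) : R := complex.Re (meval (fun i => (x i w)%:C) p).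

Lemma pevalE p w : peval p w = \sum_(m <- msupp p) complex.Re (mcoeff m p) * \prod_i x i w ^+ m i.
Proof.
rewrite /peval mevalE Re_sum; apply: eq_bigr => m _.
have -> : \prod_i (x i w)%:C ^+ m i = (\prod_i x i w ^+ m i)%:C.
  by rewrite rmorph_prod; apply: eq_bigr => i _; rewrite rmorphXn.
by rewrite mulrC ReZ mulrC.
Qed.

(** The bridge from the formal functional to the probability space: on monomials, independence and
    the one-variable moments give [gauss_weight]. *)
Lemma expectation_peval p : Pr.-integrable setT (EFin \o peval p) /\
  (\int[Pr]_w (peval p w)%:E = (complex.Re (gaussE v p))%:E)%E.
Proof.
have H (m : multinom n) : Pr.-integrable setT (fun w => (\prod_i x i w ^+ m i)%:E) /\
    (\int[Pr]_w (\prod_i x i w ^+ m i)%:E = (gauss_weight v m)%:E)%E.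
  have mx i : measurable_fun setT (x i) by [].
  apply: (integral_prod_indep mx indx (f := fun i y => y ^+ m i)) => //.
  - by move=> i; exact: (gaussian_moment v_gt0 (gx i) (m i)).1.
  - by move=> i; exact: (gaussian_moment v_gt0 (gx i) (m i)).2.
have I m : Pr.-integrable setT (fun w => (complex.Re (mcoeff m p) * \prod_i x i w ^+ m i)%:E).
  apply: (eq_integrable _ (fun w => ((complex.Re (mcoeff m p))%:E * (\prod_i x i w ^+ m i)%:E)%E)) => //.
  by apply: integrableZl => //; exact: (H m).1.
have E w : (peval p w)%:E = (\sum_(m <- msupp p) (complex.Re (mcoeff m p) * \prod_i x i w ^+ m i)%:E)%E.
  by rewrite pevalE sumEFin.
split.
  apply: (eq_integrable _ (fun w => (\sum_(m <- msupp p) (complex.Re (mcoeff m p) * \prod_i x i w ^+ m i)%:E)%E)) => //.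
    by move=> w _; rewrite /= E.
  by apply: integrable_sum.
under eq_integral => w _ do rewrite E.
rewrite integral_sum // /gaussE Re_sum -sumEFin; apply: eq_bigr => m _.
rewrite mulrC ReZ mulrC EFinM -(H m).2 -integralZl //; exact: (H m).1.
Qed.

End GaussianExpectation.

(** * Hermitian forms, numerical ranges and Hausdorff distance *)

Section Hermitian.
Local Open Scope sesquilinear_scope.
Context {R : realType}.
Local Notation C := R[i].

Definition adj m n (A : 'M[C]_(m, n)) : 'M[C]_(n, m) := A^t*.

Lemma adjE m n (A : 'M[C]_(m, n)) i j : adj A i j = (Num.conj (A j i)).
Proof. by rewrite /adj !mxE. Qed.

Lemma adjM m n p (A : 'M[C]_(m, n)) (B : 'M[C]_(n, p)) : adj (A *m B) = adj B *m adj A.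
Proof. by rewrite /adj trmx_mul map_mxM. Qed.

Lemma adjK m n (A : 'M[C]_(m, n)) : adj (adj A) = A.
Proof. by apply/matrixP => i j; rewrite !adjE conjCK. Qed.

Lemma adjD m n (A B : 'M[C]_(m, n)) : adj (A + B) = adj A + adj B.
Proof. by apply/matrixP => i j; rewrite !mxE rmorphD. Qed.

Lemma adjZ m n a (A : 'M[C]_(m, n)) : adj (a *: A) = (Num.conj a) *: adj A.
Proof. by apply/matrixP => i j; rewrite !mxE rmorphM. Qed.

Lemma adj_pow n (A : 'M[C]_n) k : adj (A ^+ k) = adj A ^+ k.
Proof.
elim: k => [|k IH].
  by rewrite !expr0; apply/matrixP => i j; rewrite !mxE eq_sym; case: eqP; rewrite ?rmorph1 ?rmorph0.
by rewrite exprS exprSr -!mulmxE adjM IH.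
Qed.

Lemma inner_adj n (x y : 'cV[C]_n) : inner x y = (adj y *m x) 0 0.
Proof. by rewrite /inner !mxE; apply: eq_bigr => i _; rewrite adjE mulrC. Qed.

Lemma innerMl n (A : 'M[C]_n) (x y : 'cV[C]_n) : inner (A *m x) y = inner x (adj A *m y).
Proof. by rewrite !inner_adj adjM adjK mulmxA. Qed.

Lemma inner_conj n (x y : 'cV[C]_n) : inner y x = (Num.conj (inner x y)).
Proof.
rewrite /inner rmorph_sum; apply: eq_bigr => i _.
by rewrite rmorphM /= conjCK mulrC.
Qed.

Lemma innerDl n (x x' y : 'cV[C]_n) : inner (x + x') y = inner x y + inner x' y.
Proof. by rewrite !inner_adj mulmxDr !mxE. Qed.

Lemma innerZl n a (x y : 'cV[C]_n) : inner (a *: x) y = a * inner x y.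
Proof. by rewrite !inner_adj -scalemxAr !mxE. Qed.

Lemma innerDr n (x y y' : 'cV[C]_n) : inner x (y + y') = inner x y + inner x y'.
Proof. by rewrite !(inner_conj _ x) innerDl rmorphD /=. Qed.

Lemma innerZr n a (x y : 'cV[C]_n) : inner x (a *: y) = (Num.conj a) * inner x y.
Proof. by rewrite !(inner_conj _ x) innerZl rmorphM /=. Qed.

Definition nsq n (x : 'cV[C]_n) : R := \sum_(i < n) Normc.normc (x i 0) ^+ 2.

Lemma normc_sq (z : C) : (Normc.normc z ^+ 2)%:C = z * (Num.conj z).
Proof. by rewrite rmorphXn /= -sqr_normc. Qed.

Lemma nsq_ge0 n (x : 'cV[C]_n) : 0 <= nsq x.
Proof. by apply: sumr_ge0 => i _; rewrite sqr_ge0. Qed.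

Lemma inner_nsq n (x : 'cV[C]_n) : inner x x = (nsq x)%:C.
Proof. by rewrite /inner /nsq rmorph_sum /=; apply: eq_bigr => i _; rewrite normc_sq. Qed.

Lemma l2norm1 n (x : 'cV[C]_n) : l2norm x = 1 <-> nsq x = 1.
Proof.
rewrite /l2norm -/(nsq x); split=> [h|->]; last by rewrite sqrtr1.
by rewrite -(sqr_sqrtr (nsq_ge0 x)) h expr1n.
Qed.

Lemma nsq0 n (x : 'cV[C]_n) : nsq x = 0 -> x = 0.
Proof.
move=> /eqP; rewrite /nsq psumr_eq0 => [/allP h|i _]; last exact: sqr_ge0.
apply/matrixP => i j; rewrite !mxE ord1; apply: Normc.eq0_normc.
by apply/eqP; rewrite -sqrf_eq0; apply: h; rewrite mem_index_enum.
Qed.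

Lemma nsqZ n a (x : 'cV[C]_n) : nsq (a *: x) = Normc.normc a ^+ 2 * nsq x.
Proof.
rewrite /nsq mulr_sumr; apply: eq_bigr => i _.
by rewrite mxE Normc.normcM exprMn.
Qed.

Lemma sum_cauchy_schwarz n (a b : 'I_n -> R) :
  (\sum_i a i * b i) ^+ 2 <= (\sum_i a i ^+ 2) * (\sum_i b i ^+ 2).
Proof.
have H : 0 <= \sum_i \sum_j (a i * b j - a j * b i) ^+ 2.
  by apply: sumr_ge0 => i _; apply: sumr_ge0 => j _; exact: sqr_ge0.
have E : \sum_i \sum_j (a i * b j - a j * b i) ^+ 2 =
   2 * ((\sum_i a i ^+ 2) * (\sum_i b i ^+ 2)) - 2 * (\sum_i a i * b i) ^+ 2.
  have -> : \sum_i \sum_j (a i * b j - a j * b i) ^+ 2 =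
     \sum_i \sum_j ((a i ^+ 2 * b j ^+ 2 + b i ^+ 2 * a j ^+ 2) - 2 * ((a i * b i) * (a j * b j))).
    by apply: eq_bigr => i _; apply: eq_bigr => j _; ring.
  under eq_bigr => i _ do rewrite big_split big_split /= sumrN -!mulr_sumr.
  rewrite big_split big_split /= sumrN -!mulr_suml -!mulr_sumr -mulr_suml; ring.
by rewrite E in H; lra.
Qed.

Lemma le_Re_normc (z : C) : `|complex.Re z| <= Normc.normc z.
Proof. by case: z => x y /=; rewrite -sqrtr_sqr ler_wsqrtr // lerDl sqr_ge0. Qed.

Lemma normc_sum I (r : seq I) (F : I -> C) :
  Normc.normc (\sum_(i <- r) F i) <= \sum_(i <- r) Normc.normc (F i).
Proof.
elim: r => [|i r IH]; first by rewrite !big_nil Normc.normc0.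
by rewrite !big_cons (le_trans (le_normcD _ _)) // lerD2l.
Qed.

Lemma normc_conj (z : C) : Normc.normc ((Num.conj z)) = Normc.normc z.
Proof. by case: z => x y /=; rewrite sqrrN. Qed.

Lemma cauchy_schwarz n (x y : 'cV[C]_n) : Normc.normc (inner x y) ^+ 2 <= nsq x * nsq y.
Proof.
apply: le_trans (sum_cauchy_schwarz (fun i => Normc.normc (x i 0)) (fun i => Normc.normc (y i 0))).
have n0 (z : C) : 0 <= Normc.normc z by case: z => ? ? /=; exact: sqrtr_ge0.
rewrite lerXn2r ?nnegrE ?n0 //; first by apply: sumr_ge0 => i _; rewrite mulr_ge0 ?n0.
apply: (le_trans (normc_sum _ _)); apply: ler_sum => i _.
by rewrite Normc.normcM normc_conj.
Qed.

Lemma sqr_norm (x : R) : `|x| ^+ 2 = x ^+ 2.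
Proof. by rewrite real_normK // num_real. Qed.

Definition rquad n (H : 'M[C]_n) (y : 'cV[C]_n) : R := complex.Re (inner (H *m y) y).

Lemma rquad_sq_le n (H : 'M[C]_n) y : nsq y = 1 -> rquad H y ^+ 2 <= nsq (H *m y).
Proof.
move=> y1; have := cauchy_schwarz (H *m y) y; rewrite y1 mulr1.
apply: le_trans; rewrite -sqr_norm lerXn2r ?nnegrE //; last exact: le_Re_normc.
exact: le_trans (le_Re_normc _).
Qed.

Lemma nsq_rquad n (H : 'M[C]_n) y : nsq (H *m y) = rquad (adj H *m H) y.
Proof. by rewrite /rquad -mulmxA innerMl adjK inner_nsq. Qed.

Lemma nsq_mulmx_le n (H : 'M[C]_n) y : nsq y = 1 ->
  nsq (H *m y) <= complex.Re (\tr (adj H *m H)).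
Proof.
move=> y1.
have -> : complex.Re (\tr (adj H *m H)) = \sum_i \sum_j Normc.normc (H i j) ^+ 2.
  rewrite mxtrace_mulC /mxtrace Re_sum; apply: eq_bigr => i _.
  by rewrite mxE Re_sum; apply: eq_bigr => j _; rewrite adjE -normc_sq.
apply: ler_sum => i _; rewrite mxE.
pose z : 'cV[C]_n := \col_j (Num.conj (H i j)).
have -> : \sum_j H i j * y j 0 = inner y z.
  by apply: eq_bigr => j _; rewrite mxE conjCK mulrC.
apply: (le_trans (cauchy_schwarz _ _)); rewrite y1 mul1r /nsq.
by apply: ler_sum => j _; rewrite mxE normc_conj.
Qed.

(** By Cauchy-Schwarz the square of the Rayleigh quotient of [H] is at most that of [H ^+ 2].
    Iteration doubles the degree, and the last squared norm is bounded by the Hilbert-Schmidt norm,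
    a trace. *)
Lemma rquad_pow_le n (H : 'M[C]_n) y k : adj H = H -> nsq y = 1 ->
  rquad H y ^+ (2 ^ k.+1) <= complex.Re (\tr (H ^+ (2 ^ k.+1))).
Proof.
move=> HH y1.
have sq l : adj (H ^+ (2 ^ l)) *m H ^+ (2 ^ l) = H ^+ (2 ^ l.+1).
  by rewrite adj_pow HH mulmxE -exprD addnn -mul2n -expnS.
have pow2 (x : R) l : x ^+ (2 ^ l.+1) = (x ^+ (2 ^ l)) ^+ 2 by rewrite -exprM expnS mulnC.
have step l : `|rquad H y| ^+ (2 ^ l) <= `|rquad (H ^+ (2 ^ l)) y|.
  elim: l => [|l IH]; first by rewrite expn0 !expr1.
  rewrite pow2; apply: (@le_trans _ _ (`|rquad (H ^+ (2 ^ l)) y| ^+ 2)).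
    by rewrite lerXn2r ?nnegrE ?exprn_ge0.
  rewrite sqr_norm (le_trans (rquad_sq_le _ y1)) //.
  by rewrite nsq_rquad sq ler_norm.
apply: (@le_trans _ _ (nsq (H ^+ (2 ^ k) *m y))).
  apply: le_trans (rquad_sq_le _ y1).
  rewrite pow2 -sqr_norm -[leRHS]sqr_norm normrX lerXn2r ?nnegrE ?exprn_ge0 //.
by apply: (le_trans (nsq_mulmx_le _ y1)); rewrite sq.
Qed.

Lemma rquadZ n (H : 'M[C]_n) (a : R) y : rquad H (a%:C *: y) = a ^+ 2 * rquad H y.
Proof.
rewrite /rquad -scalemxAr innerZl innerZr conjCE conjc_real mulrA -rmorphM -expr2.
by rewrite ReZ.
Qed.

(* Among the columns of [H ^+ k (H + t)] some vector has a Rayleigh quotient at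
   least their weighted mean, a quotient of traces. *)
Lemma rquad_lower n (H : 'M[C]_n) k (t rho : R) : adj H = H ->
  let tau j := complex.Re (\tr (H ^+ j)) in
  rho * (tau k.*2.+2 + 2 * t * tau k.*2.+1 + t ^+ 2 * tau k.*2)
    < tau k.*2.+3 + 2 * t * tau k.*2.+2 + t ^+ 2 * tau k.*2.+1 ->
  exists2 y, nsq y = 1 & rho < rquad H y.
Proof.
move=> HH tau hlt; pose D := H ^+ k.+1 + t%:C *: H ^+ k.
have DD : adj D = D.
  by rewrite /D adjD adjZ !adj_pow HH conjCE conjc_real.
have HZ j : H *m H ^+ j = H ^+ j.+1 by rewrite exprS mulmxE.
have PP i j : H ^+ i *m H ^+ j = H ^+ (i + j) by rewrite exprD mulmxE.
have D2 : D *m D = H ^+ k.*2.+2 + (2 * t)%:C *: H ^+ k.*2.+1 + (t ^+ 2)%:C *: H ^+ k.*2.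
  rewrite /D mulmxDl !mulmxDr -!scalemxAl -!scalemxAr !PP scalerA.
  have -> : (k.+1 + k.+1 = k.*2.+2)%N by rewrite addnS addSn addnn.
  have -> : (k.+1 + k = k.*2.+1)%N by rewrite addSn addnn.
  have -> : (k + k.+1 = k.*2.+1)%N by rewrite addnS addnn.
  rewrite addnn; move: (H ^+ k.*2.+2) (H ^+ k.*2.+1) (H ^+ k.*2) => X Y Z.
  rewrite -!addrA; congr (X + _); rewrite addrA -scalerDl; congr (_ *: Y + _ *: Z).
    by rewrite rmorphM /= rmorph_nat; ring.
  by rewrite rmorphXn expr2.
have HDD : H *m (D *m D) = H ^+ k.*2.+3 + (2 * t)%:C *: H ^+ k.*2.+2 + (t ^+ 2)%:C *: H ^+ k.*2.+1.
  by rewrite D2 !mulmxDr -!scalemxAr !HZ.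
have HD : H *m D = D *m H.
  by rewrite /D mulmxDr mulmxDl -scalemxAr -scalemxAl !mulmxE -!exprS -!exprSr.
have RtrZ (a : R) (A : 'M[C]_n) : complex.Re (\tr (a%:C *: A)) = a * complex.Re (\tr A).
  by rewrite mxtraceZ ReZ.
have S1 : \sum_j rquad H (col j D) = complex.Re (\tr (H *m (D *m D))).
  rewrite mulmxA HD -mulmxA -[X in \tr (X *m _)]DD /mxtrace Re_sum; apply: eq_bigr => j _.
  rewrite /rquad /inner [in RHS]mxE; congr complex.Re; apply: eq_bigr => i _.
  rewrite adjE mulrC [col j D i 0]mxE; congr (_ * _); rewrite !mxE.
  by apply: eq_bigr => l _; rewrite mxE.
have S2 : \sum_j nsq (col j D) = complex.Re (\tr (D *m D)).
  rewrite -[X in \tr (X *m _)]DD /mxtrace Re_sum; apply: eq_bigr => j _.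
  rewrite mxE Re_sum; apply: eq_bigr => i _.
  by rewrite adjE mulrC -normc_sq mxE.
have : 0 < \sum_j (rquad H (col j D) - rho * nsq (col j D)).
  rewrite big_split /= sumrN -mulr_sumr S1 S2 subr_gt0 HDD D2 !mxtraceD !ReD !RtrZ //.
have [[j hj] _|Hn] := pselect (exists j, 0 < rquad H (col j D) - rho * nsq (col j D)); last first.
  rewrite ltNge => /negP[]; apply: sumr_le0 => j _; rewrite leNgt; apply/negP => hj.
  by apply: Hn; exists j.
set y := col j D in hj; have y0 : 0 < nsq y.
  rewrite lt_neqAle nsq_ge0 andbT eq_sym; apply/eqP => y0; move: hj.
  by rewrite y0 (nsq0 y0) /rquad mulmx0 inner_nsq /nsq big1 ?mulr0 ?subr0 ?ltxx // => i _;
    rewrite mxE Normc.normc0 expr0n.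
exists ((Num.sqrt (nsq y))^-1%:C *: y).
  rewrite nsqZ /= expr0n addr0 sqr_sqrtr ?sqr_ge0 // exprVn sqr_sqrtr ?mulVf ?gt_eqF //.
  exact: ltW.
rewrite rquadZ exprVn sqr_sqrtr ?(ltW y0) // mulrC ltr_pdivlMr //.
by rewrite -subr_gt0.
Qed.
End Hermitian.

(** * Convexity of the numerical range *)

Section ToeplitzHausdorff.
Context {R : realType}.
Local Notation C := R[i].

Lemma realcD (a b : R) : (a + b)%:C = a%:C + b%:C :> C.
Proof. exact: rmorphD. Qed.

Lemma realcM (a b : R) : (a * b)%:C = a%:C * b%:C :> C.
Proof. exact: rmorphM. Qed.

Lemma realcX (a : R) k : (a ^+ k)%:C = a%:C ^+ k :> C.
Proof. exact: rmorphXn. Qed.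

Lemma conjcR (r : R) : Num.conj (r%:C : C) = r%:C.
Proof. by rewrite conjCE conjc_real. Qed.

Lemma exists_phase (w : C) : exists th : C, th * Num.conj th = 1 /\ complex.Im (th * w) = 0.
Proof.
have [->|w0] := eqVneq w 0; first by exists 1; rewrite rmorph1 !mulr1 mulr0.
have n0 : (Normc.normc w)%:C != 0.
  by apply/eqP => /complexI h; move/eqP: w0; apply; apply: Normc.eq0_normc.
exists (Num.conj w / (Normc.normc w)%:C).
have E : w * Num.conj w = (Normc.normc w)%:C ^+ 2 by rewrite -normc_sq rmorphXn.
split; last first.
  rewrite mulrAC [_ * w]mulrC E expr2 mulfK //.
rewrite rmorphM /= conjCK fmorphV /= [X in _ * (_ * X^-1)](_ : _ = (Normc.normc w)%:C); last first.
  by rewrite conjCE conjc_real.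
rewrite mulrACA [Num.conj w * w]mulrC E; field.
exact: n0.
Qed.

(** The core of the Toeplitz-Hausdorff theorem, with the end values normalised to 0 and 1. The phase
    [th] makes the cross terms real, so the form stays real along the segment from [x] to [th *: y]
    and the intermediate value theorem applies. *)
Lemma numerical_segment n (B : 'M[C]_n) (x y : 'cV[C]_n) (s : R) :
  nsq x = 1 -> nsq y = 1 -> inner (B *m x) x = 0 -> inner (B *m y) y = 1 ->
  0 <= s <= 1 -> exists2 z, nsq z = 1 & inner (B *m z) z = s%:C.
Proof.
move=> x1 y1 Bx By /andP[s0 s1].
have [th [th1 hth]] := exists_phase (inner (B *m y) x - Num.conj (inner (B *m x) y)).
pose g := complex.Re (Num.conj th * inner (B *m x) y + th * inner (B *m y) x).
have gE : Num.conj th * inner (B *m x) y + th * inner (B *m y) x = g%:C.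
  rewrite /g; move: hth; case: (inner _ _) => a b; case: (inner _ _) => c e; case: (th) => u t /=.
  move=> h; apply/eqP; rewrite eq_complex /= eqxx /=; apply/eqP; lra.
pose k := complex.Re (Num.conj th * inner x y).
have kE : Num.conj th * inner x y + th * inner y x = (2 * k)%:C.
  rewrite (inner_conj x y) /k.
  case: (inner _ _) => a b; case: (th) => u t.
  by apply/eqP; rewrite eq_complex /=; apply/andP; split; apply/eqP; ring.
pose z (r : R) := (1 - r)%:C *: x + (r%:C * th) *: y.
have BzE r : inner (B *m z r) (z r) = (r ^+ 2 + r * (1 - r) * g)%:C.
  rewrite /z mulmxDr -!scalemxAr !innerDl !innerDr !innerZl !innerZr Bx By.
  rewrite !rmorphM /= !conjcR [RHS]realcD [(_ * g)%:C]realcM -gE [(r * _)%:C]realcM !realcX.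
  rewrite -[X in _ = X + _]mulr1 -[X in _ = _ * X + _]th1; ring.
have nzE r : inner (z r) (z r) = ((1 - r) ^+ 2 + r ^+ 2 + r * (1 - r) * (2 * k))%:C.
  rewrite /z !innerDl !innerDr !innerZl !innerZr !inner_nsq x1 y1.
  rewrite !rmorphM /= !conjcR [RHS]realcD [(_ * (2 * k))%:C]realcM -kE [(r * _)%:C]realcM.
  rewrite [((1 - r) ^+ 2 + _)%:C]realcD !realcX.
  rewrite -[X in _ = _ + X + _]mulr1 -[X in _ = _ + _ * X + _]th1; ring.
have nz r : nsq (z r) = (1 - r) ^+ 2 + r ^+ 2 + r * (1 - r) * (2 * k).
  by apply: complexI; rewrite -inner_nsq nzE.
(* At a zero of [h] the form equals [s] times the squared norm; thus no division by the norm is made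
   before it is known to be positive. *)
pose h r := r ^+ 2 + r * (1 - r) * g - s * ((1 - r) ^+ 2 + r ^+ 2 + r * (1 - r) * (2 * k)).
have ch : continuous h.
  have cX j : continuous (fun r : R => r ^+ j) by exact: exprn_continuous.
  have c1 : continuous (fun r : R => 1 - r).
    by move=> r; apply: cvgB; [exact: cvg_cst|exact: cvg_id].
  have cM (f f' : R -> R) : continuous f -> continuous f' -> continuous (fun r => f r * f' r).
    by move=> cf cf' r; apply: cvgM; [exact: cf|exact: cf'].
  have cD (f f' : R -> R) : continuous f -> continuous f' -> continuous (fun r => f r + f' r).
    by move=> cf cf' r; apply: cvgD; [exact: cf|exact: cf'].
  have cc (c : R) : continuous (fun _ : R => c) by move=> r; exact: cvg_cst.
  have ci : continuous (fun r : R => r) by move=> r; exact: cvg_id.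
  have q1 : continuous (fun r : R => r * (1 - r)) by exact: (cM).
  have q2 : continuous (fun r : R => (1 - r) ^+ 2 + r ^+ 2 + r * (1 - r) * (2 * k)).
    by apply: (cD); [apply: (cD); [exact: (cM)|exact: cX]|exact: (cM)].
  move=> r; apply: cvgB; last exact: (cM _ _ (cc s) q2) r.
  exact: (cD _ _ (cX 2%N) (cM _ _ q1 (cc g))) r.
have h0 : h 0 = - s by rewrite /h; ring.
have h1 : h 1 = 1 - s by rewrite /h; ring.
have [r _ hr] : exists2 r, r \in `[0, 1] & h r = 0.
  apply: IVT => //; first by exact: continuous_subspaceT.
  by rewrite h0 h1 ge_min le_max; apply/andP; split; apply/orP; [left|right]; lra.
(* If [z r] were 0, the form evaluated on both sides of [(1 - r) x = - r th y] would give
   [r ^+ 2 = 0], and then [z r = x] has norm 1. *)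
have z0 : 0 < nsq (z r).
  rewrite lt_neqAle nsq_ge0 andbT eq_sym; apply/eqP => zr0.
  have Z := nsq0 zr0; have : inner (B *m z r) (z r) = 0.
    by rewrite Z mulmx0 inner_nsq /nsq big1 // => i _; rewrite mxE Normc.normc0 expr0n.
  have E : (1 - r)%:C *: x = - ((r%:C * th) *: y).
    by apply/eqP; rewrite -addr_eq0; apply/eqP.
  have E2 : inner (B *m ((1 - r)%:C *: x)) ((1 - r)%:C *: x) = (r ^+ 2)%:C.
    rewrite E -scaleNr -scalemxAr innerZl innerZr By !rmorphN /= !rmorphM /= conjcR.
    by rewrite -[RHS]mulr1 -[X in _ = _ * X]th1; ring.
  move: E2; rewrite -scalemxAr innerZl innerZr Bx !mulr0 => /esym/complexI/eqP.
  rewrite sqrf_eq0 => /eqP r0 _; move: zr0; rewrite nz r0; lra.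
exists ((Num.sqrt (nsq (z r)))^-1%:C *: z r).
  rewrite nsqZ /= expr0n addr0 sqr_sqrtr ?sqr_ge0 // exprVn sqr_sqrtr ?mulVf ?gt_eqF //.
  exact: ltW.
have numE : r ^+ 2 + r * (1 - r) * g = s * nsq (z r) by move: hr; rewrite nz /h; lra.
rewrite -scalemxAr innerZl innerZr conjcR BzE numE mulrA -!realcM -expr2 exprVn sqr_sqrtr; last exact: ltW.
by rewrite mulrCA mulVf ?mulr1 // gt_eqF.
Qed.

Lemma numerical_range_convex n (A : 'M[C]_n) (w1 w2 : C) (t : R) : 0 <= t <= 1 ->
  numerical_range A w1 -> numerical_range A w2 ->
  numerical_range A (w1 + t%:C * (w2 - w1)).
Proof.
move=> t01 [x /l2norm1 x1 <-] [y /l2norm1 y1 <-].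
set a := inner (A *m x) x; set b := inner (A *m y) y.
have [ba|ba] := eqVneq (b - a) 0.
  by exists x; [exact/l2norm1 | rewrite ba mulr0 addr0].
pose B := (b - a)^-1 *: (A - a%:M).
have BE u : nsq u = 1 -> inner (B *m u) u = (b - a)^-1 * (inner (A *m u) u - a).
  move=> u1; rewrite /B -scalemxAl innerZl mulmxBl mul_scalar_mx; congr (_ * _).
  by rewrite -scaleNr innerDl innerZl inner_nsq u1 mulr1.
have Bx : inner (B *m x) x = 0 by rewrite BE // subrr mulr0.
have By : inner (B *m y) y = 1 by rewrite BE // mulVf.
have [z z1 Bz] := numerical_segment x1 y1 Bx By t01.
exists z; first exact/l2norm1.
by move: Bz; rewrite BE // => <-; rewrite mulrC mulVKf // addrC subrK.
Qed.
End ToeplitzHausdorff.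

(** * Support functions and Hausdorff distance in the plane *)

Section PlaneGeometry.
Context {R : realType}.
Local Notation C := R[i].
Implicit Types (x y z w u : C) (X Y : set C).

Definition dot z u : R := complex.Re z * complex.Re u + complex.Im z * complex.Im u.

Definition cconvex X : Prop :=
  forall x y (t : R), 0 <= t <= 1 -> X x -> X y -> X (x + t%:C * (y - x)).

Definition bounded_by (r : R) X : Prop :=
  forall x, X x -> `|complex.Re x| <= r /\ `|complex.Im x| <= r.

Lemma cdist_ge0 x y : 0 <= cdist x y.
Proof. by rewrite /cdist; case: (x - y) => ? ? /=; exact: sqrtr_ge0. Qed.

Lemma cdist_sq x y : cdist x y ^+ 2 = (complex.Re x - complex.Re y) ^+ 2 + (complex.Im x - complex.Im y) ^+ 2.
Proof.
rewrite /cdist; case: x => a b; case: y => c d /=.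
by rewrite sqr_sqrtr // addr_ge0 ?sqr_ge0.
Qed.

(** [X] is not assumed closed, so a nearest point is replaced by a point [x] whose squared distance
    to [y] is within [t ^+ 2] of the infimum; [u] points from [x] to [y]. The loss is what reduces
    [eps] to [eps / 2]. *)
Lemma separation X y (r eps : R) : cconvex X -> X !=set0 -> bounded_by r X -> 0 < eps ->
  (forall x, X x -> eps <= cdist y x) ->
  exists2 u, complex.Re u ^+ 2 + complex.Im u ^+ 2 = 1 &
    forall x, X x -> dot x u <= dot y u - eps / 2.
Proof.
move=> cX [x0 Xx0] bX e0 hX.
pose S := [set cdist y x ^+ 2 | x in X].
have infS : has_inf S.
  split; first by exists (cdist y x0 ^+ 2), x0.
  by exists 0 => _ [x Xx <-]; exact: sqr_ge0.
have r0 : 0 <= r by have [h _] := bX _ Xx0; exact: le_trans h.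
pose L := 8 * r ^+ 2.
have L0 : 0 <= L by rewrite /L mulr_ge0 // sqr_ge0.
(* [L] bounds the squared diameter of [X]. A move of relative length [t] towards any point of [X]
   changes the squared distance to second order by at most [t ^+ 2 * L], which this [t] makes
   harmless. *)
pose t := Num.min 1 (eps ^+ 2 / (2 * (1 + L))).
have t0 : 0 < t.
  by rewrite lt_min ltr01 divr_gt0 ?exprn_gt0 // mulr_gt0 //; lra.
have t1 : t <= 1 by rewrite ge_min lexx.
have te : t * (1 + L) <= eps ^+ 2 / 2.
  have : t <= eps ^+ 2 / (2 * (1 + L)) by rewrite ge_min lexx orbT.
  by rewrite ler_pdivlMr ?mulr_gt0 //; lra.
have t2 : 0 < t ^+ 2 by rewrite exprn_gt0.
have [_ [x Xx <-] hx] := inf_adherent t2 infS.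
have Dle w : X w -> inf S <= cdist y w ^+ 2.
  by move=> Xw; apply: ge_inf; [case: infS | exists w].
set v1 := complex.Re y - complex.Re x; set v2 := complex.Im y - complex.Im x.
have vE : cdist y x ^+ 2 = v1 ^+ 2 + v2 ^+ 2 by rewrite cdist_sq.
pose nv := cdist y x.
have nv_ge : eps <= nv by exact: hX.
have nv0 : 0 < nv by lra.
have nvE : nv ^+ 2 = v1 ^+ 2 + v2 ^+ 2 by [].
have key w : X w -> v1 * (complex.Re w - complex.Re x) + v2 * (complex.Im w - complex.Im x) <= eps ^+ 2 / 2.
  move=> Xw; set d1 := complex.Re w - _; set d2 := complex.Im w - _.
  have Xz : X (x + t%:C * (w - x)) by apply: cX => //; rewrite t1 ltW.
  have := Dle _ Xz; rewrite cdist_sq.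
  have -> : complex.Re y - complex.Re (x + t%:C * (w - x)) = v1 - t * d1.
    by rewrite /v1 /d1; case: (x) => a b; case: (w) => c d /=; ring.
  have -> : complex.Im y - complex.Im (x + t%:C * (w - x)) = v2 - t * d2.
    by rewrite /v2 /d2; case: (x) => a b; case: (w) => c d /=; ring.
  have [/ler_normlP[a1 a2] /ler_normlP[a3 a4]] := bX _ Xx.
  have [/ler_normlP[b1 b2] /ler_normlP[b3 b4]] := bX _ Xw.
  have d1L : d1 ^+ 2 <= 4 * r ^+ 2 by rewrite /d1; nra.
  have d2L : d2 ^+ 2 <= 4 * r ^+ 2 by rewrite /d2; nra.
  move=> h.
  have h2 : t * (2 * (v1 * d1 + v2 * d2)) <= t * (t * (1 + L)).
    have E : (v1 - t * d1) ^+ 2 + (v2 - t * d2) ^+ 2 =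
      cdist y x ^+ 2 - t * (2 * (v1 * d1 + v2 * d2)) + t ^+ 2 * (d1 ^+ 2 + d2 ^+ 2).
      by rewrite vE; ring.
    have h3 : t ^+ 2 * (d1 ^+ 2 + d2 ^+ 2) <= t ^+ 2 * L.
      by rewrite ler_wpM2l ?(ltW t2) // /L; lra.
    have E2 : t * (t * (1 + L)) = t ^+ 2 + t ^+ 2 * L by ring.
    rewrite E in h; rewrite E2; lra.
  rewrite (ler_pM2l t0) in h2; have := exprn_gt0 2 e0; lra.
exists ((v1 / nv) +i* (v2 / nv)) => /=.
  by rewrite !expr_div_n -mulrDl -nvE divff // gt_eqF // exprn_gt0.
move=> w Xw; have := key _ Xw; rewrite /dot /=.
move=> h; rewrite -subr_ge0.
have -> : complex.Re y * (v1 / nv) + complex.Im y * (v2 / nv) - eps / 2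
    - (complex.Re w * (v1 / nv) + complex.Im w * (v2 / nv)) =
   ((v1 ^+ 2 + v2 ^+ 2) - nv * (eps / 2)
    - (v1 * (complex.Re w - complex.Re x) + v2 * (complex.Im w - complex.Im x))) / nv.
  by rewrite /v1 /v2; field; rewrite gt_eqF.
rewrite divr_ge0 //; last exact: ltW.
rewrite -nvE; nra.
Qed.

Definition grid (n : nat) (p q : int) : Prop := `|p| <= n%:Z /\ `|q| <= n%:Z.
Definition idir (p q : int) : C := p%:~R +i* q%:~R.

Lemma approx_direction u n : complex.Re u ^+ 2 + complex.Im u ^+ 2 = 1 -> (0 < n)%N ->
  exists p q, grid n p q /\
   forall (r : R) z, `|complex.Re z| <= r -> `|complex.Im z| <= r ->
     `|dot z (idir p q) - n%:R * dot z u| <= 2 * r.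
Proof.
case: u => u1 u2 /= u12 n0.
have nR : 1 <= n%:R :> R by rewrite ler1n.
have H (s : R) : -1 <= s <= 1 -> exists p : int, `|p| <= n%:Z /\ `|p%:~R - n%:R * s| <= 1.
  move=> /andP[s1 s2]; exists (Num.floor (n%:R * s)).
  have := floor_le_tmp (n%:R * s); have := floorD1_gt (n%:R * s).
  rewrite intrD; set f := Num.floor _ => h1 h2.
  split; last by apply/ler_normlP; split; lra.
  have n1 : f%:~R <= n%:R :> R by nra.
  have n2 : - (n%:R) < (f + 1)%:~R :> R by rewrite intrD; nra.
  rewrite ler_norml -(@ler_int R) -[X in _ && X](@ler_int R) mulrNz n1 andbT.
  move: n2; rewrite -[n%:R]/(n%:Z%:~R) -mulrNz ltr_int ltzD1 -(@ler_int R) mulrNz //.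
have b1 : -1 <= u1 <= 1 by apply/andP; split; nra.
have b2 : -1 <= u2 <= 1 by apply/andP; split; nra.
have [p [gp hp]] := H _ b1; have [q [gq hq]] := H _ b2.
exists p, q; split=> // r z z1 z2; rewrite /dot /=.
have -> : complex.Re z * p%:~R + complex.Im z * q%:~R - n%:R * (complex.Re z * u1 + complex.Im z * u2) =
   complex.Re z * (p%:~R - n%:R * u1) + complex.Im z * (q%:~R - n%:R * u2) by ring.
apply: (le_trans (ler_normD _ _)); rewrite !normrM.
have r0 : 0 <= r by exact: le_trans z1.
have : `|complex.Re z| * `|p%:~R - n%:R * u1| <= r * 1 by exact: ler_pM.
have : `|complex.Im z| * `|q%:~R - n%:R * u2| <= r * 1 by exact: ler_pM.
lra.
Qed.

(* Directions are integer vectors of length about [n], so that an error [1] in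
   the support functions is an error [1 / n] for unit directions. *)
Lemma near_of_support X Y (r eps : R) (n : nat) : cconvex Y -> Y !=set0 ->
  bounded_by r X -> bounded_by r Y -> 0 < eps -> 4 * r + 1 < n%:R * (eps / 2) ->
  (forall p q, grid n p q -> forall x, X x -> exists2 y, Y y &
     dot x (idir p q) <= dot y (idir p q) + 1) ->
  forall x, X x -> exists2 y, Y y & cdist x y < eps.
Proof.
move=> cY Y0 bX bY e0 nbig H x Xx.
have [//|Hn] := pselect (exists2 y, Y y & cdist x y < eps).
have far y : Y y -> eps <= cdist x y.
  by move=> Yy; rewrite leNgt; apply/negP => h; apply: Hn; exists y.
have [u u1 hu] := separation cY Y0 bY e0 far.
have r0 : 0 <= r by have [h _] := bX _ Xx; exact: le_trans h.
have n0 : (0 < n)%N by case: n nbig {H} => // ; rewrite mul0r; lra.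
have [p [q [gpq happ]]] := approx_direction u1 n0.
have [y Yy hy] := H _ _ gpq _ Xx.
have [x1 x2] := bX _ Xx; have [y1 y2] := bY _ Yy.
(* Replacing [n u] by the integer direction costs [2 r] at [x] and at [y], and the comparison of
   supports costs 1. The total [4 r + 1] contradicts the separation [n * (eps / 2)]. *)
have /ler_normlP[a1 a2] := happ _ _ x1 x2.
have /ler_normlP[b1 b2] := happ _ _ y1 y2.
have h := hu _ Yy.
have hn : n%:R * dot y u <= n%:R * (dot x u - eps / 2) by rewrite ler_wpM2l.
lra.
Qed.

Lemma hausdorff_le X Y (eps : R) : X !=set0 -> Y !=set0 ->
  (forall x, X x -> exists2 y, Y y & cdist x y < eps) ->
  (forall y, Y y -> exists2 x, X x & cdist y x < eps) ->
  (0 <= hausdorff_dist X Y <= eps%:E)%E.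
Proof.
move=> [x0 Xx0] [y0 Yy0] h1 h2.
have d0 z Z : (0 <= dist_set z Z)%E.
  by apply: le_ereal_inf_tmp => _ [w _ <-]; rewrite lee_fin cdist_ge0.
have dle z Z w : Z w -> cdist z w < eps -> (dist_set z Z <= eps%:E)%E.
  move=> Zw h; apply: (@le_trans _ _ (cdist z w)%:E); last by rewrite lee_fin ltW.
  by apply: ereal_inf_lbound; exists w.
apply/andP; split; rewrite /hausdorff_dist.
  rewrite le_max; apply/orP; left; apply: (le_trans (d0 x0 Y)).
  by apply: ereal_sup_ubound; exists x0.
rewrite ge_max; apply/andP; split; apply: ge_ereal_sup => _ [z Zz <-].
  by have [w Zw h] := h1 _ Zz; exact: dle h.
by have [w Zw h] := h2 _ Zz; exact: dle h.
Qed.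

Lemma hausdorff_cvg (W : nat -> set C) (E : set C) (h : int -> int -> R) :
  (forall N, cconvex (W N)) -> cconvex E -> E !=set0 ->
  (forall p q x, E x -> dot x (idir p q) <= h p q) ->
  (forall p q, exists2 x, E x & h p q <= dot x (idir p q)) ->
  (forall p q, \forall N \near \oo, forall w, W N w -> dot w (idir p q) <= h p q + 1) ->
  (forall p q, \forall N \near \oo, exists2 w, W N w & h p q - 1 <= dot w (idir p q)) ->
  hausdorff_dist (W N) E @[N --> \oo] --> 0%E.
Proof.
move=> cW cE E0 hE1 hE2 hW1 hW2.
(* The four axis directions confine [E], and eventually [W N], to one square; the summand 1 is the
   tolerance of the support functions. *)
pose r := `|h 1 0| + `|h (-1) 0| + `|h 0 1| + `|h 0 (-1)| + 1.
have bnd X : (forall x, X x -> dot x (idir 1 0) <= h 1 0 + 1) ->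
  (forall x, X x -> dot x (idir (-1) 0) <= h (-1) 0 + 1) ->
  (forall x, X x -> dot x (idir 0 1) <= h 0 1 + 1) ->
  (forall x, X x -> dot x (idir 0 (-1)) <= h 0 (-1) + 1) -> bounded_by r X.
  move=> k1 k2 k3 k4 x Xx.
  move: (k1 _ Xx) (k2 _ Xx) (k3 _ Xx) (k4 _ Xx); rewrite /dot /= !mulrNz !mulr0z.
  have := ler_norm (h 1 0); have := ler_norm (h (-1) 0).
  have := ler_norm (h 0 1); have := ler_norm (h 0 (-1)).
  have := normr_ge0 (h 1 0); have := normr_ge0 (h (-1) 0).
  have := normr_ge0 (h 0 1); have := normr_ge0 (h 0 (-1)).
  by rewrite /r => *; split; apply/ler_normlP; split; lra.
have bE : bounded_by r E.
  by apply: bnd => x Ex; apply: (le_trans (hE1 _ _ _ Ex)); rewrite lerDl.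
suff main (eps : R) : 0 < eps -> \forall N \near \oo, (0 <= hausdorff_dist (W N) E <= eps%:E)%E.
  have fin N eps : (0 <= hausdorff_dist (W N) E <= eps%:E)%E -> hausdorff_dist (W N) E \is a fin_num.
    by move=> /andP[k1 k2]; rewrite ge0_fin_numE // (le_lt_trans k2) // ltry.
  apply/fine_cvgP; split.
    by apply: filterS (main 1 ltr01) => N; exact: fin.
  apply/cvgr0Pnorm_le => eps e0; apply: filterS (main eps e0) => N hN.
  have fN := fin _ _ hN; have /andP[k1 k2] := hN.
  rewrite /= ger0_norm; first by rewrite -lee_fin fineK.
  by rewrite -lee_fin fineK.
move=> e0; pose n := (Num.truncn ((4 * r + 1) / (eps / 2))).+1.
have nbig : 4 * r + 1 < n%:R * (eps / 2).
  by rewrite -ltr_pdivrMr ?divr_gt0 // /n truncnS_gt.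
(* For a fixed [eps] only the finitely many directions of the grid occur, so their eventual
   statements hold together from some size on. *)
have gridP (P : int -> int -> nat -> Prop) : (forall p q, \forall N \near \oo, P p q N) ->
    \forall N \near \oo, forall p q, grid n p q -> P p q N.
  move=> HP.
  have : \forall N \near \oo, forall i j : 'I_(n + n).+1,
      P ((i : nat)%:Z - n%:Z) ((j : nat)%:Z - n%:Z) N.
    by apply: filter_forall => i; apply: filter_forall => j; exact: HP.
  apply: filterS => N HN p q [gp gq].
  have ord (p' : int) : `|p'| <= n%:Z -> exists i : 'I_(n + n).+1, p' = (i : nat)%:Z - n%:Z.
    move=> g; have hi : (absz (p' + n%:Z)%R < (n + n).+1)%N by lia.
    by exists (Ordinal hi) => /=; lia.
  have [i ->] := ord _ gp; have [j ->] := ord _ gq; exact: HN.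
near=> N.
have k1 : forall p q, grid n p q -> forall w, W N w -> dot w (idir p q) <= h p q + 1.
  by near: N; apply: gridP => p q; exact: hW1.
have k2 : forall p q, grid n p q -> exists2 w, W N w & h p q - 1 <= dot w (idir p q).
  by near: N; apply: gridP => p q; exact: hW2.
have g1 p q : (p == 1) || (p == 0) || (p == -1) -> (q == 1) || (q == 0) || (q == -1) -> grid n p q.
  by rewrite /grid /n => hp hq; split; lia.
have W0 : W N !=set0 by have [w Ww _] := k2 0 0 (g1 0 0 isT isT); exists w.
have bW : bounded_by r (W N) by apply: bnd; apply: k1; apply: g1.
apply: hausdorff_le => //.
- apply: (near_of_support cE E0 bW bE e0 nbig) => p q g x Wx.
  by have [e Ee he] := hE2 p q; exists e => //; have := k1 p q g x Wx; lra.
- apply: (near_of_support (cW N) W0 bE bW e0 nbig) => p q g x Ex.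
  by have [w Ww hw] := k2 p q g; exists w => //; have := hE1 p q x Ex; lra.
Unshelve. all: by end_near. Qed.

End PlaneGeometry.

(** * Almost sure convergence of the spectral edges *)

Section AlmostSure.
Context {R : realType} d (T : measurableType d) (Pr : probability T R).

Lemma sum_invsq_le n : \sum_(0 <= i < n) (i.+1%:R ^- 2 : R) <= 2.
Proof.
case: n => [|n]; first by rewrite big_geq.
suff: \sum_(0 <= i < n.+1) (i.+1%:R ^- 2 : R) <= 2 - n.+1%:R^-1.
  by move=> /le_trans; apply; rewrite gerBl invr_ge0.
elim: n => [|n IH]; first by rewrite big_nat1 invr1; lra.
rewrite big_nat_recr //=; apply: (le_trans (lerD IH (lexx _))).
have n1 : 0 < n.+1%:R :> R by rewrite ltr0n.
have e2 : n.+2%:R = n.+1%:R + 1 :> R by rewrite -natr1.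
rewrite -subr_ge0 e2; set x := n.+1%:R in n1 *.
have -> : 2 - (x + 1)^-1 - (2 - x^-1 + (x + 1) ^- 2) = (x * (x + 1) ^+ 2)^-1.
  by field; rewrite !gt_eqF //; lra.
by rewrite invr_ge0 mulr_ge0 ?exprn_ge0 ?ltW //; lra.
Qed.

(** Summable expectations make the series of the [Z n] integrable, hence finite almost everywhere,
    and the terms of a convergent series tend to 0. *)
Lemma ae_cvg0 (Z : nat -> T -> R) (K : R) :
  (forall n, (0 < n)%N -> measurable_fun setT (Z n)) -> (forall n w, 0 <= Z n w) ->
  (\forall n \near \oo, (\int[Pr]_w (Z n w)%:E <= (K / n%:R ^+ 2)%:E)%E) ->
  {ae Pr, forall w, Z n w @[n --> \oo] --> 0}.
Proof.
move=> mZ Z0 [N _ hN].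
pose Y n w := (Z (n + N.+1)%N w)%:E.
have mY n : measurable_fun setT (Y n) by apply/measurable_EFinP; apply: mZ; rewrite addnS.
have Y0 n w : (0 <= Y n w)%E by rewrite lee_fin.
have K0 : 0 <= K.
  have /= := hN N.+1 (leqnSn _); have : (0 <= \int[Pr]_w (Z N.+1 w)%:E)%E.
    by apply: integral_ge0 => w _; rewrite lee_fin.
  move=> h /(le_trans h); rewrite lee_fin pmulr_lge0 // invr_gt0 exprn_gt0 //.
have IY n : (\int[Pr]_w Y n w <= (K * n.+1%:R ^- 2)%:E)%E.
  have le1 : (n.+1 <= n + N.+1)%N by rewrite addnS ltnS leq_addr.
  have leN : (N <= n + N.+1)%N by rewrite addnS (leq_trans (leq_addl n N)).
  apply: (le_trans (hN _ leN)).
  rewrite lee_fin ler_wpM2l // lef_pV2 ?posrE ?exprn_gt0 ?ltr0n ?addnS //.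
  by rewrite lerXn2r ?nnegrE // ler_nat -addnS.
have fin : (\int[Pr]_w \big[+%E/0%E]_(0 <= n <oo) Y n w < +oo)%E.
  rewrite integral_nneseries //.
  apply: (@le_lt_trans _ _ (K * 2)%:E); last exact: ltry.
  apply: lime_le.
    by apply: is_cvg_nneseries => n _ _; apply: integral_ge0 => w _.
  near=> n; apply: (@le_trans _ _ (\sum_(0 <= i < n) (K * i.+1%:R ^- 2)%:E)%E).
    exact: lee_sum.
  by rewrite sumEFin lee_fin -mulr_sumr ler_wpM2l // sum_invsq_le.
have S0 w : (0 <= \big[+%E/0%E]_(0 <= n <oo) Y n w)%E by apply: nneseries_ge0.
have int : Pr.-integrable setT (fun w => \big[+%E/0%E]_(0 <= n <oo) Y n w).
  apply/integrableP; split; first by apply: ge0_emeasurable_sum.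
  by rewrite (eq_integral (fun w => \big[+%E/0%E]_(0 <= n <oo) Y n w)) // => w _; rewrite gee0_abs.
apply: filterS (integrable_ae measurableT int) => w /(_ I) h.
have : cvgn (series (fun n => Z (n + N.+1)%N w)).
  apply: nondecreasing_is_cvgn.
    by move=> i j ij; apply: (@nondecreasing_series R (fun k => Z (k + N.+1)%N w) xpredT 0%N _ i j ij) => k _ _; exact: Z0.
  exists (fine (\big[+%E/0%E]_(0 <= n <oo) Y n w)%E) => _ [n _ <-].
  rewrite -lee_fin fineK // /series /= -sumEFin; apply: (@nneseries_lim_ge R (fun k => Y k w) xpredT 0%N n) => k _ _; exact: Y0.
move=> cS; have := cvg_series_cvg_0 cS.
by rewrite (cvg_shiftn N.+1 (Z ^~ w)).
Unshelve. all: by end_near. Qed.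

(** What the limit theorems use of a random matrix: [tau N a] is the trace of its power [a] divided
    by [N], and the mixed moments of these solve the loop equations. *)
Definition trace_process e (beta : nat -> R) (tau : nat -> nat -> T -> R) : Prop :=
  forall N, (0 < N)%N -> exists2 M, trace_rec e (beta N) (N%:R ^- 2) M &
    forall s, Pr.-integrable setT (fun w => (\prod_(a <- s) tau N a w)%:E) /\
      (\int[Pr]_w (\prod_(a <- s) tau N a w)%:E = (M s)%:E)%E.

Variables (e : nat) (beta : nat -> R) (tau : nat -> nat -> T -> R).
Hypothesis tauP : trace_process e beta tau.
Hypothesis beta_ge0 : forall N, 0 <= beta N.

Lemma trace_process_integrable N a : (0 < N)%N ->
  Pr.-integrable setT (fun w => (tau N a w)%:E).
Proof.
move=> /tauP[M _ /(_ [:: a])[h _]]; apply: (eq_integrable _ _ _ _ h) => // w _.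
by rewrite big_seq1.
Qed.

Lemma trace_process_measurable N a : (0 < N)%N -> measurable_fun setT (tau N a).
Proof. by move=> /(trace_process_integrable a)/measurable_int/measurable_EFinP. Qed.

(** The centring [m N] uses the ratio [beta N] and not its limit, since [beta] may converge
    arbitrarily slowly. The upper bound on [M [:: a; a]] and the lower bound on [M [:: a]] leave a
    second moment of at most [K / N ^ 2]. *)
Lemma trace_process_lln (alpha : R) a : beta N @[N --> \oo] --> alpha ->
  {ae Pr, forall w, tau N a w @[N --> \oo] --> mom e alpha a}.
Proof.
move=> cb; pose m N := mom e (beta N) a.
have cm : m N @[N --> \oo] --> mom e alpha a.
  by apply: (cvg_mom (fun n => mom_recP e (beta n)) (mom_recP e alpha) cb).
have [K K0 HK] := trace_rec_le_prod e (weight [:: a; a]) (normr_ge0 (alpha + 1) : 0 <= `|alpha + 1|).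
pose Z N w := (tau N a w - m N) ^+ 2.
suff : {ae Pr, forall w, Z N w @[N --> \oo] --> 0}.
  apply: filterS => w cZ.
  have : `|tau N a w - m N| @[N --> \oo] --> 0.
    have -> : (fun N => `|tau N a w - m N|) = (fun N => Num.sqrt (Z N w)).
      by apply/funext => N; rewrite sqrtr_sqr.
    rewrite -[X in _ --> X]sqrtr0.
    by apply: (continuous_cvg _ (@sqrt_continuous R 0) cZ).
  move=> /norm_cvg0P h; rewrite -[mom _ _ _]add0r.
  have -> : (fun N => tau N a w) = (fun N => (tau N a w - m N) + m N).
    by apply/funext => N; rewrite subrK.
  exact: cvgD h cm.
apply: (@ae_cvg0 _ K) => [N N0|N w|]; last first.
- have bb : \forall N \near \oo, beta N <= `|alpha + 1|.
    have : \forall N \near \oo, beta N < alpha + 1.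
      by apply: (cvgr_lt alpha) => //; rewrite ltrDl.
    by apply: filterS => N /ltW h; apply: (le_trans h); exact: ler_norm.
  near=> N.
  have N0 : (0 < N)%N by near: N; exists 1%N.
  have bN : 0 <= beta N <= `|alpha + 1| by rewrite beta_ge0 /=; near: N.
  have [M MR HM] := tauP N0.
  have q1 : 0 <= (N%:R ^- 2 : R) <= 1.
    by rewrite invr_ge0 exprn_ge0 //= invf_le1 ?exprn_gt0 ?ltr0n // exprn_ege1 // ler1n.
  have mR := mom_recP e (beta N).
  have := HK _ _ _ _ bN q1 MR mR [:: a; a] (leqnn _).
  have /andP[b0 _] := bN; have /andP[q0 _] := q1.
  have := trace_rec_ge_prod b0 q0 MR mR [:: a]; rewrite !big_cons !big_nil !mulr1 => h1 h2.
  have m0 := mom_rec_ge0 b0 mR a.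
  have [I1 E1] := HM [:: a]; have [I2 E2] := HM [:: a; a].
  have E : (\int[Pr]_w (Z N w)%:E = (M [:: a; a] - 2 * m N * M [:: a] + m N ^+ 2)%:E)%E.
    rewrite EFinD EFinB EFinM -E1 -E2 -integralZl //.
    rewrite -integralB //; last exact: integrableZl.
    have -> : (m N ^+ 2)%:E = (\int[Pr]_w (m N ^+ 2)%:E)%E.
      by rewrite integral_cst //= [X in (_ * X)%E]probability_setT mule1.
    rewrite -integralD //.
    - apply: eq_integral => w _; rewrite /Z !big_cons !big_nil !mulr1 -EFinM -EFinB -EFinD.
      by congr (_%:E); ring.
    - by apply: integrableB => //; exact: integrableZl.
    - exact: finite_measure_integrable_cst.
  rewrite E lee_fin -/(m N) in h2 *.
  have : m N * (M [:: a] - m N) >= 0 by rewrite mulr_ge0 // subr_ge0.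
  rewrite -/(m N) in h1 h2 *; rewrite expr2; lra.
- exact: sqr_ge0.
- by apply: measurable_funX; apply: measurable_funB => //; exact: trace_process_measurable.
Unshelve. all: by end_near. Qed.

End AlmostSure.

Lemma pow_geometric_bounded {R : realType} (th : R) p : 0 < th < 1 ->
  exists2 K, 0 <= K & forall n, n%:R ^+ p.+1 * th ^+ n <= K.
Proof.
move=> /andP[t0 t1]; pose L := - ln th.
have L0 : 0 < L by rewrite oppr_gt0 ln_lt0 // t0.
exists ((p.+1%:R / L) ^+ p.+1) => [|n]; first by rewrite exprn_ge0 // divr_ge0 // ltW.
have E : th ^+ n = (expR (L * n%:R))^-1.
  by rewrite expRM_natr /L expRN lnK ?posrE // exprVn invrK.
rewrite E ler_pdivrMr ?expR_gt0 //.
have := @expR_ge_pow R (L * n%:R) p (mulr_ge0 (ltW L0) (ler0n _ _)).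
move=> h; apply: le_trans (ler_wpM2l _ h); last by rewrite exprn_ge0 // divr_ge0 // ltW.
rewrite -exprMn le_eqVlt; apply/orP; left; apply/eqP; congr (_ ^+ _).
move: (p.+1%:R : R) (pnatr_eq0 R p.+1) => c /= c0.
by field; rewrite ?c0 ?(gt_eqF L0).
Qed.

(** A power of two, as [rquad_pow_le] demands, between half the square root of [N] and that square
    root. *)
Definition half_pow (N : nat) : nat := (2 ^ (trunc_log 2 N)./2)%N.

Lemma half_pow_sq_le N : (0 < N)%N -> (half_pow N ^ 2 <= N)%N.
Proof.
move=> N0; have /andP[h _] := @trunc_log_bounds 2 N isT N0.
rewrite /half_pow -expnM; apply: leq_trans h; rewrite leq_exp2l //; lia.
Qed.

Lemma half_pow_sq_gt N : (0 < N)%N -> (N < 4 * half_pow N ^ 2)%N.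
Proof.
move=> N0; have /andP[_ h] := @trunc_log_bounds 2 N isT N0.
rewrite /half_pow -expnM -[4%N]/(2 ^ 2)%N -expnD; apply: (leq_trans h).
rewrite leq_exp2l //; lia.
Qed.

Lemma half_pow_gt0 N : (0 < half_pow N)%N.
Proof. by rewrite expn_gt0. Qed.

(** * From traces of high and of fixed degree to the edges *)

Section Edge.
Context {R : realType} d (T : measurableType d) (Pr : probability T R).
Variables (e : nat) (beta : nat -> R) (tau : nat -> nat -> T -> R).
Hypothesis tauP : trace_process Pr e beta tau.
Hypothesis beta_ge0 : forall N, 0 <= beta N.

(* The degree [half_pow N] grows like a power of [N], so it beats the factor
   [N] of the trace, while staying in the range of [trace_rec_le_super]. *)
Lemma trace_process_edge (z mu : nat -> R) (A mumax rho : R) : (e <= 1)%N ->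
  (forall N, critical e (beta N) (z N) (mu N)) ->
  (\forall N \near \oo, (z N)^-1 <= A) -> (forall N, mu N <= mumax) ->
  0 < A < rho ->
  {ae Pr, forall w, \forall N \near \oo,
     2 * N%:R * tau N (half_pow N) w <= rho ^+ half_pow N}.
Proof.
move=> e1 cr zA muB /andP[A0 Arho].
have rho0 : 0 < rho by exact: lt_trans Arho.
(* Half of the gap between [A] and [rho] is spent on the factors [1 + delta], so that
   [A * (1 + delta) < rho]. *)
pose delta := Num.min 1 ((rho - A) / (2 * A)).
have d0 : 0 < delta by rewrite lt_min ltr01 /= divr_gt0 //; lra.
have d1 : delta <= 1 by rewrite ge_min lexx.
have dA : A * (1 + delta) < rho.
  have h : delta <= (rho - A) / (2 * A) by rewrite ge_min lexx orbT.
  have := ler_wpM2l (ltW A0) h; have -> : A * ((rho - A) / (2 * A)) = (rho - A) / 2.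
    by field; rewrite gt_eqF.
  lra.
pose th := A * (1 + delta) / rho.
have th01 : 0 < th < 1.
  by rewrite /th divr_gt0 ?mulr_gt0 //= ?ltr_pdivrMr ?mul1r //; lra.
(* The geometric factor has to absorb [N ^ 2], one [N] from the conclusion and one for the summable
   rate; as [N <= 4 n ^ 2] this is the fourth power of [n]. *)
have [K1 K10 HK1] := pow_geometric_bounded 3 th01.
have mu1 N : 1 <= mu N by case: (cr N).
have B1 : 1 <= mumax by exact: le_trans (muB 0%N).
pose K := 32 * (mumax + 1) * K1.
pose Z N w := (2 * N%:R / rho ^+ half_pow N * tau N (half_pow N) w) ^+ 2.
suff : {ae Pr, forall w, Z N w @[N --> \oo] --> 0}.
  apply: filterS => w cZ.
  have : \forall N \near \oo, Z N w < 1 by apply: (cvgr_lt 0).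
  apply: filterS => N; rewrite /Z => h.
  have r0 : 0 < rho ^+ half_pow N by rewrite exprn_gt0.
  have [|h1] := lerP (2 * N%:R / rho ^+ half_pow N * tau N (half_pow N) w) 1.
    by rewrite mulrAC ler_pdivrMr // mul1r.
  by move: h; rewrite ltNge exprn_ege1 // ltW.
apply: (@ae_cvg0 _ _ _ _ _ (K ^+ 2)) => [N N0|N w|]; last first.
(* The constant is [16 * 2 ^ 3]: the second moment is the list [[:: n; n]], of total degree [2 n] in
   [trace_rec_le_super]. *)
- have nbig : \forall N \near \oo, 128 * mumax <= delta ^+ 3 * (half_pow N)%:R.
    pose X := 128 * mumax / delta ^+ 3.
    have d30 : 0 < delta ^+ 3 by rewrite exprn_gt0.
    exists (4 * (Num.truncn X).+1 ^ 2)%N => // N /= hN.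
    rewrite -ler_pdivrMl // mulrC -/X; apply: (le_trans (ltW (truncnS_gt X))).
    rewrite ler_nat -leq_sqr.
    have N0 : (0 < N)%N by apply: leq_trans hN; rewrite muln_gt0 expn_gt0.
    rewrite -(@leq_pmul2l 4) //; exact: leq_trans hN (ltnW (half_pow_sq_gt N0)).
  near=> N.
  have N0 : (0 < N)%N by near: N; exists 1%N.
  have nb : 128 * mumax <= delta ^+ 3 * (half_pow N)%:R by near: N.
  have zN : (z N)^-1 <= A by near: N.
  have [M MR HM] := tauP N0.
  set n := half_pow N in nb *.
  have n0 : (0 < n)%N by exact: half_pow_gt0.
  have n0R : 0 < n%:R :> R by rewrite ltr0n.
  have nN : n%:R ^+ 2 <= N%:R :> R by rewrite -natrX ler_nat half_pow_sq_le.
  have Nn : N%:R <= 4 * n%:R ^+ 2 :> R.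
    by rewrite -natrX -natrM ler_nat ltnW // half_pow_sq_gt.
  have N0R : 0 < N%:R :> R by rewrite ltr0n.
  have small : N%:R ^- 2 * (16 * mu N * (2 * n)%:R ^+ 3) <= delta ^+ 3.
    rewrite mulrC ler_pdivrMr ?exprn_gt0 //.
    have h1 : n%:R ^+ 4 <= N%:R ^+ 2 :> R.
      by rewrite (exprM _ 2 2) lerXn2r ?nnegrE ?exprn_ge0 // ltW.
    apply: le_trans (ler_wpM2l (exprn_ge0 _ (ltW d0)) h1).
    apply: (@le_trans _ _ (128 * mumax * n%:R ^+ 3)).
      rewrite natrM exprMn -[(2 : nat)%:R ^+ 3]natrX.
      have := ler_wpM2r (exprn_ge0 3 (ltW n0R)) (muB N); rewrite (_ : (2 ^ 3 = 8)%N) //; lra.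
    by rewrite (exprS n%:R 3) [leRHS]mulrA ler_wpM2r // exprn_ge0 // ltW.
  have n20 : (0 < 2 * n)%N by rewrite muln_gt0.
  have d01 : 0 < delta <= 1 by rewrite d0.
  have q0 : 0 <= N%:R ^- 2 :> R by rewrite invr_ge0 exprn_ge0.
  have HS := trace_rec_le_super n20 (beta_ge0 N) q0 d01 MR (mom_recP e (beta N)) (cr N) e1 small.
  cbv zeta in HS; have := HS [:: n; n].
  rewrite /= addn0 addnn mul2n leqnn => /(_ isT).
  rewrite !big_cons big_nil mulr1 -expr2; set eta := delta / _; set X := _ * (1 + delta) ^+ n => hM.
  have eta0 : 0 <= eta <= 1.
    have n4 : 1 <= 2 * (n.*2)%:R :> R by rewrite -natrM ler1n muln_gt0 double_gt0.
    apply/andP; split; first by rewrite divr_ge0 // ltW.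
    by rewrite ler_pdivrMr; lra.
  have /andP[z0 z1] : 0 < z N <= 1 by case: (cr N).
  have hX : 0 <= X <= (mumax + 1) * (A * (1 + delta)) ^+ n.
    have zV0 : 0 <= z N ^- n by rewrite invr_ge0 exprn_ge0 // ltW.
    have mb := mom_le_critical (beta_ge0 N) (mom_recP e (beta N)) (cr N) n.
    have m0 := mom_rec_ge0 (beta_ge0 N) (mom_recP e (beta N)) n.
    have dn0 : 0 <= (1 + delta) ^+ n by rewrite exprn_ge0 //; lra.
    case/andP: eta0 => eta0 eta1.
    rewrite /X; apply/andP; split; first by rewrite mulr_ge0 // addr_ge0 // mulr_ge0.
    rewrite exprMn mulrA ler_wpM2r //.
    have zAn : z N ^- n <= A ^+ n.
      by rewrite -exprVn lerXn2r // ?nnegrE ?invr_ge0 ?ltW.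
    apply: le_trans (ler_wpM2l _ zAn); last by lra.
    rewrite mulrDl mul1r lerD //; last by rewrite ler_piMl.
    by apply: (le_trans mb); rewrite ler_wpM2r.
  have [I2 E2] := HM [:: n; n].
  pose c := 2 * N%:R / rho ^+ n.
  have E : (\int[Pr]_w (Z N w)%:E = (c ^+ 2 * M [:: n; n])%:E)%E.
    rewrite EFinM -E2 -integralZl //.
    apply: eq_integral => w _; rewrite /Z -/n -/c !big_cons !big_nil !mulr1 -EFinM.
    by congr (_%:E); ring.
  rewrite E lee_fin ler_pdivlMr ?exprn_gt0 //.
  have c0 : 0 <= c by rewrite /c divr_ge0 ?exprn_ge0 ?mulr_ge0 ?ltW.
  apply: (@le_trans _ _ (c ^+ 2 * X ^+ 2 * N%:R ^+ 2)).
    by rewrite ler_wpM2r ?exprn_ge0 // ler_wpM2l ?exprn_ge0.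
  case/andP: hX => X0 hX.
  have m1 : 0 <= mumax + 1 by exact: addr_ge0 (le_trans ler01 B1) ler01.
  have K0 : 0 <= K by rewrite /K mulr_ge0 // mulr_ge0.
  have cX0 : 0 <= c * X * N%:R by rewrite mulr_ge0 // mulr_ge0.
  rewrite -!exprMn lerXn2r ?nnegrE //.
  apply: (@le_trans _ _ (2 * N%:R ^+ 2 * ((mumax + 1) * th ^+ n))).
    have -> : 2 * N%:R ^+ 2 * ((mumax + 1) * th ^+ n) = c * ((mumax + 1) * (A * (1 + delta)) ^+ n) * N%:R.
      by rewrite /c /th exprMn exprVn; field; rewrite expf_neq0 // gt_eqF.
    rewrite ler_wpM2r ?ler0n //; exact: ler_wpM2l.
  have t0 : 0 <= th ^+ n by rewrite exprn_ge0 // ltW //; case/andP: th01.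
  have N2 : N%:R ^+ 2 <= 16 * n%:R ^+ 4 :> R.
    have -> : 16 * n%:R ^+ 4 = (4 * n%:R ^+ 2) ^+ 2 :> R by ring.
    by rewrite lerXn2r ?nnegrE ?mulr_ge0 ?exprn_ge0 // ltW.
  have mt : 0 <= (mumax + 1) * th ^+ n by rewrite mulr_ge0.
  apply: (@le_trans _ _ (2 * (16 * n%:R ^+ 4) * ((mumax + 1) * th ^+ n))).
    by apply: ler_wpM2r => //; exact: ler_wpM2l.
  have -> : 2 * (16 * n%:R ^+ 4) * ((mumax + 1) * th ^+ n) = 32 * (mumax + 1) * (n%:R ^+ 4 * th ^+ n) by ring.
  by apply: ler_wpM2l => //; rewrite mulr_ge0.
- exact: sqr_ge0.
- apply: measurable_funX; apply: measurable_funM => //.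
  exact: (trace_process_measurable tauP).
Unshelve. all: by end_near. Qed.

End Edge.

Section BlockTrace.
Context {K : comNzRingType}.

Lemma mxtrace_pow_swap m n (A : 'M[K]_(m, n)) (B : 'M[K]_(n, m)) j :
  \tr ((B *m A) ^+ j.+1) = \tr ((A *m B) ^+ j.+1).
Proof.
suff -> : (B *m A) ^+ j.+1 = B *m (A *m B) ^+ j *m A.
  by rewrite -mulmxA mxtrace_mulC -mulmxA mulmxE -exprSr.
elim: j => [|j IH]; first by rewrite expr1 expr0 mulmx1.
by rewrite exprS IH -[(B *m A) * _]/((B *m A) *m _) exprS -[(A *m B) * _]/((A *m B) *m _) !mulmxA.
Qed.

Lemma antidiag_pow_even m n (A : 'M[K]_(m, n)) (B : 'M[K]_(n, m)) j :
  block_mx 0 A B 0 ^+ j.*2 = block_mx ((A *m B) ^+ j) 0 0 ((B *m A) ^+ j).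
Proof.
elim: j => [|j IH]; first by rewrite !expr0 -scalar_mx_block.
rewrite doubleS !exprS IH -!mulmxE !mulmx_block.
by rewrite !(mul0mx, mulmx0, add0r, addr0) !mulmxA.
Qed.

Lemma mxtrace_antidiag_even m n (A : 'M[K]_(m, n)) (B : 'M[K]_(n, m)) j :
  \tr (block_mx 0 A B 0 ^+ j.+1.*2) = \tr ((A *m B) ^+ j.+1) *+ 2.
Proof. by rewrite antidiag_pow_even mxtrace_block mxtrace_pow_swap mulr2n. Qed.

Lemma mxtrace_antidiag_odd m n (A : 'M[K]_(m, n)) (B : 'M[K]_(n, m)) j :
  \tr (block_mx 0 A B 0 ^+ j.*2.+1) = 0.
Proof.
rewrite exprS antidiag_pow_even -mulmxE mulmx_block.
by rewrite !(mul0mx, mulmx0, add0r, addr0) mxtrace_block !mxtrace0 addr0.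
Qed.

End BlockTrace.

Section HermitianEdge.
Context {R : realType}.
Local Notation C := R[i].

Lemma hermitian_edge_upper n (H : 'M[C]_n) k (rho : R) : adj H = H -> 0 <= rho ->
  complex.Re (\tr (H ^+ (2 ^ k.+1))) <= rho ^+ (2 ^ k.+1) ->
  forall y, nsq y = 1 -> rquad H y <= rho.
Proof.
move=> HH r0 h y y1; rewrite leNgt; apply/negP => ry.
have := le_trans (rquad_pow_le k HH y1) h; rewrite leNgt => /negP; apply.
by rewrite ltrXn2r // ?expn_eq0.
Qed.

(** The hypothesis of [rquad_lower] once the odd traces vanish. The ratio [m k.+1 / m k] comes close
    to [t ^+ 2], the Marchenko-Pastur edge, and at that ratio the weighted mean
    [2 t m k.+1 / (m k.+1 + t ^+ 2 m k)] equals [t]. *)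
Lemma mom_growth_sqrt (beta rho : R) : 0 <= beta -> let t := 1 + Num.sqrt (1 + beta) in
  rho < t -> exists2 k, (0 < k)%N & let m := mom 0 beta in
    rho * (m k.+1 + t ^+ 2 * m k) < 2 * t * m k.+1.
Proof.
move=> b0 /=; set r := Num.sqrt _; set t := 1 + r => rt; have r2 : r ^+ 2 = 1 + beta by rewrite sqr_sqrtr; lra.
have r1 : 0 <= r by exact: sqrtr_ge0.
pose r0 := Num.max rho (t / 2).
have [rr0 tr0] : rho <= r0 /\ t / 2 <= r0 by rewrite /r0 !le_max !lexx orbT.
have r0t : r0 < t by rewrite /r0 gt_max rt /= /t; lra.
have d0 : 0 < 2 * t - r0 by move: r0t; rewrite /t; lra.
have t0 : 0 < t by rewrite /t; lra.
(* The ratio [m k.+1 / m k] at which the claim, with [r0] for [rho], becomes an equality. *)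
pose rho' := t ^+ 2 * r0 / (2 * t - r0).
have rt' : rho' < t ^+ 2.
  rewrite /rho' -mulrA gtr_pMr ?exprn_gt0 // ltr_pdivrMr // mul1r; lra.
have bt : beta < t ^+ 2 by rewrite /t sqrrD r2 expr1n; lra.
have bt4 : (t ^+ 2 - beta) ^+ 2 = 4 * t ^+ 2.
  have -> : t ^+ 2 - beta = 2 * t by rewrite /t sqrrD r2 expr1n; ring.
  by ring.
have [k k0 hk] := mom_growth b0 (mom_recP 0 beta) bt bt4 rt'.
exists k => //=; set m := mom 0 beta in hk *.
have mge0 : forall a, 0 <= m a by apply: (mom_rec_ge0 b0); exact: mom_recP.
apply: (@le_lt_trans _ _ (r0 * (m k.+1 + t ^+ 2 * m k))).
  by rewrite ler_wpM2r // addr_ge0 // mulr_ge0 // sqr_ge0.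
have : (rho' * m k) * (2 * t - r0) < m k.+1 * (2 * t - r0) by rewrite ltr_pM2r.
have -> : (rho' * m k) * (2 * t - r0) = t ^+ 2 * r0 * m k by rewrite /rho'; field; rewrite gt_eqF.
rewrite mulrBr mulrDr; lra.
Qed.

(** A strict inequality between limits holds for all large sizes. Degree 0 is kept out because
    [\tr (H N ^+ 0) / N] is [n N / N], which for the chiral block does not tend to twice the moment
    of degree 0. *)
Lemma hermitian_edge_lower (n : nat -> nat) (H : forall N, 'M[C]_(n N)) (l : nat -> R) k (t rho : R) :
  (forall N, adj (H N) = H N) ->
  (forall j, (0 < j)%N -> (complex.Re (\tr (H N ^+ j)) / N%:R) @[N --> \oo] --> l j) ->
  (0 < k)%N ->
  rho * (l k.*2.+2 + 2 * t * l k.*2.+1 + t ^+ 2 * l k.*2)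
    < l k.*2.+3 + 2 * t * l k.*2.+2 + t ^+ 2 * l k.*2.+1 ->
  \forall N \near \oo, exists2 y, nsq y = 1 & rho < rquad (H N) y.
Proof.
move=> HH cl k0 hlt.
pose tau N j := complex.Re (\tr (H N ^+ j)) / N%:R.
have c j : (0 < j)%N -> tau N j @[N --> \oo] --> l j by exact: cl.
have k20 : (0 < k.*2)%N by rewrite double_gt0.
have cL : tau N k.*2.+3 + 2 * t * tau N k.*2.+2 + t ^+ 2 * tau N k.*2.+1
    - rho * (tau N k.*2.+2 + 2 * t * tau N k.*2.+1 + t ^+ 2 * tau N k.*2) @[N --> \oo] -->
   l k.*2.+3 + 2 * t * l k.*2.+2 + t ^+ 2 * l k.*2.+1
    - rho * (l k.*2.+2 + 2 * t * l k.*2.+1 + t ^+ 2 * l k.*2).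
  apply: cvgB.
    apply: cvgD; last by apply: cvgM; [exact: cvg_cst|exact: c].
    by apply: cvgD; [exact: c|apply: cvgM; [exact: cvg_cst|exact: c]].
  apply: cvgM; first exact: cvg_cst.
  apply: cvgD; last by apply: cvgM; [exact: cvg_cst|exact: c].
  by apply: cvgD; [exact: c|apply: cvgM; [exact: cvg_cst|exact: c]].
near=> N; apply: (@rquad_lower _ _ _ k t) => //.
have N0 : (0 < N)%N by near: N; exists 1%N.
have h : 0 < tau N k.*2.+3 + 2 * t * tau N k.*2.+2 + t ^+ 2 * tau N k.*2.+1
    - rho * (tau N k.*2.+2 + 2 * t * tau N k.*2.+1 + t ^+ 2 * tau N k.*2).
  near: N; apply: (cvgr_gt _ cL); rewrite subr_gt0 //.
have N1 : 0 < N%:R^-1 :> R by rewrite invr_gt0 ltr0n.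
rewrite -subr_gt0 -(pmulr_lgt0 _ N1); move: h; congr (_ < _); rewrite /tau; ring.
Unshelve. all: by end_near. Qed.

End HermitianEdge.

(** * Independent real Gaussians behind the complex matrices *)

Section IndependentReals.
Context {R : realType} d (T : measurableType d) (Pr : probability T R).

Definition indep_family (K : finType) (Z : K -> T -> R[i]) : Prop :=
  forall A : K -> set T, (forall k, sigma_complex (Z k) (A k)) ->
    Pr (\bigcap_k A k) = (\prod_k Pr (A k))%E.

Lemma mutual_indep_family (K : finType) (Z : K -> T -> R[i]) :
  mutual_indep Pr (fun k => sigma_complex (Z k)) -> indep_family Z.
Proof.
move=> h A hA; have := h [set: K]%SET A (fun k _ => hA k).
have -> : [set` [set: K]%SET] = [set: K] by apply/seteqP; split=> x //=; rewrite inE.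
by move=> ->; apply: eq_bigl => k; rewrite inE.
Qed.

Definition mx_family m n (M : T -> 'M[R[i]]_(m, n)) (ij : 'I_m * 'I_n) (w : T) : R[i] := M w ij.1 ij.2.

Lemma indep_family_pair m n (P Q : T -> 'M[R[i]]_(m, n)) :
  indep_family (mx_family P) -> indep_family (mx_family Q) ->
  indep2 Pr (sigma_mx P) (sigma_mx Q) ->
  indep_family (fun k : bool * ('I_m * 'I_n) => mx_family (if k.1 then Q else P) k.2).
Proof.
move=> iP iQ iPQ A hA.
have cap (M : T -> 'M[R[i]]_(m, n)) (B : 'I_m * 'I_n -> set T) :
    (forall ij, sigma_complex (mx_family M ij) (B ij)) -> sigma_mx M (\bigcap_ij B ij).
  move=> hB; pose G := \bigcup_(ij in [set: 'I_m * 'I_n]) sigma_complex (fun w => M w ij.1 ij.2).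
  apply: (@fin_bigcap_measurable _ (g_sigma_algebraType G)) => // ij _.
  apply: sub_gen_smallest; exists ij; [by [] | exact: hB].
have -> : \bigcap_k A k = (\bigcap_ij A (false, ij)) `&` (\bigcap_ij A (true, ij)).
  apply/seteqP; split=> [w h|w [h1 h2] [[] ij] _].
  - by split=> ij _; exact: h.
  - exact: h2.
  - exact: h1.
rewrite iPQ; [|by apply: cap => ij; exact: (hA (false, ij))|by apply: cap => ij; exact: (hA (true, ij))].
rewrite iP; last by move=> ij; exact: (hA (false, ij)).
rewrite iQ; last by move=> ij; exact: (hA (true, ij)).
have -> : (\prod_k Pr (A k) = \prod_b \prod_ij Pr (A (b, ij)))%E.
  by rewrite pair_bigA; apply: eq_bigr => -[b ij].
by rewrite big_bool /= muleC.
Qed.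

(** Independence acts on two levels: a rectangle in real and imaginary part of [Z k] lies in the
    sigma-algebra of [Z k], so the entries separate first, and then the two parts of each entry. *)
Lemma indep_real_family (K : finType) (Z : K -> T -> R[i]) (v : R) :
  (forall k, complex_gaussian Pr v (Z k)) -> indep_family Z ->
  exists x : 'I_#|{: K * bool}| -> {RV Pr >-> R},
   [/\ forall i, real_gaussian (v / 2) (x i),
       (forall B : 'I_#|{: K * bool}| -> set R, (forall i, measurable (B i)) ->
         Pr (\bigcap_i (x i @^-1` B i)) = (\prod_i Pr (x i @^-1` B i))%E) &
       forall k w, Z k w = x (enum_rank (k, false)) w +i* x (enum_rank (k, true)) w].
Proof.
move=> gZ iZ.
have HP k : exists F : {RV Pr >-> R} * {RV Pr >-> R},
    [/\ Z k = (fun w => F.1 w +i* F.2 w), real_gaussian (v / 2) F.1, real_gaussian (v / 2) F.2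
      & indep2 Pr (g_sigma_algebra_preimage F.1) (g_sigma_algebra_preimage F.2)].
  by have [X [Y [h1 h2 h3 h4]]] := gZ k; exists (X, Y).
pose F k := sval (cid (HP k)).
have HF k : [/\ Z k = (fun w => (F k).1 w +i* (F k).2 w), real_gaussian (v / 2) (F k).1,
        real_gaussian (v / 2) (F k).2
      & indep2 Pr (g_sigma_algebra_preimage (F k).1) (g_sigma_algebra_preimage (F k).2)].
  exact: svalP (cid (HP k)).
pose x (i : 'I_#|{: K * bool}|) : {RV Pr >-> R} := let kb := enum_val i : K * bool in if kb.2 then (F kb.1).2 else (F kb.1).1.
have xE k b : x (enum_rank (k, b)) = if b then (F k).2 else (F k).1 by rewrite /x enum_rankK.
exists x; split.
- by move=> i; rewrite /x; have [_ h1 h2 _] := HF (enum_val i).1; case: ifP.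
- move=> B mB.
  pose D k b := (if b then (F k).2 else (F k).1) @^-1` B (enum_rank (k, b)).
  have -> : \bigcap_i (x i @^-1` B i) = \bigcap_k (D k false `&` D k true).
    apply/seteqP; split=> w h.
      move=> k _; have := h (enum_rank (k, false)) I; have := h (enum_rank (k, true)) I.
      by rewrite !xE.
    move=> i _; have := h (enum_val i).1 I => -[h1 h2].
    rewrite -(enum_valK i); case: (enum_val i) h1 h2 => k b /= h1 h2.
    by rewrite /= xE; case: b.
  rewrite iZ => [|k].
    rewrite (reindex enum_rank) /=; last exact: onW_bij (@enum_rank_bij _).
    have -> : (\prod_(kb : K * bool) Pr (x (enum_rank kb) @^-1` B (enum_rank kb)) =
        \prod_k \prod_b Pr (x (enum_rank (k, b)) @^-1` B (enum_rank (k, b))))%E.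
      by rewrite pair_bigA; apply: eq_bigr => -[k b].
    apply: eq_bigr => k _; rewrite big_bool /= !xE muleC.
    have [_ _ _ ->] := HF k => //.
    + by exists (B (enum_rank (k, false))) => //; rewrite setTI.
    + by exists (B (enum_rank (k, true))) => //; rewrite setTI.
  have [ZE _ _ _] := HF k.
  exists (B (enum_rank (k, false)) `*` B (enum_rank (k, true))); first exact: measurableX.
  by rewrite setTI ZE.
- by move=> k w; rewrite !xE; have [-> _ _ _] := HF k.
Qed.

End IndependentReals.

Section Evaluation.
Context {R : realType} d (T : measurableType d) (Pr : probability T R).
Local Notation C := R[i].

Lemma mxtrace_real n (H : 'M[C]_n) k : adj H = H ->
  \tr (H ^+ k) = (complex.Re (\tr (H ^+ k)))%:C.
Proof.
move=> HH; have : Num.conj (\tr (H ^+ k)) = \tr (H ^+ k).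
  rewrite -[in RHS]HH -adj_pow; move: (H ^+ k) => B.
  by rewrite rmorph_sum; apply: eq_bigr => i _; rewrite adjE.
rewrite conjCE; case: (\tr _) => a b /= [] /eqP; rewrite -subr_eq0 -opprD oppr_eq0.
by rewrite -mulr2n mulrn_eq0 /= => /eqP ->.
Qed.

Section Family.
Context (n N : nat) (v : R) (x : 'I_n -> {RV Pr >-> R}).
Hypothesis N_gt0 : (0 < N)%N.
Hypothesis v_gt0 : 0 < v.
Hypothesis gx : forall i, real_gaussian v (x i).
Hypothesis indx : forall B : 'I_n -> set R, (forall i, measurable (B i)) ->
  Pr (\bigcap_i (x i @^-1` B i)) = (\prod_i Pr (x i @^-1` B i))%E.

Definition xeval (w : T) : mpoly n C -> C := meval (fun i => (x i w)%:C).

Lemma trace_moments (A : 'M[mpoly n C]_N) (B : T -> 'M[C]_N) :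
  (forall w, map_mx (xeval w) A = B w) -> (forall w, adj (B w) = B w) ->
  forall s, Pr.-integrable setT
      (fun w => (\prod_(a <- s) (complex.Re (\tr (B w ^+ a)) / N%:R))%:E) /\
    (\int[Pr]_w (\prod_(a <- s) (complex.Re (\tr (B w ^+ a)) / N%:R))%:E
      = (norm_traces v A s)%:E)%E.
Proof.
move=> AB HB s; have [I E] := expectation_peval v_gt0 gx indx (tr_prod A s).
have pE w : peval x (tr_prod A s) w = \prod_(a <- s) complex.Re (\tr (B w ^+ a)).
  rewrite /peval /tr_prod rmorph_prod /=.
  have -> : \prod_(a <- s) meval (fun i => (x i w)%:C) (\tr (A ^+ a)) =
      (\prod_(a <- s) complex.Re (\tr (B w ^+ a)))%:C.
    rewrite rmorph_prod; apply: eq_bigr => a _; rewrite /= -mxtrace_real //.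
    by rewrite -trace_map_mx rmorphXn /= [map_mx _ A]AB.
  by [].
have FE w : \prod_(a <- s) (complex.Re (\tr (B w ^+ a)) / N%:R) =
    N%:R ^- size s * peval x (tr_prod A s) w.
  rewrite pE; elim: s {I E pE} => [|a s IH]; first by rewrite !big_nil expr0 invr1 mul1r.
  by rewrite !big_cons /= IH exprS invfM; ring.
split.
  apply: (eq_integrable _ (fun w => ((N%:R ^- size s)%:E * (peval x (tr_prod A s) w)%:E)%E)) => //.
    by move=> w _; rewrite -EFinM FE.
  exact: integrableZl.
under eq_integral => w _ do rewrite FE EFinM.
by rewrite integralZl // E -EFinM mulrC.
Qed.

End Family.

Lemma xeval_gpoly (K : finType) (x : 'I_#|{: K * bool}| -> {RV Pr >-> R}) (k : K) w :
  xeval x w (gpoly k) = x (enum_rank (k, false)) w +i* x (enum_rank (k, true)) w.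
Proof.
rewrite /xeval /gpoly mevalD mevalZ /gvar !mevalXU [RHS]complexE /=.
by rewrite /Num.imaginary /=.
Qed.

Lemma xeval_gpolyc (K : finType) (x : 'I_#|{: K * bool}| -> {RV Pr >-> R}) (k : K) w :
  xeval x w (gpolyc k) = Num.conj (xeval x w (gpoly k)).
Proof.
rewrite xeval_gpoly /xeval /gpolyc mevalB mevalZ /gvar !mevalXU conjCE [RHS]complexE /=.
by rewrite rmorphN mulrN.
Qed.

Lemma xeval_comb n (x : 'I_n -> {RV Pr >-> R}) w a b p q :
  xeval x w (a *: p + b *: q) = a * xeval x w p + b * xeval x w q.
Proof. by rewrite /xeval mevalD !mevalZ. Qed.

(* Every Hermitian part [Re (c^* X^e)] has this form. *)
Definition elliptic_proj (N : nat) (z : C) (G : 'M[C]_N) : 'M[C]_N :=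
  z *: G + Num.conj z *: adj G.

Lemma adj_elliptic_proj N z (G : 'M[C]_N) : adj (elliptic_proj z G) = elliptic_proj z G.
Proof. by rewrite /elliptic_proj adjD !adjZ adjK conjCK addrC. Qed.

(** The real variables have variance [1 / (2 N)], so a squared modulus 1/2 gives entries of variance
    [1 / N], whatever the phase of [z]. *)
Lemma ginibre_trace_process (G : forall N, T -> 'M[C]_N) (z : C) :
  (forall N, (0 < N)%N -> ginibre Pr (G N)) ->
  complex.Re z ^+ 2 + complex.Im z ^+ 2 = 1 / 2 ->
  trace_process Pr 1 (fun=> 0)
    (fun N a w => complex.Re (\tr (elliptic_proj z (G N w) ^+ a)) / N%:R).
Proof.
move=> gG hz N N0; have [gZ /mutual_indep_family iZ] := gG N N0.
have [x [gx ix xE]] := indep_real_family (fun k => gZ k.1 k.2) iZ.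
have v0 : 0 < (N%:R^-1 / 2 : R) by rewrite divr_gt0 // invr_gt0 ltr0n.
exists (norm_traces (N%:R^-1 / 2) (gue_mx N z)).
  by apply: gue_trace_rec => //; rewrite hz; field; rewrite pnatr_eq0 -lt0n.
apply: (trace_moments v0 gx ix) => w; last exact: adj_elliptic_proj.
have gE k : xeval x w (gpoly k) = mx_family (G N) k w by rewrite xeval_gpoly -xE.
apply/matrixP => i j; rewrite mxE [gue_mx _ _ _ _]mxE xeval_comb.
by rewrite xeval_gpolyc !gE /elliptic_proj !mxE.
Qed.

Lemma wishart_trace_process (nu : nat -> nat) (P Q : forall N, T -> 'M[C]_(N, N + nu N)) (z1 z2 : C) :
  (forall N : nat, (0 < N)%N ->
     [/\ gaussian_mx Pr ((2 * N%:R)^-1) (P N), gaussian_mx Pr ((2 * N%:R)^-1) (Q N)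
       & indep2 Pr (sigma_mx (P N)) (sigma_mx (Q N))]) ->
  complex.Re z1 ^+ 2 + complex.Im z1 ^+ 2 + (complex.Re z2 ^+ 2 + complex.Im z2 ^+ 2) = 2 ->
  trace_process Pr 0 (fun N => (nu N)%:R / N%:R)
    (fun N a w => let Y := z1 *: P N w + z2 *: Q N w in
       complex.Re (\tr ((Y *m adj Y) ^+ a)) / N%:R).
Proof.
move=> gPQ hz N N0; have [[gP /mutual_indep_family iP] [gQ /mutual_indep_family iQ] iPQ] := gPQ N N0.
have gZ (k : bool * ('I_N * 'I_(N + nu N))) : complex_gaussian Pr ((2 * N%:R)^-1)
    (mx_family (if k.1 then Q N else P N) k.2).
  by case: k => -[] [i j] /=; [exact: gQ | exact: gP].
have [x [gx ix xE]] := indep_real_family gZ (indep_family_pair iP iQ iPQ).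
have v0 : 0 < ((2 * N%:R)^-1 / 2 : R) by rewrite divr_gt0 // invr_gt0 mulr_gt0 ?ltr0n.
exists (norm_traces ((2 * N%:R)^-1 / 2) (wishart_l N (N + nu N) z1 z2 *m wishart_r N (N + nu N) z1 z2)).
  have -> : (nu N)%:R / N%:R = (N + nu N)%:R / N%:R - 1 :> R.
    by rewrite natrD; field; rewrite pnatr_eq0 -lt0n.
  by apply: wishart_trace_rec => //; rewrite hz; field; rewrite pnatr_eq0 -lt0n.
apply: (trace_moments v0 gx ix) => w; last by rewrite adjM adjK.
have gE k : xeval x w (gpoly k) = mx_family (if k.1 then Q N else P N) k.2 w.
  by rewrite xeval_gpoly -xE.
apply: (etrans (map_mxM _ _ _)); congr (_ *m _); apply/matrixP => i j; rewrite mxE -[LHS]/(xeval x w _).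
  by rewrite [wishart_l _ _ _ _ _ _]mxE xeval_comb !gE !mxE.
rewrite [wishart_r _ _ _ _ _ _]mxE xeval_comb !xeval_gpolyc !gE adjE !mxE.
by rewrite rmorphD !rmorphM.
Qed.

End Evaluation.

Lemma critical_semicircle (R : realType) : critical 1 (0 : R) (1 / 2) 2.
Proof.
split.
- apply/andP; split; lra.
- lra.
- rewrite !expr2; lra.
- rewrite !expr2; lra.
Qed.

(** * Edges of the two models *)

Section Edges.
Context {R : realType} d (T : measurableType d) (Pr : probability T R).
Local Notation C := R[i].

(** Almost sure convergence of the largest eigenvalue to [lam], expressed by Rayleigh quotients; the
    null set may depend on [rho]. *)
Definition spectral_edge (n : nat -> nat) (H : forall N, T -> 'M[C]_(n N)) (lam : R) : Prop :=
  (forall rho, lam < rho -> {ae Pr, forall w, \forall N \near \oo,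
     forall y, nsq y = 1 -> rquad (H N w) y <= rho}) /\
  (forall rho, rho < lam -> {ae Pr, forall w, \forall N \near \oo,
     exists2 y, nsq y = 1 & rho < rquad (H N w) y}).

Lemma elliptic_edge (G : forall N, T -> 'M[C]_N) (z : C) :
  (forall N, (0 < N)%N -> ginibre Pr (G N)) ->
  complex.Re z ^+ 2 + complex.Im z ^+ 2 = 1 / 2 ->
  spectral_edge (fun N w => elliptic_proj z (G N w)) 2.
Proof.
move=> gG hz; have TP := ginibre_trace_process gG hz.
split=> rho hrho.
  have zA : (1 / 2 : R)^-1 <= 2 by rewrite div1r invrK.
  have A2 : 0 < (2 : R) < rho by rewrite hrho ltr0n.
  apply: filterS (trace_process_edge TP (fun=> lexx _) isT (fun=> critical_semicircle R) (nearW _ (fun=> zA)) (fun=> lexx _) A2) => w hw.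
  near=> N.
  (* From here on [half_pow N] is at least 2, hence of the form [2 ^ k.+1] that [rquad_pow_le]
     treats. *)
  have N4 : (4 <= N)%N by near: N; exists 4%N.
  have [k hk] : exists k, half_pow N = (2 ^ k.+1)%N.
    exists (trunc_log 2 N)./2.-1; rewrite /half_pow prednK // half_gt0.
    by apply: (@leq_trans (trunc_log 2 4)) => //; apply: leq_trunc_log.
  have : 2 * N%:R * (complex.Re (\tr (elliptic_proj z (G N w) ^+ half_pow N)) / N%:R)
      <= rho ^+ half_pow N by near: N.
  rewrite hk => h y y1.
  have N0 : 0 < N%:R :> R by rewrite ltr0n; lia.
  have r0 : 0 <= rho by lra.
  apply: (@hermitian_edge_upper _ _ _ k _ (adj_elliptic_proj _ _) r0 _ y y1).
  (* The trace dominates an even power, so it is nonnegative and the bound on twice the trace bounds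
     the trace. *)
  have := rquad_pow_le k (adj_elliptic_proj z (G N w)) y1.
  have := exprn_even_ge0 (rquad (elliptic_proj z (G N w)) y) (n := 2 ^ k.+1).
  rewrite oddX /= => /(_ isT); move: h; set t := complex.Re _.
  have -> : 2 * N%:R * (t / N%:R) = 2 * t by field; rewrite gt_eqF.
  lra.
(* Ratio 0 gives [t = 2], the edge of the semicircle law; [mom_catalan] carries the inequality over
   to its even moments. *)
have := @mom_growth_sqrt R 0 rho (lexx _).
rewrite addr0 sqrtr1.
have -> : 1 + 1 = 2 :> R by lra.
move=> /(_ hrho)[k k0 /= hk].
have : {ae Pr, forall w, forall a, complex.Re (\tr (elliptic_proj z (G N w) ^+ a)) / N%:R
    @[N --> \oo] --> mom 1 (0 : R) a}.
  by apply: ae_foralln => a; apply: (trace_process_lln TP (fun=> lexx _)); exact: cvg_cst.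
apply: filterS => w hw.
have cat := mom_catalan (mom_recP 1 (0 : R)) (mom_recP 0 (0 : R)).
apply: (hermitian_edge_lower (l := mom 1 0) (k := k) (t := 2)) => //.
- by move=> N; exact: adj_elliptic_proj.
- rewrite -doubleS !(cat _).1 !(cat _).2; lra.
Unshelve. all: by end_near. Qed.
End Edges.

(** [t ^+ 2] is the upper edge of the Marchenko-Pastur law, so its inverse is the radius of
    convergence of the generating function, whose value there is [t]. *)
Lemma critical_marchenko_pastur (R : realType) (beta : R) : 0 <= beta ->
  let t := 1 + Num.sqrt (1 + beta) in critical 0 beta (t ^+ 2)^-1 t.
Proof.
move=> b0 /=; set r := Num.sqrt _.
have r2 : r ^+ 2 = 1 + beta by rewrite sqr_sqrtr; lra.
have r0 : 0 <= r by exact: sqrtr_ge0.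
have bE : beta = r ^+ 2 - 1 by lra.
have t0 : 1 + r != 0 by rewrite gt_eqF //; lra.
split.
- by rewrite invr_gt0 exprn_gt0 /= ?invf_le1 ?exprn_ege1 ?exprn_gt0 //; lra.
- lra.
- rewrite bE expr1; field; exact: t0.
- rewrite bE expr1; field; exact: t0.
Qed.

Section ChiralEdge.
Context {R : realType} d (T : measurableType d) (Pr : probability T R).
Local Notation C := R[i].

Definition chiral_block m n (Y : 'M[C]_(m, n)) : 'M[C]_(m + n) := block_mx 0 Y (adj Y) 0.

Lemma adj_block m n p q (A : 'M[C]_(m, n)) (B : 'M[C]_(m, q)) (D : 'M[C]_(p, n)) (E : 'M[C]_(p, q)) :
  adj (block_mx A B D E) = block_mx (adj A) (adj D) (adj B) (adj E).
Proof. by rewrite /adj tr_block_mx map_block_mx. Qed.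

Lemma adj0 m n : adj (0 : 'M[C]_(m, n)) = 0.
Proof. by apply/matrixP => i j; rewrite adjE !mxE conjC0. Qed.

Lemma adj_chiral_block m n (Y : 'M[C]_(m, n)) : adj (chiral_block Y) = chiral_block Y.
Proof. by rewrite /chiral_block adj_block !adj0 adjK. Qed.

Lemma chiral_block_trace_even m n (Y : 'M[C]_(m, n)) j :
  complex.Re (\tr (chiral_block Y ^+ j.+1.*2)) = 2 * complex.Re (\tr ((Y *m adj Y) ^+ j.+1)).
Proof. by rewrite mxtrace_antidiag_even mulr2n ReD; ring. Qed.

Lemma chiral_block_trace_odd m n (Y : 'M[C]_(m, n)) j :
  complex.Re (\tr (chiral_block Y ^+ j.*2.+1)) = 0.
Proof. by rewrite mxtrace_antidiag_odd. Qed.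

Lemma chiral_edge (nu : nat -> nat) (alpha : R) (P Q : forall N, T -> 'M[C]_(N, N + nu N)) (z1 z2 : C) :
  0 <= alpha -> (nu N)%:R / N%:R @[N --> \oo] --> alpha ->
  (forall N : nat, (0 < N)%N ->
     [/\ gaussian_mx Pr ((2 * N%:R)^-1) (P N), gaussian_mx Pr ((2 * N%:R)^-1) (Q N)
       & indep2 Pr (sigma_mx (P N)) (sigma_mx (Q N))]) ->
  complex.Re z1 ^+ 2 + complex.Im z1 ^+ 2 + (complex.Re z2 ^+ 2 + complex.Im z2 ^+ 2) = 2 ->
  spectral_edge Pr (fun N w => chiral_block (z1 *: P N w + z2 *: Q N w)) (1 + Num.sqrt (1 + alpha)).
Proof.
move=> a0 cnu gPQ hz; have TP := wishart_trace_process gPQ hz.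
pose beta N : R := (nu N)%:R / N%:R.
have b0 N : 0 <= beta N by rewrite divr_ge0.
pose t (b : R) := 1 + Num.sqrt (1 + b).
pose Y N w := z1 *: P N w + z2 *: Q N w.
have ct : t (beta N) @[N --> \oo] --> t alpha.
  apply: cvgD; first exact: cvg_cst.
  apply: (continuous_cvg _ (@sqrt_continuous R _)).
  by apply: cvgD; [exact: cvg_cst | exact: cnu].
have t1 b : 1 <= t b by rewrite /t lerDl sqrtr_ge0.
split=> rho; rewrite -/(t alpha) => hrho.
  (* The edge [t (beta N)] of size [N] is only eventually close to [t alpha]; the intermediate level
     leaves room for this. *)
  pose r1 := (t alpha + rho) / 2.
  have [r1t r1r] : t alpha < r1 /\ r1 < rho by rewrite /r1; split; lra.
  have r11 : 1 < r1 by exact: le_lt_trans (t1 alpha) r1t.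
  have tb : \forall N \near \oo, t (beta N) <= r1.
    by apply: filterS (cvgr_lt _ ct _ r1t) => N /ltW.
  have zA : \forall N \near \oo, ((t (beta N) ^+ 2)^-1)^-1 <= r1 ^+ 2.
    apply: filterS tb => N h; rewrite invrK lerXn2r // nnegrE; last lra.
    by apply: le_trans (t1 _).
  have [m hm] : exists m, forall N, t (beta N) <= m.
    have : cvgn (fun N => t (beta N)) by apply/cvg_ex; exists (t alpha).
    move=> /cvg_seq_bounded [m0 [_ hm]]; exists (m0 + 1) => N.
    by apply: le_trans (ler_norm _) _; apply: (hm (m0 + 1)) => //; rewrite ltrDl.
  have A2 : 0 < r1 ^+ 2 < rho ^+ 2.
    by rewrite exprn_gt0 /= ?ltrXn2r ?nnegrE //; lra.
  have cr N : critical 0 (beta N) (t (beta N) ^+ 2)^-1 (t (beta N)).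
    exact: critical_marchenko_pastur.
  apply: filterS (trace_process_edge TP b0 isT cr zA hm A2) => w hw.
  near=> N => y y1.
  have N0 : 0 < N%:R :> R by rewrite ltr0n; near: N; exists 1%N.
  have : 2 * N%:R * (complex.Re (\tr ((Y N w *m adj (Y N w)) ^+ half_pow N)) / N%:R)
      <= (rho ^+ 2) ^+ half_pow N by near: N.
  have r0 : 0 <= rho by lra.
  rewrite /half_pow; set k := (_./2)%N => h.
  apply: (@hermitian_edge_upper _ _ _ k _ (adj_chiral_block _) r0 _ y y1).
  have kE : (2 ^ k.+1 = (2 ^ k).-1.+1.*2)%N.
    by rewrite prednK ?expn_gt0 // expnS mul2n.
  (* The block to the power [2 ^ k.+1] has twice the trace of [Y *m adj Y] to the power [2 ^ k]:
     this is the factor 2 in [trace_process_edge]. *)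
  rewrite {1}kE chiral_block_trace_even prednK ?expn_gt0 // expnS exprM.
  by move: h; rewrite mulrACA divff ?gt_eqF // mulr1.
have [k k0 /= hk] := mom_growth_sqrt a0 hrho.
have : {ae Pr, forall w, forall a, complex.Re (\tr ((Y N w *m adj (Y N w)) ^+ a)) / N%:R
    @[N --> \oo] --> mom 0 alpha a}.
  by apply: ae_foralln => a; apply: (trace_process_lln TP b0); exact: cnu.
apply: filterS => w hw.
pose l j := if odd j then 0 else 2 * mom 0 alpha j./2.
apply: (hermitian_edge_lower (l := l) (k := k) (t := t alpha)) => //.
- by move=> N; exact: adj_chiral_block.
- move=> j j0; rewrite /l; case: ifP => oj.
    rewrite -(odd_double_half j) oj add1n.
    by under eq_fun do rewrite chiral_block_trace_odd mul0r; exact: cvg_cst.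
  have [i ->] : exists i, j = i.+1.*2.
    by exists j./2.-1; rewrite prednK; have := odd_double_half j; rewrite oj; lia.
  rewrite doubleK; under eq_fun do rewrite chiral_block_trace_even -mulrA.
  by apply: cvgM; [exact: cvg_cst | exact: hw].
- rewrite /l -doubleS /= !odd_double /= !doubleK /t; lra.
Unshelve. all: by end_near. Qed.

End ChiralEdge.

(** * Directional Hermitian parts and the limiting ellipse *)

Section Cartesian.
Context {R : realType}.
Local Notation C := R[i].

Lemma inner_real n (H : 'M[C]_n) y : adj H = H -> inner (H *m y) y = (rquad H y)%:C.
Proof.
move=> HH; have : Num.conj (inner (H *m y) y) = inner (H *m y) y.
  by rewrite -inner_conj -[in RHS]HH [RHS]innerMl adjK.
rewrite /rquad conjCE; case: (inner _ _) => a b /= [] /eqP; rewrite -subr_eq0 -opprD oppr_eq0.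
by rewrite -mulr2n mulrn_eq0 /= => /eqP ->.
Qed.

Lemma rquad_comb n (S K : 'M[C]_n) (a b : R) y :
  rquad (a%:C *: S + b%:C *: K) y = a * rquad S y + b * rquad K y.
Proof. by rewrite /rquad mulmxDl -!scalemxAl innerDl !innerZl ReD !ReZ. Qed.

Lemma rquad_scale n (H : 'M[C]_n) (a : R) y : rquad (a%:C *: H) y = a * rquad H y.
Proof. by rewrite /rquad -scalemxAl innerZl ReZ. Qed.

Lemma dot_cartesian n (S K : 'M[C]_n) y p q : adj S = S -> adj K = K ->
  dot (inner ((S + 'i *: K) *m y) y) (idir p q) =
    rquad ((p%:~R)%:C *: S + (q%:~R)%:C *: K) y.
Proof.
move=> SS KK; rewrite mulmxDl -scalemxAl innerDl innerZl !inner_real // rquad_comb.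
by rewrite /dot /idir /= /Num.imaginary /=; ring.
Qed.

Lemma scaler_comb2 (V : lmodType C) (a b s s' k k' : C) (u v : V) :
  a *: (s *: u + s' *: v) + b *: (k *: u + k' *: v) = (a * s + b * k) *: u + (a * s' + b * k') *: v.
Proof. by rewrite !scalerDr !scalerA addrACA -!scalerDl. Qed.

(** In the Cartesian decomposition [S + 'i *: K] both parts are instances of [elliptic_proj], with a
    real and an imaginary parameter, and real combinations of such instances are again of this
    form. *)
Lemma elliptic_cartesian (tau : R) N (G : 'M[C]_N) y p q :
  dot (inner (elliptic_mx tau G *m y) y) (idir p q) =
  rquad (elliptic_proj ((Num.sqrt (1 + tau) * p%:~R / 2) +i* (- (Num.sqrt (1 - tau) * q%:~R / 2))) G) y.
Proof.
set a := Num.sqrt (1 + tau); set b := Num.sqrt (1 - tau).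
pose S := elliptic_proj (a / 2)%:C G; pose K := elliptic_proj (0 +i* (- (b / 2))) G.
have -> : elliptic_mx tau G = S + 'i *: K.
  have i1 : 'i * (0 +i* (- (b / 2))) = (b / 2)%:C :> C.
    by apply/eqP; rewrite eq_complex /=; apply/andP; split; apply/eqP; ring.
  have i2 : 'i * Num.conj (0 +i* (- (b / 2))) = - (b / 2)%:C :> C.
    by rewrite conjCE; apply/eqP; rewrite eq_complex /=; apply/andP; split; apply/eqP; ring.
  rewrite /elliptic_mx /S /K /elliptic_proj -/a -/b -/(adj G); move: (adj G) => G'.
  rewrite conjcR; move: (a / 2)%:C (b / 2)%:C i1 i2 => a' b' i1 i2.
  by rewrite [in RHS]scalerDr [X in _ = _ + (X + _)]scalerA [X in _ = _ + (_ + X)]scalerA i1 i2 scaleNr scalerDr scalerBr.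
rewrite dot_cartesian; [|exact: adj_elliptic_proj|exact: adj_elliptic_proj].
apply: (f_equal (fun X => rquad X y)).
rewrite /S /K /elliptic_proj.
rewrite [LHS]scaler_comb2.
rewrite !conjCE.
congr (_ *: _ + _ *: _).
apply/eqP; rewrite eq_complex /=; apply/andP; split; apply/eqP; ring.
apply/eqP; rewrite eq_complex /=; apply/andP; split; apply/eqP; ring.
Qed.

Lemma chiral_cartesian (tau : R) N nu (P Q : 'M[C]_(N, N + nu)) y p q :
  dot (inner (chiral_elliptic_mx tau P Q *m y) y) (idir p q) =
  rquad (chiral_block ((Num.sqrt (1 + tau) * p%:~R)%:C *: P
     + (0 +i* (- (Num.sqrt (1 - tau) * q%:~R))) *: Q)) y.
Proof.
set a := Num.sqrt (1 + tau); set b := Num.sqrt (1 - tau).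
pose S := chiral_block (a%:C *: P); pose K := chiral_block ((0 +i* (- b)) *: Q).
have -> : chiral_elliptic_mx tau P Q = S + 'i *: K.
  have i1 : 'i * (0 +i* (- b)) = b%:C :> C.
    by apply/eqP; rewrite eq_complex /=; apply/andP; split; apply/eqP; ring.
  have i2 : 'i * Num.conj (0 +i* (- b)) = - b%:C :> C.
    by rewrite conjCE; apply/eqP; rewrite eq_complex /=; apply/andP; split; apply/eqP; ring.
  rewrite /chiral_elliptic_mx -/a -/b /S /K /chiral_block scale_block_mx add_block_mx.
  have i3 : Num.conj (- b%:C) = - b%:C :> C by rewrite -raddfN /= conjcR.
  by rewrite !scaler0 !addr0 -/(adj _) -scaleNr adjD !adjZ !scalerA i1 i2 i3 !conjcR.
rewrite dot_cartesian; [|exact: adj_chiral_block|exact: adj_chiral_block].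
apply: (f_equal (fun X => rquad X y)).
rewrite /S /K /chiral_block !scale_block_mx add_block_mx.
have p1 : (p%:~R)%:C * a%:C = (a * p%:~R)%:C :> C by rewrite -realcM mulrC.
have p2 : (q%:~R)%:C * (0 +i* (- b)) = 0 +i* (- (b * q%:~R)) :> C.
  by apply/eqP; rewrite eq_complex /=; apply/andP; split; apply/eqP; ring.
have p3 : (q%:~R)%:C * Num.conj (0 +i* (- b)) = Num.conj (0 +i* (- (b * q%:~R))) :> C.
  by rewrite !conjCE; apply/eqP; rewrite eq_complex /=; apply/andP; split; apply/eqP; ring.
by rewrite !scaler0 !addr0 adjD !adjZ !scalerA !conjcR p1 p2 p3.
Qed.

End Cartesian.

(** * The ellipse and its support function *)

Section Ellipse.
Context {R : realType} (a b : R).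
Hypotheses (a_gt0 : 0 < a) (b_ge0 : 0 <= b).
Local Notation C := R[i].

Lemma ellipse_cconvex : cconvex (ellipse a b).
Proof.
move=> [x1 x2] [y1 y2] t /andP[t0 t1]; rewrite /ellipse; case: eqP => [b0|/eqP b0] /=.
  move=> [/andP[h1 h2] ->] [/andP[h3 h4] ->]; split; last by ring.
  by apply/andP; split; nra.
rewrite !mul0r subr0 addr0.
set X1 := x1 / a; set X2 := x2 / b; set Y1 := y1 / a; set Y2 := y2 / b => hx hy.
have -> : (x1 + t * (y1 - x1)) / a = X1 + t * (Y1 - X1) by rewrite /X1 /Y1; ring.
have -> : (x2 + (t * (y2 - x2))) / b = X2 + t * (Y2 - X2) by rewrite /X2 /Y2; ring.
have t1' : 0 <= 1 - t by rewrite subr_ge0.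
have : 0 <= t * (1 - t) * ((X1 - Y1) ^+ 2 + (X2 - Y2) ^+ 2).
  by apply: mulr_ge0; [exact: mulr_ge0 | rewrite addr_ge0 ?sqr_ge0].
have := ler_wpM2l t0 hy.
have := ler_wpM2l t1' hx.
have -> : (X1 + t * (Y1 - X1)) ^+ 2 + (X2 + t * (Y2 - X2)) ^+ 2 = (1 - t) * (X1 ^+ 2 + X2 ^+ 2)
    + t * (Y1 ^+ 2 + Y2 ^+ 2) - t * (1 - t) * ((X1 - Y1) ^+ 2 + (X2 - Y2) ^+ 2) by ring.
move: (t * (1 - t) * _) (t * (Y1 ^+ 2 + _)) ((1 - t) * (X1 ^+ 2 + _)) => u1 u2 u3; lra.
Qed.

Lemma ellipse0 : ellipse a b 0.
Proof.
rewrite /ellipse; case: eqP => _ /=; last by rewrite !mul0r expr0n /= addr0.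
by split=> //; rewrite oppr_le0 ltW.
Qed.

Definition ellipse_support (p q : R) : R := Num.sqrt ((a * p) ^+ 2 + (b * q) ^+ 2).

Lemma dot_ellipse_le e p q : ellipse a b e -> dot e (p +i* q) <= ellipse_support p q.
Proof.
case: e => x y; rewrite /ellipse /dot /ellipse_support /=; case: eqP => [->|/eqP b0] /=.
  move=> [/andP[h1 h2] ->]; rewrite !mul0r expr0n /= !addr0 sqrtr_sqr normrM gtr0_norm //.
  apply: (le_trans (ler_norm _)); rewrite normrM ler_wpM2r //.
  by apply/ler_normlP; split; lra.
set X := x / a; set Y := y / b => h.
have -> : x = a * X by rewrite /X mulrC divfK // gt_eqF.
have -> : y = b * Y by rewrite /Y mulrC divfK.
apply: (le_trans (ler_norm _)); rewrite -sqrtr_sqr ler_wsqrtr //.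
apply: (@le_trans _ _ (((a * p) ^+ 2 + (b * q) ^+ 2) * (X ^+ 2 + Y ^+ 2))).
  rewrite -subr_ge0.
  have -> : ((a * p) ^+ 2 + (b * q) ^+ 2) * (X ^+ 2 + Y ^+ 2) - (a * X * p + b * Y * q) ^+ 2 =
     (a * p * Y - b * q * X) ^+ 2 by ring.
  exact: sqr_ge0.
by rewrite ler_piMr // addr_ge0 ?sqr_ge0.
Qed.

Lemma ellipse_support_attained p q :
  exists2 e, ellipse a b e & ellipse_support p q <= dot e (p +i* q).
Proof.
set s := ellipse_support p q; have [s0|s0] := eqVneq s 0.
  by exists 0; [exact: ellipse0 | rewrite s0 /dot /= !mul0r addr0].
have s2 : s ^+ 2 = (a * p) ^+ 2 + (b * q) ^+ 2 by rewrite sqr_sqrtr // addr_ge0 ?sqr_ge0.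
have sge : 0 < s by rewrite lt0r s0 sqrtr_ge0.
(* The equality case of Cauchy-Schwarz. For [b = 0] its second coordinate is 0, so it also lies on
   the degenerate ellipse. *)
exists ((a ^+ 2 * p / s) +i* (b ^+ 2 * q / s)); last first.
  rewrite /dot /=; have -> : a ^+ 2 * p / s * p + b ^+ 2 * q / s * q = s ^+ 2 / s.
    by rewrite s2; ring.
  by rewrite expr2 mulfK.
rewrite /ellipse; case: eqP => [b0|/eqP b0] /=; last first.
  have -> : (a ^+ 2 * p / s / a) ^+ 2 + (b ^+ 2 * q / s / b) ^+ 2 = ((a * p) ^+ 2 + (b * q) ^+ 2) / s ^+ 2.
    by field; rewrite s0 b0 gt_eqF.
  by rewrite -s2 divff // expf_neq0.
rewrite b0 expr0n !mul0r; split=> //.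
move: s2; rewrite b0 mul0r expr0n /= addr0 => s2.
have sE : s = a * `|p|.
  by rewrite /s /ellipse_support b0 mul0r expr0n addr0 sqrtr_sqr normrM gtr0_norm.
have -> : a ^+ 2 * p / s = a * ((a * p) / s) by field; rewrite s0.
have : `|(a * p) / s| <= 1.
  by rewrite normrM normfV normrM (gtr0_norm sge) (gtr0_norm a_gt0) -sE divff.
move: (a * p / s) a_gt0 => u a0 /ler_normlP[h1 h2].
by apply/andP; split; nra.
Qed.

End Ellipse.

(** * Convergence of the numerical ranges *)

Section Assembly.
Context {R : realType} d (T : measurableType d) (Pr : probability T R).
Local Notation C := R[i].

Lemma ae_forall_int2 (S : int -> int -> T -> Prop) :
  (forall p q, {ae Pr, forall w, S p q w}) -> {ae Pr, forall w, forall p q, S p q w}.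
Proof.
move=> h; pose S' n w := if unpickle n is Some (p, q) then S p q w else True.
have : {ae Pr, forall w, forall n, S' n w}.
  apply: ae_foralln => n; rewrite /S'; case: unpickle => [[p q]|]; [exact: h | exact: aeW].
by apply: filterS => w hw p q; have := hw (pickle (p, q)); rewrite /S' pickleK.
Qed.

(** [H p q] is the Hermitian part in direction [(p, q)] rescaled so that its edge [lam] is the same
    in all directions; the factor [c p q] carries the dependence on the direction. *)
Lemma numerical_range_cvg_ellipse (n : nat -> nat) (A : forall N, T -> 'M[C]_(n N)) (a b lam : R)
    (c : int -> int -> R) (H : int -> int -> forall N, T -> 'M[C]_(n N)) :
  0 < a -> 0 <= b -> (forall p q, 0 <= c p q) ->
  (forall p q, spectral_edge Pr (H p q) lam) ->
  (forall p q N w y, dot (inner (A N w *m y) y) (idir p q) = c p q * rquad (H p q N w) y) ->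
  (forall p q, c p q * lam = ellipse_support a b p%:~R q%:~R) ->
  {ae Pr, forall w, hausdorff_dist (numerical_range (A N w)) (ellipse a b) @[N --> \oo] --> 0%E}.
Proof.
move=> a0 b0 c0 HE dotE cE.
(* An edge tolerance that stays at most 1 after multiplication by [c p q], also when [c p q = 0]. *)
have e0 p q : 0 < (c p q + 1)^-1 by rewrite invr_gt0 ltr_wpDl.
have ce p q : c p q * (c p q + 1)^-1 <= 1.
  by rewrite ler_pdivrMr ?mul1r ?lerDl // ltr_wpDl.
have up p q : {ae Pr, forall w, \forall N \near \oo, forall y, nsq y = 1 ->
    rquad (H p q N w) y <= lam + (c p q + 1)^-1}.
  by apply: (HE p q).1; rewrite ltrDl.
have lo p q : {ae Pr, forall w, \forall N \near \oo, exists2 y, nsq y = 1 &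
    lam - (c p q + 1)^-1 < rquad (H p q N w) y}.
  by apply: (HE p q).2; rewrite gtrDl oppr_lt0.
apply: (filterS2 _ _ (ae_forall_int2 up) (ae_forall_int2 lo)) => w hu hl.
apply: (hausdorff_cvg (h := fun p q => ellipse_support a b p%:~R q%:~R)).
- by move=> N x y t t01; exact: numerical_range_convex.
- exact: ellipse_cconvex.
- by exists 0; exact: ellipse0.
- by move=> p q x; exact: dot_ellipse_le.
- by move=> p q; exact: ellipse_support_attained.
- move=> p q; apply: filterS (hu p q) => N hN _ [y /l2norm1 y1 <-].
  rewrite dotE -cE; apply: (le_trans (ler_wpM2l (c0 p q) (hN y y1))).
  by rewrite mulrDr lerD2l.
- move=> p q; apply: filterS (hl p q) => N [y y1 hy].
  exists (inner (A N w *m y) y); first by exists y => //; apply/l2norm1.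
  rewrite dotE -cE; apply: le_trans (ler_wpM2l (c0 p q) (ltW hy)).
  by rewrite mulrBr lerD2l lerN2.
Qed.

(** For the zero vector the factor is 0 and any vector of length [r] serves. This covers the
    direction [(0, 0)] and, at the ends of the range of [tau], a whole axis of directions. *)
Lemma normalise_direction (x y r : R) : 0 < r -> exists x' y',
  [/\ x' ^+ 2 + y' ^+ 2 = r ^+ 2, x = Num.sqrt (x ^+ 2 + y ^+ 2) / r * x'
    & y = Num.sqrt (x ^+ 2 + y ^+ 2) / r * y'].
Proof.
move=> r0; set s := Num.sqrt _.
have s2 : s ^+ 2 = x ^+ 2 + y ^+ 2 by rewrite sqr_sqrtr // addr_ge0 ?sqr_ge0.
have rn : r != 0 by rewrite gt_eqF.
have [s0|s0] := eqVneq s 0.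
  move: s2; rewrite s0 expr0n /= => /esym/eqP; rewrite paddr_eq0 ?sqr_ge0 // !sqrf_eq0.
  by move=> /andP[/eqP -> /eqP ->]; exists r, 0; rewrite !mul0r expr0n addr0.
exists (r * x / s), (r * y / s); split.
- have -> : (r * x / s) ^+ 2 + (r * y / s) ^+ 2 = r ^+ 2 * ((x ^+ 2 + y ^+ 2) / s ^+ 2) by field.
  by rewrite -s2 divff ?mulr1 // expf_neq0.
- by field; rewrite rn s0.
- by field; rewrite rn s0.
Qed.

End Assembly.

Lemma elliptic_proj_scale {R : realType} N (a x y : R) (G : 'M[R[i]]_N) :
  elliptic_proj ((a * x) +i* (a * y)) G = a%:C *: elliptic_proj (x +i* y) G.
Proof.
rewrite /elliptic_proj scalerDr !scalerA !conjCE.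
have -> : (a * x) +i* (a * y) = a%:C * (x +i* y) by apply/eqP; rewrite eq_complex /=; apply/andP; split; apply/eqP; ring.
congr (_ + _ *: _); apply/eqP; rewrite eq_complex /=; apply/andP; split; apply/eqP; ring.
Qed.

Lemma chiral_block_scale {R : realType} m n (a x y : R) (P Q : 'M[R[i]]_(m, n)) :
  chiral_block ((a * x)%:C *: P + (0 +i* (a * y)) *: Q) =
  a%:C *: chiral_block (x%:C *: P + (0 +i* y) *: Q).
Proof.
have -> : (a * x)%:C *: P + (0 +i* (a * y)) *: Q = a%:C *: (x%:C *: P + (0 +i* y) *: Q).
  rewrite scalerDr !scalerA -realcM; congr (_ + _ *: _).
  by apply/eqP; rewrite eq_complex /=; apply/andP; split; apply/eqP; ring.
by rewrite /chiral_block scale_block_mx !scaler0 adjZ conjcR.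
Qed.

Lemma elliptic_numerical_range_cvg {R : realType} (d : measure_display) (T : measurableType d)
    (Pr : probability T R) (tau : R) (G : forall N : nat, T -> 'M[R[i]]_N) : 0 <= tau <= 1 ->
  (forall N : nat, (0 < N)%N -> ginibre Pr (G N)) ->
  {ae Pr, forall w, hausdorff_dist (numerical_range (elliptic_mx tau (G N w)))
      (ellipse (Num.sqrt (2 * (1 + tau))) (Num.sqrt (2 * (1 - tau)))) @[N --> \oo] --> 0%E}.
Proof.
move=> /andP[tau0 tau1] gG.
pose X (p : int) := Num.sqrt (1 + tau) * p%:~R / 2.
pose Y (q : int) := - (Num.sqrt (1 - tau) * q%:~R / 2).
have r0 : 0 < (Num.sqrt 2)^-1 :> R by rewrite invr_gt0 sqrtr_gt0.
(* The radius is the inverse square root of 2, because [elliptic_edge] is normalised by squared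
   modulus 1/2. *)
pose c p q := Num.sqrt (X p ^+ 2 + Y q ^+ 2) / (Num.sqrt 2)^-1.
have HP p q : exists u : R * R, [/\ u.1 ^+ 2 + u.2 ^+ 2 = (Num.sqrt 2)^-1 ^+ 2,
    X p = c p q * u.1 & Y q = c p q * u.2].
  by have [x [y h]] := normalise_direction (X p) (Y q) r0; exists (x, y).
pose u p q := sval (cid (HP p q)).
have hu p q : [/\ (u p q).1 ^+ 2 + (u p q).2 ^+ 2 = (Num.sqrt 2)^-1 ^+ 2,
    X p = c p q * (u p q).1 & Y q = c p q * (u p q).2] := svalP (cid (HP p q)).
have c0 p q : 0 <= c p q by rewrite divr_ge0 ?sqrtr_ge0 // ltW.
have q1 : Num.sqrt (1 + tau) ^+ 2 = 1 + tau by rewrite sqr_sqrtr; lra.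
have q2 : Num.sqrt (1 - tau) ^+ 2 = 1 - tau by rewrite sqr_sqrtr; lra.
have q3 : Num.sqrt 2 ^+ 2 = 2 :> R by rewrite sqr_sqrtr.
have qc p q : Num.sqrt (X p ^+ 2 + Y q ^+ 2) ^+ 2 = X p ^+ 2 + Y q ^+ 2.
  by rewrite sqr_sqrtr // addr_ge0 ?sqr_ge0.
apply: (numerical_range_cvg_ellipse (c := c) (lam := 2)
  (H := fun p q N w => elliptic_proj ((u p q).1 +i* (u p q).2) (G N w))) => //.
- by rewrite sqrtr_gt0; lra.
- move=> p q; apply: elliptic_edge => //=; have [-> _ _] := hu p q.
  by rewrite exprVn sqr_sqrtr // div1r.
- move=> p q N w y; rewrite elliptic_cartesian -/(X p) -/(Y q).
  by have [_ -> ->] := hu p q; rewrite elliptic_proj_scale rquad_scale.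
- move=> p q; rewrite /ellipse_support -[LHS]ger0_norm; last by rewrite mulr_ge0.
  rewrite -sqrtr_sqr; congr Num.sqrt.
  transitivity (Num.sqrt (X p ^+ 2 + Y q ^+ 2) ^+ 2 * Num.sqrt 2 ^+ 2 * 4); first by rewrite /c invrK; ring.
  rewrite qc q3 !(exprMn _ (Num.sqrt (2 * _))) ?sqr_sqrtr; [|by rewrite mulr_ge0 //; lra|by rewrite mulr_ge0 //; lra].
  by rewrite /X /Y !(sqrrN, exprMn, exprVn) q1 q2; field.
Qed.

Lemma chiral_numerical_range_cvg {R : realType} (d : measure_display) (T : measurableType d)
    (Pr : probability T R) (tau : R) (nu : nat -> nat) (alpha : R)
    (P Q : forall N : nat, T -> 'M[R[i]]_(N, N + nu N)) : 0 <= tau <= 1 -> 0 <= alpha ->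
  (nu N)%:R / N%:R @[N --> \oo] --> alpha ->
  (forall N : nat, (0 < N)%N ->
     [/\ gaussian_mx Pr ((2 * N%:R)^-1) (P N), gaussian_mx Pr ((2 * N%:R)^-1) (Q N)
       & indep2 Pr (sigma_mx (P N)) (sigma_mx (Q N))]) ->
  {ae Pr, forall w, hausdorff_dist (numerical_range (chiral_elliptic_mx tau (P N w) (Q N w)))
      (ellipse (Num.sqrt (1 + tau) * (Num.sqrt (1 + alpha) + 1) / Num.sqrt 2)
               (Num.sqrt (1 - tau) * (Num.sqrt (1 + alpha) + 1) / Num.sqrt 2))
    @[N --> \oo] --> 0%E}.
Proof.
move=> /andP[tau0 tau1] a0 cnu gPQ.
pose X (p : int) := Num.sqrt (1 + tau) * p%:~R.
pose Y (q : int) := - (Num.sqrt (1 - tau) * q%:~R).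
have r0 : 0 < Num.sqrt 2 :> R by rewrite sqrtr_gt0.
pose c p q := Num.sqrt (X p ^+ 2 + Y q ^+ 2) / Num.sqrt 2.
have HP p q : exists u : R * R, [/\ u.1 ^+ 2 + u.2 ^+ 2 = Num.sqrt 2 ^+ 2,
    X p = c p q * u.1 & Y q = c p q * u.2].
  by have [x [y h]] := normalise_direction (X p) (Y q) r0; exists (x, y).
pose u p q := sval (cid (HP p q)).
have hu p q : [/\ (u p q).1 ^+ 2 + (u p q).2 ^+ 2 = Num.sqrt 2 ^+ 2,
    X p = c p q * (u p q).1 & Y q = c p q * (u p q).2] := svalP (cid (HP p q)).
have c0 p q : 0 <= c p q by rewrite divr_ge0 ?sqrtr_ge0 // ltW.
have t0 : 0 < Num.sqrt (1 + alpha) + 1 by rewrite ltr_wpDl // sqrtr_ge0.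
have q1 : Num.sqrt (1 + tau) ^+ 2 = 1 + tau by rewrite sqr_sqrtr; lra.
have q2 : Num.sqrt (1 - tau) ^+ 2 = 1 - tau by rewrite sqr_sqrtr; lra.
have q3 : Num.sqrt 2 ^+ 2 = 2 :> R by rewrite sqr_sqrtr.
have qc p q : Num.sqrt (X p ^+ 2 + Y q ^+ 2) ^+ 2 = X p ^+ 2 + Y q ^+ 2.
  by rewrite sqr_sqrtr // addr_ge0 ?sqr_ge0.
apply: (numerical_range_cvg_ellipse (c := c) (lam := 1 + Num.sqrt (1 + alpha))
  (H := fun p q N w => chiral_block ((u p q).1%:C *: P N w + (0 +i* (u p q).2) *: Q N w))) => //.
- by rewrite divr_gt0 // mulr_gt0 // sqrtr_gt0; lra.
- move=> p q; apply: (chiral_edge a0 cnu gPQ) => /=; have [h _ _] := hu p q.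
  by rewrite expr0n /= addr0 add0r h sqr_sqrtr.
- move=> p q N w y; rewrite chiral_cartesian -/(X p) -/(Y q).
  by have [_ -> ->] := hu p q; rewrite chiral_block_scale rquad_scale.
- move=> p q; rewrite /ellipse_support -[LHS]ger0_norm; last first.
    by rewrite mulr_ge0 // addrC ltW.
  rewrite -sqrtr_sqr [1 + Num.sqrt (1 + alpha)]addrC; congr Num.sqrt; move: (_ + 1) => t.
  transitivity (Num.sqrt (X p ^+ 2 + Y q ^+ 2) ^+ 2 / Num.sqrt 2 ^+ 2 * t ^+ 2).
    by rewrite /c -exprVn; ring.
  by rewrite qc /X /Y !(sqrrN, exprMn, exprVn) q1 q2 q3; field.
Qed.

Theorem theorem1p1 (R : realType) (d : measure_display) (T : measurableType d)
    (Pr : probability T R) (tau : R) (htau : 0 <= tau <= 1) :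
  (forall G : forall N : nat, T -> 'M[R[i]]_N,
     (forall N : nat, (0 < N)%N -> ginibre Pr (G N)) ->
     {ae Pr, forall w : T,
        hausdorff_dist (numerical_range (elliptic_mx tau (G N w)))
          (ellipse (Num.sqrt (2 * (1 + tau))) (Num.sqrt (2 * (1 - tau))))
        @[N --> \oo] --> 0%E})
  /\
  (forall (nu : nat -> nat) (alpha : R),
     0 <= alpha ->
     (nu N)%:R / N%:R @[N --> \oo] --> alpha ->
     forall P Q : forall N : nat, T -> 'M[R[i]]_(N, N + nu N),
     (forall N : nat, (0 < N)%N ->
        [/\ gaussian_mx Pr ((2 * N%:R)^-1) (P N),
            gaussian_mx Pr ((2 * N%:R)^-1) (Q N)
          & indep2 Pr (sigma_mx (P N)) (sigma_mx (Q N))]) ->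
     {ae Pr, forall w : T,
        hausdorff_dist (numerical_range (chiral_elliptic_mx tau (P N w) (Q N w)))
          (ellipse
             (Num.sqrt (1 + tau) * (Num.sqrt (1 + alpha) + 1) / Num.sqrt 2)
             (Num.sqrt (1 - tau) * (Num.sqrt (1 + alpha) + 1) / Num.sqrt 2))
        @[N --> \oo] --> 0%E}).
Proof.
split=> [G gG|nu alpha a0 cnu P Q gPQ]; first exact: elliptic_numerical_range_cvg.
exact: chiral_numerical_range_cvg.
Qed.
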